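(* In the setting described in the context, for $K\to\infty$ we have $|u_K-v_K|\to0$ uniformly in $G$. Moreover, let $\tau\in(0,1)$; if $\omega(t)=t^{\tau}$, then there exist constants $\xi\in(0,1)$, depending only on $\tau,d,K_0,\delta$, and $N\in(0,\infty)$, depending only on $\tau,d,K_0,\delta,G$, such that, if $K\ge N$, then $$|u_K-v_K|\le NK^{-\xi}$$ in $G$.
   Context: Fix $\delta\in(0,1)$, $K_0\in[0,\infty)$. $\mathbb S$ is the set of symmetric $d\times d$ matrices and, for $\kappa\in(0,1)$, $\mathbb S_\kappa=\{a\in\mathbb S:\kappa|\xi|^2\le a_{ij}\xi^i\xi^j\le\kappa^{-1}|\xi|^2\ \forall\xi\in\mathbb R^d\}$ (summation convention throughout). $A,B$ are separable metric spaces. For $(\alpha,\beta,x)\in A\times B\times\mathbb R^d$ we are given $a^{\alpha\beta}(x)\in\mathbb S_\delta$, $b^{\alpha\beta}(x)\in\mathbb R^d$, $c^{\alpha\beta}(x)\ge0$, $f^{\alpha\beta}(x)\in\mathbb R$, and $g:\mathbb R^d\to\mathbb R$. Set $$L^{\alpha\beta}u=a^{\alpha\beta}_{ij}D_{ij}u+b^{\alpha\beta}_iD_iu-c^{\alpha\beta}u,\qquad F[u](x)=\sup_{\alpha\in A}\inf_{\beta\in B}\big[L^{\alpha\beta}u(x)+f^{\alpha\beta}(x)\big].$$ Standing assumptions, with $\gamma=\frac{4-3\chi}{8-4\chi}$ and $\chi\in(0,1)$ a constant depending only on $d,\delta$ specified below: (1) $a,b,c,f$ are continuous in $\beta$ for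 each $(\alpha,x)$, and continuous in $\alpha$ uniformly with respect to $\beta$ for each $x$; $\|g\|_{C^{1,1}(\mathbb R^d)}\le K_0$. (2) $\|a^{\alpha\beta}(x)\|,|b^{\alpha\beta}(x)|,|c^{\alpha\beta}(x)|,|f^{\alpha\beta}(x)|\le K_0$, where $\|\sigma\|^2=\mathrm{tr}\,\sigma\sigma^*$. (3) $\|a^{\alpha\beta}(x)-a^{\alpha\beta}(y)\|\le K_0|x-y|^\gamma$ and $|u^{\alpha\beta}(x)-u^{\alpha\beta}(y)|\le K_0\,\omega(|x-y|)$ for $u=b,c,f$, where $\omega$ is a fixed continuous increasing function on $[0,\infty)$ with $\omega(0)=0$. $G\subset\mathbb R^d$ is a fixed bounded domain of class $C^2$. The function $P$: once $d,K_0,\delta$ are given, one fixes a convex, positively homogeneous of degree one, Lipschitz continuous function $P(u_{ij},u_i,u)$ on $\mathbb S\times\mathbb R^d\times\mathbb R$ (constructed by Krylov, 2012) such that at all points of differentiability $(P_{u_{ij}})\in\mathbb S_{\hat\delta}$, $|(P_{u_i})|\le K_1$, $0>P_u\ge-K_1$, where $\hat\delta\in(0,\delta)$ depends only on $d,\delta$ and $K_1\ge K_0$ depends only on $d,K_0,\delta$; moreover $P(u_{ij},0,0)\le P(u_{ij},u_i,0)\le P(u_{ij},u_i,u)+K_1u_+$. Write $P[u](x)=P(D_{ij}u(x),D_iu(x),u(x))$. It is known that for this $P$ and any $K\ge0$ each of the equations $$\max(F[u],P[u]-K)=0,\qquad \min(F[v],-P[-v]+K)=0$$ in $G$ (understood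 almost everywhere), with boundary condition $u=v=g$ on $\partial G$, has a unique solution in $C^{1,1}_{loc}(G)\cap C(\bar G)$. These solutions are denoted $u_K$ and $v_K$, respectively. The constant $\chi$: with $G_\varepsilon=\{x\in G:\mathrm{dist}(x,\partial G)>\varepsilon\}$ and $$\|u\|_{C^{1+\chi}(G)}=\sup_G|u|+\sup_{x\ne y\in G}\frac{|u(x)-u(y)|}{|x-y|}+\sup_{x\ne y\in G}\frac{|Du(x)-Du(y)|}{|x-y|^\chi},$$ $\chi\in(0,1)$ is a fixed constant depending only on $d,\delta$ with the property that (under the assumptions above with $\gamma$ defined through this $\chi$) there is a constant $N_0$ depending only on $K_0,\delta,d,G$ such that $\|u_K,v_K\|_{C^{1+\chi}(G_\varepsilon)}\le N_0\varepsilon^{-1-\chi}$ for all $K\ge0$ and $\varepsilon\in(0,1]$ with $G_\varepsilon\ne\emptyset$. *)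

(* Defs.v *)
From HB Require Import structures.
From mathcomp Require Import all_boot all_order all_algebra.
From mathcomp Require Import all_classical all_reals all_analysis.

Set Implicit Arguments.
Unset Strict Implicit.
Unset Printing Implicit Defensive.

Import Order.TTheory GRing.Theory Num.Theory.
Import numFieldNormedType.Exports.

Local Open Scope classical_set_scope.
Local Open Scope ring_scope.

(* Points of R^d are row vectors.  The library norm `|_| on 'rV and 'M is the
   max norm; it is used only where the choice of norm is immaterial (topology,
   unquantified Lipschitz constants, little-o).  Quantitative bounds use the
   Euclidean norm enorm and the Frobenius norm fnorm. *)

Section euclidean.
Context {R : realType} {d : nat}.
Implicit Types (x y : 'rV[R]_d) (a : 'M[R]_d).

Definition dotp x y : R := \sum_(i < d) x 0 i * y 0 i.

Definition enorm x : R := Num.sqrt (dotp x x).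

Definition fnorm a : R := Num.sqrt (\tr (a *m a^T)).

Definition elliptic (kappa : R) : set 'M[R]_d :=
  [set a | a^T = a /\
    forall xi : 'rV[R]_d,
      kappa * enorm xi ^+ 2 <= \sum_(i < d) \sum_(j < d) a i j * xi 0 i * xi 0 j
      <= kappa^-1 * enorm xi ^+ 2].

(* Zero d-dimensional Lebesgue (outer) measure: coverings by countably many
   boxes of arbitrarily small total volume. *)
Definition lebesgue_null (E : set 'rV[R]_d) : Prop :=
  forall e : R, 0 < e ->
  exists lo hi : nat -> 'rV[R]_d,
    [/\ forall k i, lo k 0 i <= hi k 0 i,
        E `<=` \bigcup_k [set x | forall i, lo k 0 i <= x 0 i <= hi k 0 i] &
        forall n, \sum_(k < n) \prod_(i < d) (hi k 0 i - lo k 0 i) <= e].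

Definition ae_in (G : set 'rV[R]_d) (Q : 'rV[R]_d -> Prop) : Prop :=
  exists2 E, lebesgue_null E & forall x, G x -> ~ E x -> Q x.

Definition frontier (G : set 'rV[R]_d) : set 'rV[R]_d := closure G `\` G°.

Definition dist_to (E : set 'rV[R]_d) x : R := inf [set enorm (x - y) | y in E].

Definition inner_set (G : set 'rV[R]_d) (eps : R) : set 'rV[R]_d :=
  [set x | G x /\ eps < dist_to (frontier G) x].

End euclidean.

Section calculus.
Context {R : realType} {d : nat}.
Implicit Types (u : 'rV[R]_d -> R) (x : 'rV[R]_d) (G : set 'rV[R]_d).

Definition partial (i : 'I_d) u x : R := 'D_(delta_mx 0 i) u x.

Definition grad u x : 'rV[R]_d := \row_i partial i u x.

Definition hess u x : 'M[R]_d := \matrix_(i, j) partial i (partial j u) x.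

Definition C1_on G u : Prop :=
  forall x, G x -> forall i,
    derivable u x (delta_mx 0 i) /\ {for x, continuous (partial i u)}.

Definition C2_on G u : Prop := C1_on G u /\ forall i, C1_on G (partial i u).

(* Local straightening of the boundary by a C^2 diffeomorphism psi : V -> W
   with inverse phi; the coordinate i plays the role of the normal one. *)
Definition C2_boundary G : Prop :=
  forall x0, frontier G x0 ->
  exists (V W : set 'rV[R]_d) (psi phi : 'rV[R]_d -> 'rV[R]_d) (i : 'I_d),
    [/\ open V /\ V x0, open W,
        (forall x, V x -> W (psi x) /\ phi (psi x) = x) /\
        (forall y, W y -> V (phi y) /\ psi (phi y) = y),
        (forall j, C2_on V (fun x => psi x 0 j)) /\
        (forall j, C2_on W (fun y => phi y 0 j)) &
        forall x, V x ->
          (G x <-> 0 < psi x 0 i) /\ (frontier G x <-> psi x 0 i = 0)].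

Definition C2_bounded_domain G : Prop :=
  [/\ G !=set0, open G, connected G, bounded_set G & C2_boundary G].

Definition C11loc G u : Prop :=
  (forall x, G x -> differentiable u x) /\
  (forall C, compact C -> C `<=` G -> [lipschitz grad u x | x in C]).

Definition offdiag G : set ('rV[R]_d * 'rV[R]_d) :=
  [set p | [/\ G p.1, G p.2 & p.1 <> p.2]].

Definition C1norm (chi : R) G u : \bar R :=
  (ereal_sup [set `|u x|%:E | x in G]
   + ereal_sup [set (`|u p.1 - u p.2| / enorm (p.1 - p.2))%:E
                | p in offdiag G]
   + ereal_sup [set (enorm (grad u p.1 - grad u p.2)
                     / enorm (p.1 - p.2) `^ chi)%:E | p in offdiag G])%E.

End calculus.

Section equation.
Context {R : realType} {d : nat}.

(* Triples (u_ij, u_i, u); the matrix component is meant to be symmetric. *)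
Definition jet := ('M[R]_d * 'rV[R]_d * R)%type.

Definition sym_jet : set jet := [set m | m.1.1^T = m.1.1].

Definition jet_of (u : 'rV[R]_d -> R) (x : 'rV[R]_d) : jet :=
  (hess u x, grad u x, u x).

Definition jet_pairing (p m : jet) : R :=
  \sum_(i < d) \sum_(j < d) p.1.1 i j * m.1.1 i j
  + dotp p.1.2 m.1.2 + p.2 * m.2.

(* p = (P_{u_ij}, P_{u_i}, P_u) at m.  P is a function on S x R^d x R, so only
   symmetric increments count and (P_{u_ij}) is the symmetric representative. *)
Definition is_jet_gradient (P : jet -> R) (m p : jet) : Prop :=
  sym_jet p /\
  forall e : R, 0 < e ->
    \forall h \near (0 : jet), sym_jet h ->
      `|P (m + h) - P m - jet_pairing p h| <= e * `|h|.

(* Values of P at non-symmetric matrices are irrelevant. *)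
Definition cutoff_function (deltahat K1 : R) (P : jet -> R) : Prop :=
  [/\ @convex_function R jet sym_jet P,
      (forall (t : R) m, 0 < t -> sym_jet m -> P (t *: m) = t * P m),
      [lipschitz P m | m in sym_jet],
      (forall m p, sym_jet m -> is_jet_gradient P m p ->
         [/\ elliptic deltahat p.1.1, enorm p.1.2 <= K1, p.2 < 0 & - K1 <= p.2]) &
      (forall (M : 'M[R]_d) (q : 'rV[R]_d) (z : R), M^T = M ->
         P (M, 0, 0) <= P (M, q, 0) /\
         P (M, q, 0) <= P (M, q, z) + K1 * Num.max z 0)].

Record coefficients (A B : Type) := Coefficients {
  coef_a : A -> B -> 'rV[R]_d -> 'M[R]_d;
  coef_b : A -> B -> 'rV[R]_d -> 'rV[R]_d;
  coef_c : A -> B -> 'rV[R]_d -> R;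
  coef_f : A -> B -> 'rV[R]_d -> R }.

Definition linear_op (A B : Type) (D : coefficients A B)
    (al : A) (be : B) (m : jet) (x : 'rV[R]_d) : R :=
  \sum_(i < d) \sum_(j < d) coef_a D al be x i j * m.1.1 i j
  + \sum_(i < d) coef_b D al be x 0 i * m.1.2 0 i
  - coef_c D al be x * m.2.

Definition isaacs (A B : Type) (D : coefficients A B)
    (u : 'rV[R]_d -> R) (x : 'rV[R]_d) : R :=
  sup (range (fun al : A => inf (range (fun be : B =>
    linear_op D al be (jet_of u x) x + coef_f D al be x)))).

Definition separable (T : topologicalType) : Prop :=
  exists2 S : set T, countable S & dense S.

Definition control_continuous (A B : metricType R) (V : normedModType R)
    (h : A -> B -> 'rV[R]_d -> V) : Prop :=
  forall x,
    (forall al, continuous (fun be => h al be x)) /\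
    (forall al0 (e : R), 0 < e ->
       \forall al \near al0, forall be, `|h al be x - h al0 be x| < e).

Definition modulus (omega : R -> R) : Prop :=
  [/\ {within `[0, +oo[, continuous omega},
      {in `[0, +oo[ &, {homo omega : s t / s <= t}} & omega 0 = 0].

Definition gamma_of (chi : R) : R := (4 - 3 * chi) / (8 - 4 * chi).

Definition admissible (delta chi K0 : R) (omega : R -> R) (A B : metricType R)
    (D : coefficients A B) (g : 'rV[R]_d -> R) : Prop :=
  let gamma := gamma_of chi in
  [/\ [/\ [set: A] !=set0, [set: B] !=set0, separable A & separable B],
      modulus omega,
      [/\ control_continuous (coef_a D), control_continuous (coef_b D),
          control_continuous (coef_c D), control_continuous (coef_f D) &
          (forall x, differentiable g x) /\
          (C1norm 1 [set: 'rV[R]_d] g <= K0%:E)%E],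
      forall al be x,
        [/\ elliptic delta (coef_a D al be x), 0 <= coef_c D al be x,
            fnorm (coef_a D al be x) <= K0, enorm (coef_b D al be x) <= K0 &
            `|coef_c D al be x| <= K0 /\ `|coef_f D al be x| <= K0] &
      forall al be x y,
        [/\ fnorm (coef_a D al be x - coef_a D al be y)
              <= K0 * enorm (x - y) `^ gamma,
            enorm (coef_b D al be x - coef_b D al be y)
              <= K0 * omega (enorm (x - y)),
            `|coef_c D al be x - coef_c D al be y|
              <= K0 * omega (enorm (x - y)) &
            `|coef_f D al be x - coef_f D al be y|
              <= K0 * omega (enorm (x - y))]].

(* C^{1,1}_loc(G) /\ C(closure G), with u = g on the boundary and the equation
   E u = 0 at almost every x, where u is twice differentiable. *)
Definition strong_solution (G : set 'rV[R]_d) (g : 'rV[R]_d -> R)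
    (E : ('rV[R]_d -> R) -> 'rV[R]_d -> R) (u : 'rV[R]_d -> R) : Prop :=
  [/\ C11loc G u, {within closure G, continuous u},
      forall x, frontier G x -> u x = g x &
      ae_in G (fun x => differentiable (grad u) x /\ E u x = 0)].

Definition solves_max (A B : Type) (D : coefficients A B) (P : jet -> R)
    (G : set 'rV[R]_d) (g : 'rV[R]_d -> R) (K : R) (u : 'rV[R]_d -> R) : Prop :=
  strong_solution G g
    (fun w x => Num.max (isaacs D w x) (P (jet_of w x) - K)) u.

Definition solves_min (A B : Type) (D : coefficients A B) (P : jet -> R)
    (G : set 'rV[R]_d) (g : 'rV[R]_d -> R) (K : R) (v : 'rV[R]_d -> R) : Prop :=
  strong_solution G g
    (fun w x => Num.min (isaacs D w x) (- P (jet_of (fun y => - w y) x) + K)) v.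

(* A solution only matters on closure G. *)
Definition exists_unique_on (G : set 'rV[R]_d)
    (S : ('rV[R]_d -> R) -> Prop) : Prop :=
  (exists u, S u) /\
  (forall u1 u2, S u1 -> S u2 -> forall x, closure G x -> u1 x = u2 x).

Definition uniquely_solvable (delta chi K0 : R) (P : jet -> R) : Prop :=
  forall (G : set 'rV[R]_d) (omega : R -> R) (A B : metricType R)
    (D : coefficients A B) (g : 'rV[R]_d -> R) (K : R),
    C2_bounded_domain G -> admissible delta chi K0 omega D g -> 0 <= K ->
    exists_unique_on G (solves_max D P G g K) /\
    exists_unique_on G (solves_min D P G g K).

Definition interior_C1chi_estimate (delta chi K0 : R) (P : jet -> R) : Prop :=
  forall G : set 'rV[R]_d, C2_bounded_domain G ->
  exists N0 : R,
  forall (omega : R -> R) (A B : metricType R)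
    (D : coefficients A B) (g : 'rV[R]_d -> R),
    admissible delta chi K0 omega D g ->
  forall (K eps : R) (u v : 'rV[R]_d -> R),
    0 <= K -> solves_max D P G g K u -> solves_min D P G g K v ->
    0 < eps <= 1 -> inner_set G eps !=set0 ->
    (C1norm chi (inner_set G eps) u <= (N0 * eps `^ (- 1 - chi))%:E)%E /\
    (C1norm chi (inner_set G eps) v <= (N0 * eps `^ (- 1 - chi))%:E)%E.

End equation.

Arguments jet : clear implicits.

(* Main.v *)
(** At almost every point, both u_K and v_K are sub- and supersolutions of the
    Isaacs equation, except where the cut-off operator is at least K.  Let h be
    a barrier with L h <= - c0 for all operators L in play, and suppose that
    U - V - lam h has a nonnegative maximum at a point z away from the boundary.
    Maximize
      U x - lam h x - V y - <DV z, x - y> - nu |x - y|^2 - kap |x - z|^2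
    near (z, z).  As DV is chi-Hoelder continuous near z, the maximum satisfies
    |x - y| = O(r^chi / nu), where r is the radius of the neighborhood.  Small
    linear perturbations (Jensen's lemma) move x and y off the exceptional null
    sets.  The Hessians at x and y have upper bounds of order nu, so the cut-off
    operator stays below K if K is large compared with nu, and the Isaacs
    inequalities hold.  Their difference contradicts lam c0 > 0, because
    coupling the two diffusion matrices costs only O(nu |x - y|^(2 gamma)), and
    gamma is such that this tends to 0 with r for a suitable nu = nu(r).  Close
    to the boundary, U - V is small by barriers from exterior balls. *)
Require Import Defs.
From HB Require Import structures.
From mathcomp Require Import all_boot all_order all_algebra.
From mathcomp Require Import all_classical all_reals all_analysis.
From mathcomp Require Import ring lra.
Import Order.TTheory GRing.Theory Num.Theory.
Import numFieldNormedType.Exports.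
Local Open Scope classical_set_scope.
Local Open Scope ring_scope.
Set Implicit Arguments.
Unset Strict Implicit.
Unset Printing Implicit Defensive.

(** * Euclidean geometry and quadratic forms *)

(** The bounds uniform in K are the interior C^(1+chi) estimate and the boundary estimate. The
    C^(1,1) constants of u_K and v_K on compact sets may blow up with K; they enter only
    qualitatively, to show that perturbed maxima cannot all lie in a null set. The cut-off function
    is not differentiable everywhere, so its values are read off from nearby points of
    differentiability, where homogeneity makes it a linear operator of the same class. Origin of the
    threshold for gamma, up to constants: |x - y| is at most t = r^chi / nu, and keeping x near z
    costs kap = r^(2 chi - 2) / nu, which must be small, so nu has to exceed r^(2 chi - 2). At this
    borderline t = r^(2 - chi), and nu t^(2 gamma) tends to 0 exactly when gamma > (1 - chi) / (2 -
    chi). The given gamma exceeds this by chi / (8 - 4 chi); the margin pays for a slightly larger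
    nu, for the growth of the Hoelder norm near the boundary, and for a rate. A much larger nu is
    harmful: as 2 gamma < 1, nu t^(2 gamma) grows with nu. *)

Section euclidean_algebra.
Context {R : realType} {d : nat}.
Implicit Types (x y z : 'rV[R]_d) (M Q S : 'M[R]_d) (t : R).

Lemma dotpC x y : dotp x y = dotp y x.
Proof. by apply: eq_bigr => i _; rewrite mulrC. Qed.

Lemma dotpDl x y z : dotp (x + y) z = dotp x z + dotp y z.
Proof. by rewrite -big_split; apply: eq_bigr => i _; rewrite mxE mulrDl. Qed.

Lemma dotpZl t x y : dotp (t *: x) y = t * dotp x y.
Proof. by rewrite mulr_sumr; apply: eq_bigr => i _; rewrite mxE mulrA. Qed.

Lemma dotpNl x y : dotp (- x) y = - dotp x y.
Proof. by rewrite -scaleN1r dotpZl mulN1r. Qed.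

Lemma dotpBl x y z : dotp (x - y) z = dotp x z - dotp y z.
Proof. by rewrite dotpDl dotpNl. Qed.

Lemma dotpDr x y z : dotp x (y + z) = dotp x y + dotp x z.
Proof. by rewrite dotpC dotpDl !(dotpC x). Qed.

Lemma dotpZr t x y : dotp x (t *: y) = t * dotp x y.
Proof. by rewrite dotpC dotpZl dotpC. Qed.

Lemma dotpNr x y : dotp x (- y) = - dotp x y.
Proof. by rewrite dotpC dotpNl dotpC. Qed.

Lemma dotpBr x y z : dotp x (y - z) = dotp x y - dotp x z.
Proof. by rewrite dotpDr dotpNr. Qed.

Lemma dotp0l x : dotp 0 x = 0.
Proof. by rewrite -(scale0r 0) dotpZl mul0r. Qed.

Lemma dotp0r x : dotp x 0 = 0.
Proof. by rewrite dotpC dotp0l. Qed.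

Definition dotpE := (dotpDl, dotpDr, dotpNl, dotpNr, dotpZl, dotpZr,
  dotp0l, dotp0r).

Lemma dotp_delta x i : dotp x (delta_mx 0 i) = x 0 i.
Proof.
rewrite /dotp (bigD1 i) //= mxE !eqxx mulr1 big1 ?addr0 // => j ji.
by rewrite mxE (negbTE ji) andbF mulr0.
Qed.

Lemma dotp_mulmx M x y : dotp (x *m M) y = dotp x (y *m M^T).
Proof.
have E u v : dotp u v = (u *m v^T) 0 0.
  by rewrite mxE; apply: eq_bigr => i _; rewrite mxE.
by rewrite !E trmx_mul trmxK mulmxA.
Qed.

Lemma dotpxx_ge0 x : 0 <= dotp x x.
Proof. by apply: sumr_ge0 => i _; rewrite -expr2 sqr_ge0. Qed.

Lemma dotpxx_eq0 x : dotp x x = 0 -> x = 0.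
Proof.
move=> /psumr_eq0P h; apply/rowP => i; rewrite mxE.
have := h _ i isT; rewrite -expr2 => /(_ (fun j _ => sqr_ge0 _)).
by move/eqP; rewrite sqrf_eq0 => /eqP.
Qed.

Lemma enorm_ge0 x : 0 <= enorm x.
Proof. exact: sqrtr_ge0. Qed.

Lemma enormE x : enorm x ^+ 2 = dotp x x.
Proof. by rewrite sqr_sqrtr ?dotpxx_ge0. Qed.

Lemma enorm0 : enorm (0 : 'rV[R]_d) = 0.
Proof. by rewrite /enorm dotp0l sqrtr0. Qed.

Lemma enorm_eq0 x : enorm x = 0 -> x = 0.
Proof. by move=> h; apply: dotpxx_eq0; rewrite -enormE h expr0n. Qed.

Lemma enorm_gt0 x : x <> 0 -> 0 < enorm x.
Proof.
by rewrite lt_neqAle enorm_ge0 andbT eq_sym => h; apply/eqP => /enorm_eq0.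
Qed.

Lemma enormN x : enorm (- x) = enorm x.
Proof. by rewrite /enorm dotpNl dotpNr opprK. Qed.

Lemma enormC x y : enorm (x - y) = enorm (y - x).
Proof. by rewrite -enormN opprB. Qed.

Lemma enormZ t x : enorm (t *: x) = `|t| * enorm x.
Proof.
by rewrite /enorm dotpZl dotpZr mulrA -expr2 sqrtrM ?sqr_ge0 // sqrtr_sqr.
Qed.

Lemma dotp_CS2 x y : dotp x y ^+ 2 <= dotp x x * dotp y y.
Proof.
have [/dotpxx_eq0->|/eqP y0] := eqVneq (dotp y y) 0.
  by rewrite !dotp0r expr0n mulr0.
have yy : 0 < dotp y y by rewrite lt_neqAle dotpxx_ge0 andbT eq_sym; apply/eqP.
have := dotpxx_ge0 (dotp y y *: x - dotp x y *: y).
rewrite !dotpE (dotpC y x) => h.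
rewrite -subr_ge0 -(pmulr_rge0 _ yy).
by apply: le_trans h _; rewrite le_eqVlt; apply/orP; left; apply/eqP; ring.
Qed.

Lemma dotp_CS x y : `|dotp x y| <= enorm x * enorm y.
Proof.
rewrite -(@ler_pXn2r _ 2) // ?nnegrE ?mulr_ge0 ?enorm_ge0 //.
by rewrite exprMn !enormE real_normK ?num_real ?dotp_CS2.
Qed.

Lemma dotp_le x y : dotp x y <= enorm x * enorm y.
Proof. exact: le_trans (ler_norm _) (dotp_CS x y). Qed.

Lemma enormD x y : enorm (x + y) <= enorm x + enorm y.
Proof.
rewrite -(@ler_pXn2r _ 2) // ?nnegrE ?addr_ge0 ?enorm_ge0 //.
rewrite sqrrD !enormE !dotpE (dotpC y x).
have := dotp_le x y; lra.
Qed.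

Lemma enormB x y : enorm (x - y) <= enorm x + enorm y.
Proof. by rewrite -(enormN y) enormD. Qed.

Lemma enorm_triangle z x y : enorm (x - y) <= enorm (x - z) + enorm (z - y).
Proof. by have := enormD (x - z) (z - y); rewrite addrA subrK. Qed.

Lemma coord_le_enorm x i : `|x 0 i| <= enorm x.
Proof.
rewrite -(@ler_pXn2r _ 2) // ?nnegrE ?enorm_ge0 // enormE.
rewrite real_normK ?num_real // /dotp (bigD1 i) //= -expr2 lerDl.
by apply: sumr_ge0 => j _; rewrite -expr2 sqr_ge0.
Qed.

Lemma enorm_le_sum x : enorm x <= \sum_i `|x 0 i|.
Proof.
rewrite -(@ler_pXn2r _ 2) // ?nnegrE ?enorm_ge0 ?sumr_ge0 // enormE.
rewrite expr2 mulr_suml; apply: ler_sum => i _.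
rewrite -expr2 -real_normK ?num_real // expr2 ler_wpM2l //.
by rewrite (bigD1 i) //= lerDl sumr_ge0.
Qed.

Definition qform M x y : R := dotp (x *m M) y.

Lemma qformE M x y :
  qform M x y = \sum_(i < d) \sum_(j < d) M i j * x 0 i * y 0 j.
Proof.
rewrite /qform /dotp exchange_big /=; apply: eq_bigr => j _.
by rewrite mxE mulr_suml; apply: eq_bigr => i _; rewrite (mulrC (x 0 i)).
Qed.

Lemma qformDl M x y z : qform M (x + y) z = qform M x z + qform M y z.
Proof. by rewrite /qform mulmxDl dotpDl. Qed.
Lemma qformDr M x y z : qform M x (y + z) = qform M x y + qform M x z.
Proof. exact: dotpDr. Qed.
Lemma qformZl M t x y : qform M (t *: x) y = t * qform M x y.
Proof. by rewrite /qform -scalemxAl dotpZl. Qed.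
Lemma qformZr M t x y : qform M x (t *: y) = t * qform M x y.
Proof. exact: dotpZr. Qed.
Lemma qformDm M S x y : qform (M + S) x y = qform M x y + qform S x y.
Proof. by rewrite /qform mulmxDr dotpDl. Qed.
Lemma qformZm M t x y : qform (t *: M) x y = t * qform M x y.
Proof. by rewrite /qform -scalemxAr dotpZl. Qed.
Lemma qformNm M x y : qform (- M) x y = - qform M x y.
Proof. by rewrite -scaleN1r qformZm mulN1r. Qed.
Lemma qform1 x y : qform 1%:M x y = dotp x y.
Proof. by rewrite /qform mulmx1. Qed.
Lemma qform_delta M i j : qform M (delta_mx 0 i) (delta_mx 0 j) = M i j.
Proof. by rewrite /qform dotp_delta -rowE mxE. Qed.
Lemma qformC M x y : M^T = M -> qform M x y = qform M y x.
Proof. by move=> h; rewrite /qform dotp_mulmx h dotpC. Qed.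

Definition qfE := (qformDl, qformDr, qformZl, qformZr, qformDm, qformZm,
  qformNm, qform1).

Definition frob M S : R := \sum_(i < d) \sum_(j < d) M i j * S i j.

Lemma frobDl M Q S : frob (M + Q) S = frob M S + frob Q S.
Proof.
rewrite -big_split; apply: eq_bigr => i _; rewrite -big_split.
by apply: eq_bigr => j _; rewrite mxE mulrDl.
Qed.
Lemma frobZl t M S : frob (t *: M) S = t * frob M S.
Proof.
rewrite mulr_sumr; apply: eq_bigr => i _; rewrite mulr_sumr.
by apply: eq_bigr => j _; rewrite mxE mulrA.
Qed.
Lemma frobC M S : frob M S = frob S M.
Proof. by apply: eq_bigr => i _; apply: eq_bigr => j _; rewrite mulrC. Qed.
Lemma frobNl M S : frob (- M) S = - frob M S.
Proof. by rewrite -scaleN1r frobZl mulN1r. Qed.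
Lemma frobDr M Q S : frob S (M + Q) = frob S M + frob S Q.
Proof. by rewrite frobC frobDl !(frobC S). Qed.
Lemma frobZr t M S : frob S (t *: M) = t * frob S M.
Proof. by rewrite frobC frobZl frobC. Qed.
Lemma frobNr M S : frob S (- M) = - frob S M.
Proof. by rewrite frobC frobNl frobC. Qed.
Lemma frob1 M : frob M 1%:M = \tr M.
Proof.
apply: eq_bigr => i _; rewrite (bigD1 i) //= mxE eqxx mulr1 big1 ?addr0 //.
by move=> j ji; rewrite mxE eq_sym (negbTE ji) mulr0.
Qed.

Definition frobE := (frobDl, frobDr, frobNl, frobNr, frobZl, frobZr, frob1).

Lemma frob_tensor x y M : frob (x^T *m y) M = qform M x y.
Proof.
rewrite qformE; apply: eq_bigr => i _; apply: eq_bigr => j _.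
rewrite mxE big_ord_recl big_ord0 !mxE addr0; ring.
Qed.

(** This converts inequalities between quadratic forms, tested on the rows of [Q], into inequalities
    between traces. *)
Lemma frob_gram Q M : \sum_i qform M (row i Q) (row i Q) = frob (Q^T *m Q) M.
Proof.
have -> : Q^T *m Q = \sum_i (row i Q)^T *m row i Q.
  apply/matrixP => i j; rewrite mxE summxE; apply: eq_bigr => k _.
  by rewrite !mxE big_ord_recl big_ord0 !mxE addr0.
by rewrite frobC; elim/big_ind2: _ => [||i _];
  [rewrite frobC /frob big1 // => i _; rewrite big1 // => j _; rewrite mxE mul0r
  |move=> ? ? ? ? -> ->; rewrite frobDr|rewrite frobC frob_tensor].
Qed.

Lemma fnorm_sqr M : fnorm M ^+ 2 = frob M M.
Proof.
have h : \tr (M *m M^T) = frob M M.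
  by apply: eq_bigr => i _; rewrite mxE; apply: eq_bigr => j _; rewrite mxE.
rewrite sqr_sqrtr // h.
by apply: sumr_ge0 => i _; apply: sumr_ge0 => j _; rewrite -expr2 sqr_ge0.
Qed.

Lemma coord_le_fnorm M i j : `|M i j| <= fnorm M.
Proof.
rewrite -(@ler_pXn2r _ 2) // ?nnegrE ?sqrtr_ge0 // fnorm_sqr.
rewrite real_normK ?num_real // /frob (bigD1 i) //= (bigD1 j) //= -expr2 -addrA.
rewrite lerDl addr_ge0 //.
  by apply: sumr_ge0 => k _; rewrite -expr2 sqr_ge0.
by apply: sumr_ge0 => k _; apply: sumr_ge0 => l _; rewrite -expr2 sqr_ge0.
Qed.

Lemma mulmx_fnorm M x : dotp (x *m M) (x *m M) <= frob M M * dotp x x.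
Proof.
rewrite /frob exchange_big /= mulr_suml; apply: ler_sum => j _.
have -> : (x *m M) 0 j = dotp x (col j M)^T.
  by rewrite mxE; apply: eq_bigr => i _; rewrite !mxE.
rewrite -expr2 (le_trans (dotp_CS2 _ _)) // mulrC ler_wpM2r ?dotpxx_ge0 //.
by apply: ler_sum => i _; rewrite !mxE.
Qed.

Definition psd M : Prop := forall x, 0 <= qform M x x.

(** Testing on [s e_i + e_j] leaves [s^2 Q_ii + 2 s Q_ij], which takes negative values for small [s]
    of the right sign unless [Q_ij] vanishes. *)
Lemma psd_diag0 Q i j : Q^T = Q -> psd Q -> Q j j = 0 -> Q i j = 0.
Proof.
move=> Qs Qp Qj.
have h s : 0 <= s ^+ 2 * Q i i + 2 * s * Q i j.
  have := Qp (s *: delta_mx 0 i + delta_mx 0 j).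
  rewrite !qfE !qform_delta Qj addr0.
  have -> : Q j i = Q i j by rewrite -[in LHS]Qs mxE.
  by move=> h; apply: le_trans h _; rewrite le_eqVlt; apply/orP; left;
    apply/eqP; ring.
apply/eqP; apply: contraT => q0.
have Qi : 0 <= Q i i by have := Qp (delta_mx 0 i); rewrite qform_delta.
have Qi1 : Q i i + 1 != 0 by rewrite gt_eqF // ltr_wpDl.
(* The added 1 keeps the denominator positive when [Q i i] is 0. *)
have := h (- Q i j / (Q i i + 1)).
have -> : (- Q i j / (Q i i + 1)) ^+ 2 * Q i i
   + 2 * (- Q i j / (Q i i + 1)) * Q i j
  = - (Q i j / (Q i i + 1)) ^+ 2 * (Q i i + 2) by field.
rewrite leNgt mulNr oppr_lt0 mulr_gt0 // ?exprn_even_gt0 //=; last lra.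
by rewrite mulf_neq0 ?invr_eq0.
Qed.

Lemma qform_tensor (u v x y : 'rV[R]_d) :
  qform (u^T *m v) x y = dotp x u * dotp v y.
Proof.
rewrite /qform mulmxA (mx11_scalar (x *m u^T)) mul_scalar_mx dotpZl.
by congr (_ * _); rewrite mxE; apply: eq_bigr => k _; rewrite mxE.
Qed.

(** Symmetric elimination in place of a spectral decomposition: subtracting the rank-one matrix
    built from a row with nonzero pivot leaves a nonnegative Schur complement with fewer nonzero
    diagonal entries, and the rank-one part pairs with [S] to a value of its form. *)
Lemma frob_psd_ge0 Q S : Q^T = Q -> psd Q -> psd S -> 0 <= frob Q S.
Proof.
have [n le_n] := ubnP #|[pred i | Q i i != 0]|.
elim: n Q le_n => // n IH Q le_n Qs Qp Sp.
have [i Qi|Q0] := pickP (fun i => Q i i != 0); last first.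
  suff -> : Q = 0.
    by rewrite /frob big1 // => i _; rewrite big1 // => j _; rewrite mxE mul0r.
  apply/matrixP => i j; rewrite mxE psd_diag0 //.
  by have /negbFE/eqP := Q0 j.
have Qi0 : 0 < Q i i.
  by rewrite lt_neqAle eq_sym Qi; have := Qp (delta_mx 0 i); rewrite qform_delta.
pose v := row i Q; pose Q' := Q - (Q i i)^-1 *: (v^T *m v).
have vE x : dotp v x = qform Q (delta_mx 0 i) x by rewrite /qform -rowE.
have Q'E x : qform Q' x x = qform Q x x - (Q i i)^-1 * dotp v x ^+ 2.
  by rewrite !qfE qform_tensor (dotpC x) expr2.
have Q's : Q'^T = Q'.
  by rewrite linearB /= linearZ /= trmx_mul trmxK Qs.
have Q'p : psd Q'.
  move=> x; rewrite Q'E.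
  have := Qp (x - (dotp v x / Q i i) *: delta_mx 0 i).
  rewrite -scaleNr !qfE qform_delta (qformC x) // -vE => h.
  by apply: le_trans h _; rewrite le_eqVlt; apply/orP; left; apply/eqP; field.
have Q'0 j : Q j j = 0 -> Q' j j = 0.
  move=> Qj; rewrite -qform_delta Q'E qform_delta Qj vE qform_delta.
  by rewrite (@psd_diag0 Q i j) // expr0n mulr0 subr0.
have Q'i : Q' i i = 0.
  by rewrite -qform_delta Q'E qform_delta vE qform_delta; field.
have -> : frob Q S = frob Q' S + (Q i i)^-1 * qform S v v.
  by rewrite frobDl frobNl frobZl frob_tensor subrK.
rewrite addr_ge0 ?mulr_ge0 ?invr_ge0 ?(ltW Qi0) //.
apply: IH => //; rewrite -ltnS (leq_trans _ le_n) // ltnS proper_card //.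
apply/properP; split.
  apply/fintype.subsetP => j; rewrite !inE; apply: contraNneq => Qj.
  exact/eqP/Q'0.
by exists i; rewrite !inE ?Qi // Q'i eqxx.
Qed.

(** Pair [a] with the nonnegative matrix [nu I - M], then bound the trace of [a]. Only an upper
    bound on [M] is used, which is all that a maximum provides. *)
Lemma frob_le_elliptic (kappa nu : R) (a M : 'M[R]_d) :
  0 < kappa -> elliptic kappa a -> 0 <= nu ->
  (forall x, qform M x x <= nu * dotp x x) -> frob a M <= d%:R * nu / kappa.
Proof.
move=> k0 [asym ae] nu0 hM.
have ap : psd a.
  move=> x; rewrite qformE; have /andP[h _] := ae x; apply: le_trans h.
  by rewrite mulr_ge0 ?sqr_ge0 // ltW.
have : 0 <= frob a (nu *: 1%:M - M).
  by apply: frob_psd_ge0 => // x; rewrite !qfE subr_ge0.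
rewrite !frobE subr_ge0 => h; apply: le_trans h _.
rewrite (mulrC _ nu) -mulrA ler_wpM2l //.
rewrite -[X in X%:R]card_ord -sum1_card natr_sum mulr_suml /mxtrace.
apply: ler_sum => i _; have /andP[_] := ae (delta_mx 0 i).
by rewrite -qformE qform_delta enormE dotp_delta mxE !eqxx mulr1 mul1r.
Qed.

(* With h = (a - a') / 2 there is one matrix C such that
   a = C + (k / 2) (h / k + 1)^2 and a' = C + (k / 2) (h / k - 1)^2; it is
   nonnegative because h^2 <= dl k and k <= dl.  The two roots differ by 2, so
   the Hessian inequality is tested on pairs of rows at distance 2. *)
Lemma coupling_frob (a a' A B : 'M[R]_d) (dl k nu : R) :
  a^T = a -> a'^T = a' -> 0 <= nu -> 0 < k -> k <= dl ->
  (forall x, dl * dotp x x <= qform a x x) ->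
  (forall x, dl * dotp x x <= qform a' x x) ->
  frob (a - a') (a - a') <= 4 * dl * k ->
  (forall x y, qform A x x - qform B y y <= 2 * nu * dotp (x - y) (x - y)) ->
  frob a A - frob a' B <= 4 * nu * k * d%:R.
Proof.
move=> sa sa' nu0 k0 kd ea ea' hk hAB.
pose h := 2^-1 *: (a - a').
have hs : h^T = h by rewrite linearZ /= linearB /= sa sa'.
pose X := k^-1 *: h + 1%:M; pose Y := k^-1 *: h - 1%:M.
have Xs : X^T = X by rewrite linearD /= linearZ /= hs trmx1.
have Ys : Y^T = Y by rewrite linearB /= linearZ /= hs trmx1.
have XX : X^T *m X = k^-2 *: (h *m h) + (2 / k) *: h + 1%:M.
  rewrite Xs /X mulmxDl mulmxDr !mul1mx mulmx1 -scalemxAl -scalemxAr scalerA.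
  move: (h *m h) => w; apply/matrixP => i j; rewrite !mxE.
  have k_neq0 : k != 0 by rewrite gt_eqF.
  by case: (i == j) => /=; field.
have YY : Y^T *m Y = k^-2 *: (h *m h) - (2 / k) *: h + 1%:M.
  rewrite Ys /Y mulmxBl mulmxBr !mul1mx mulmx1 -scalemxAl -scalemxAr scalerA.
  move: (h *m h) => w; apply/matrixP => i j; rewrite !mxE.
  have k_neq0 : k != 0 by rewrite gt_eqF.
  by case: (i == j) => /=; field.
pose C := 2^-1 *: (a + a') - (2 * k)^-1 *: (h *m h) - (k / 2) *: 1%:M.
have aE : a = C + (k / 2) *: (X^T *m X).
  rewrite XX /C; move: (h *m h) => w; apply/matrixP => i j; rewrite !mxE.
  have k_neq0 : k != 0 by rewrite gt_eqF.
  by case: (i == j) => /=; field.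
have a'E : a' = C + (k / 2) *: (Y^T *m Y).
  rewrite YY /C; move: (h *m h) => w; apply/matrixP => i j; rewrite !mxE.
  have k_neq0 : k != 0 by rewrite gt_eqF.
  by case: (i == j) => /=; field.
have Cs : C^T = C.
  have : (h *m h)^T = h *m h by rewrite trmx_mul hs.
  rewrite /C; move: (h *m h) => w ws.
  have E i j : a i j = a j i by rewrite -[in LHS]sa mxE.
  have E' i j : a' i j = a' j i by rewrite -[in LHS]sa' mxE.
  have Ew i j : w i j = w j i by rewrite -[in LHS]ws mxE.
  by apply/matrixP => i j; rewrite !mxE E E' Ew eq_sym.
have Cp : psd C.
  move=> x; rewrite /C !qfE.
  have -> : qform (h *m h) x x = dotp (x *m h) (x *m h).
    by rewrite /qform mulmxA dotp_mulmx hs.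
  have := mulmx_fnorm h x; have := ea x; have := ea' x.
  rewrite [frob h h]frobZl frobZr => e1 e2 e3.
  have e4 : dotp (x *m h) (x *m h) <= dl * k * dotp x x.
    apply: le_trans e3 _; rewrite ler_wpM2r ?dotpxx_ge0 //; lra.
  have e5 : (2 * k)^-1 * dotp (x *m h) (x *m h) <= dl / 2 * dotp x x.
    rewrite mulrC ler_pdivrMr ?mulr_gt0 //; apply: le_trans e4 _.
    by rewrite le_eqVlt; apply/orP; left; apply/eqP; field.
  have e6 : k / 2 * dotp x x <= dl / 2 * dotp x x.
    by rewrite ler_wpM2r ?dotpxx_ge0 //; lra.
  lra.
(* On the common part [C] both forms are tested at the same vector, so the penalty vanishes. *)
have CAB : frob C A - frob C B <= 0.
  rewrite -subr_ge0 sub0r opprB -frobNr -frobDr.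
  apply: frob_psd_ge0 => // x; rewrite !qfE subr_ge0 -subr_le0.
  by have := hAB x x; rewrite subrr dotp0l mulr0.
clearbody C; rewrite aE a'E !frobDl !frobZl -!frob_gram.
have XY : \sum_i qform A (row i X) (row i X) - \sum_i qform B (row i Y) (row i Y)
    <= 8 * nu * d%:R.
  rewrite -sumrB (le_trans (ler_sum _ (fun i _ => hAB (row i X) (row i Y)))) //.
  rewrite -mulr_sumr -!mulrA mulrCA [leRHS]mulrCA ler_wpM2l //.
  have -> : \sum_i dotp (row i X - row i Y) (row i X - row i Y) = d%:R * 4 :> R.
    rewrite -[X in X%:R]card_ord -sum1_card natr_sum mulr_suml.
    apply: eq_bigr => i _.
    have -> : row i X - row i Y = 2%:R *: delta_mx 0 i.
      apply/rowP => j; rewrite !mxE eqxx /= [i == j]eq_sym; ring.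
    rewrite !dotpE dotp_delta mxE !eqxx /=; ring.
  lra.
have : (k / 2) * (\sum_i qform A (row i X) (row i X) -
    \sum_i qform B (row i Y) (row i Y)) <= (k / 2) * (8 * nu * d%:R).
  by rewrite ler_wpM2l // divr_ge0 // ltW.
lra.
Qed.

End euclidean_algebra.

(** * Null sets and perturbed maxima *)

Lemma coord_le_norm {R : realType} (m n : nat) (x : 'M[R]_(m, n)) i j :
  `|x i j| <= `|x|.
Proof.
have -> : `|x| = mx_norm x by [].
by rewrite mx_normrE (le_bigmax _ (fun ij => `|x ij.1 ij.2|) (i, j)).
Qed.

Lemma norm_le_coord {R : realType} (m n : nat) (x : 'M[R]_(m, n)) (c : R) :
  0 <= c -> (forall i j, `|x i j| <= c) -> `|x| <= c.
Proof.
move=> c0 h; have -> : `|x| = mx_norm x by [].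
by rewrite mx_normrE; apply/bigmax_leP; split=> // -[i j] _; exact: h.
Qed.

(** The left side is a polynomial in [t], hence continuous at 0. It is used to open up closed boxes
    and to absorb the [+ 1] in counting grid cells. *)
Lemma prod_shift_le {R : realType} (n N : nat) (w : 'I_N -> 'I_n -> R) (e : R) :
  0 < e -> exists t, 0 < t /\
    \sum_(k < N) \prod_(i < n) (w k i + t) <= \sum_(k < N) \prod_(i < n) w k i + e.
Proof.
move=> e0.
pose p : {poly R} := \sum_(k < N) \prod_(i < n) ('X + (w k i)%:P).
have pE t : p.[t] = \sum_(k < N) \prod_(i < n) (w k i + t).
  rewrite horner_sum; apply: eq_bigr => k _; rewrite horner_prod.
  by apply: eq_bigr => i _; rewrite hornerD hornerX hornerC addrC.
have := @continuous_horner R p 0.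
move/cvgrPdist_le => /(_ e e0) /nbhs_ballP [r /= r0 hr].
exists (r / 2); split; first by rewrite divr_gt0.
rewrite -pE.
have -> : \sum_(k < N) \prod_(i < n) w k i = p.[0].
  by rewrite pE; apply: eq_bigr => k _; apply: eq_bigr => i _; rewrite addr0.
have : ball (0 : R) r (r / 2).
  by rewrite /ball /= sub0r normrN gtr0_norm ?divr_gt0 // ltr_pdivrMr //; lra.
move/hr => /=; rewrite ler_norml => /andP[+ _]; lra.
Qed.

Lemma ler_prodn {R : realType} (I : finType) (a b : I -> R) :
  (forall i, 0 <= a i <= b i) -> \prod_i a i <= \prod_i b i.
Proof. by move=> h; apply: ler_prod => i _; exact: h. Qed.

(* Points that are s-separated in the max norm fall into distinct cells of the
   cubic grid of mesh s. *)
Lemma card_separated {R : realType} (n : nat) (T : finType) (D : pred T)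
    (x : T -> 'rV[R]_n) (lo w : 'I_n -> R) (s : R) :
  0 < s ->
  {in D &, forall g g', (forall i, `|x g 0 i - x g' 0 i| < s) -> g = g'} ->
  (forall g i, D g -> lo i <= x g 0 i <= lo i + w i) ->
  (forall i, 0 <= w i) ->
  (#|D|)%:R <= \prod_(i < n) (w i / s + 1).
Proof.
move=> s0 sep box w0.
pose c g i := Num.trunc ((x g 0 i - lo i) / s).
pose m i := Num.trunc (w i / s).
have cm g i : D g -> (c g i <= m i)%N.
  move=> /box - /(_ i) /andP[h1 h2]; apply: le_truncn.
  by rewrite ler_pM2r ?invr_gt0 //; lra.
pose M := (\max_i m i).+1.
have mM i : (m i < M)%N by rewrite ltnS (leq_bigmax i).
pose F (i : 'I_n) : pred 'I_M := [pred j : 'I_M | (j < (m i).+1)%N].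
pose psi g : {ffun 'I_n -> 'I_M} := [ffun i => inord (c g i)].
have psiE g i : D g -> psi g i = c g i :> nat.
  by move=> Dg; rewrite ffunE inordK // (leq_ltn_trans (cm _ i Dg)).
have inj : {in D &, injective psi}.
  move=> g g' Dg Dg' e; apply: sep => // i.
  have : c g i = c g' i by rewrite -!psiE // e.
  have bg : 0 <= (x g 0 i - lo i) / s.
    by rewrite divr_ge0 ?(ltW s0) //; have := box g i Dg; lra.
  have bg' : 0 <= (x g' 0 i - lo i) / s.
    by rewrite divr_ge0 ?(ltW s0) //; have := box g' i Dg'; lra.
  have /andP[] := truncn_itv bg; have /andP[] := truncn_itv bg'.
  rewrite /c => a1 a2 a3 a4 ee; rewrite ee in a3 a4.
  have : `|(x g 0 i - lo i) / s - (x g' 0 i - lo i) / s| < 1.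
    rewrite ltr_norml; move: a2 a4; rewrite -natr1; lra.
  rewrite -mulrBl normrM normfV (gtr0_norm s0) ltr_pdivrMr // mul1r.
  by have -> : x g 0 i - lo i - (x g' 0 i - lo i) = x g 0 i - x g' 0 i by ring.
have : (#|D| <= #|family F|)%N.
  rewrite -(card_in_imset inj) subset_leq_card //.
  apply/fintype.subsetP => _ /imsetP[g Dg ->]; apply/familyP => i.
  by rewrite inE psiE // ltnS cm.
rewrite -(ler_nat R) => /le_trans; apply.
rewrite card_family foldrE big_map big_enum /= natr_prod.
apply: ler_prodn => i; rewrite ler0n /=.
have -> : #|F i| = (m i).+1.
  rewrite -sum1_card -[RHS]card_ord -sum1_card.
  by rewrite (big_ord_widen M (fun=> 1%N)) //; exact: mM.
have ws : 0 <= w i / s by rewrite divr_ge0 ?(ltW s0).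
by rewrite -[(m i).+1%:R]natr1 lerD2r; have /andP[] := truncn_itv ws.
Qed.

(** The k-th closed box is enlarged to an open one at a cost of [e / 2^(k+2)] in volume, and
    compactness then leaves finitely many boxes. *)
Lemma lebesgue_null_compact {R : realType} (n : nat) (C N : set 'rV[R]_n) (e : R) :
  compact C -> C `<=` N -> lebesgue_null N -> 0 < e ->
  exists (m : nat) (lo w : 'I_m -> 'I_n -> R),
    [/\ forall k i, 0 <= w k i,
      forall x, C x -> exists k, forall i, lo k i <= x 0 i <= lo k i + w k i &
      \sum_(k < m) \prod_(i < n) w k i <= e].
Proof.
move=> Cc CN Nn e0.
have e2 : 0 < e / 2 by rewrite divr_gt0.
have [lo [hi [lohi cov vol]]] := Nn _ e2.
pose w k i := hi k 0 i - lo k 0 i.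
have w0 k i : 0 <= w k i by rewrite subr_ge0.
have ht k : exists t : R, 0 < t /\
    \prod_(i < n) (w k i + t) <= \prod_(i < n) w k i + e / 2 ^+ k.+2.
  have ek : 0 < e / 2 ^+ k.+2 by rewrite divr_gt0 ?exprn_gt0.
  have [t [t0 ht]] := @prod_shift_le R n 1 (fun _ i => w k i) _ ek.
  by exists t; split=> //; move: ht; rewrite !big_ord_recl !big_ord0 !addr0.
have {ht} [t htt] := choice ht.
have t0 k : 0 < t k by case: (htt k).
have ht k : \prod_(i < n) (w k i + t k) <= \prod_(i < n) w k i + e / 2 ^+ k.+2.
  by case: (htt k).
pose U k := [set x : 'rV[R]_n |
  forall i, lo k 0 i - t k / 2 < x 0 i < hi k 0 i + t k / 2].
have Uo k : setT k -> open (U k).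
  move=> _; rewrite openE => x Ux.
  suff fx i : nbhs x [set y : 'rV[R]_n |
      lo k 0 i - t k / 2 < y 0 i < hi k 0 i + t k / 2].
    by rewrite /U /=; apply: (filter_forall _ fx).
  have ci := @coord_continuous R 1 n 0 i x.
  have /andP[h1 h2] := Ux i.
  have a : nbhs x [set y : 'rV[R]_n | lo k 0 i - t k / 2 < y 0 i].
    exact: (ci _ (lt_nbhsr h1)).
  have b : nbhs x [set y : 'rV[R]_n | y 0 i < hi k 0 i + t k / 2].
    exact: (ci _ (lt_nbhsl h2)).
  by apply: filterS (filterI a b) => y /= [-> ->].
have CU : C `<=` \bigcup_(k in setT) U k.
  move=> x /CN /cov [k _ hk]; exists k => // i.
  by have := hk i; have := t0 k; lra.
have := Cc; rewrite compact_cover => /(_ nat setT U Uo CU) [D _ CD].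
(* The finite subcover is completed to an initial segment, because [lebesgue_null] bounds the
   volumes of initial segments. *)
pose m := (\max_(k <- finmap.enum_fset D) k).+1.
have Dm k : k \in finmap.enum_fset D -> (k < m)%N by move=> kD; rewrite ltnS (@leq_bigmax_seq _ _ xpredT id).
exists m, (fun k i => lo k 0 i - t k / 2), (fun k i => w k i + t k); split.
- by move=> k i; rewrite addr_ge0 // ltW.
- move=> x /CD [k /Dm km Ux]; exists (Ordinal km) => i /=.
  by have := Ux i; rewrite /w; lra.
apply: (@le_trans _ _ (\sum_(k < m) (\prod_(i < n) w k i + e / 2 ^+ k.+2))).
  by apply: ler_sum => k _; exact: ht.
rewrite big_split /=.
have h1 := vol m.
suff : \sum_(k < m) e / 2 ^+ k.+2 <= e / 2 by move: h1; rewrite /w; lra.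
have : \sum_(k < m) e / 2 ^+ k.+2 = e / 2 - e / 2 ^+ m.+1.
  elim: m {Dm h1} => [|j IH]; first by rewrite big_ord0 expr1 subrr.
  rewrite big_ord_recr /= IH !exprS; field.
  by rewrite expf_neq0.
by move=> ->; rewrite gerBl divr_ge0 ?exprn_ge0 // ltW.
Qed.

(** A counting version of the fact that Lipschitz images of null sets are null. Preimages of a grid
    of [M^n] points in the cube are separated by the mesh over [L], and boxes of small total volume
    contain fewer than [M^n] such points. *)
Lemma contact_null {R : realType} (n : nat) (C N : set 'rV[R]_n)
    (f : 'rV[R]_n -> 'rV[R]_n) (L eta : R) :
  compact C -> C `<=` N -> lebesgue_null N -> 0 < eta ->
  (forall x y, C x -> C y -> `|f x - f y| <= L * `|x - y|) ->
  ~ (forall p : 'rV[R]_n, (forall i, `|p 0 i| <= eta) ->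
       exists2 x, C x & f x = p).
Proof.
move=> Cc CN Nn eta0 fL surj.
wlog L1 : L fL / 1 <= L.
  move=> /(_ (Num.max 1 L)); apply; last by rewrite le_max lexx.
  move=> x y Cx Cy; apply: (le_trans (fL x y Cx Cy)).
  by rewrite ler_wpM2r // le_max lexx orbT.
have L0 : 0 < L by apply: lt_le_trans L1.
pose q := L / (2 * eta).
have q0 : 0 < q by rewrite divr_gt0 ?mulr_gt0.
(* After scaling by [q] the covering has total volume at most 1/4, and the shift [t], at least
   [1 / M], adds at most 1/4. The count of grid points would force a total of at least 1. *)
have e0 : 0 < 4^-1 / q ^+ n by rewrite divr_gt0 ?invr_gt0 ?exprn_gt0.
have [m [lo [w [w0 cov vol]]]] := lebesgue_null_compact Cc CN Nn e0.
have e1 : (0 : R) < 4^-1 by rewrite invr_gt0.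
have [t [t0 ht]] := @prod_shift_le R n m (fun k i => q * w k i) _ e1.
have [M' M't] : exists M' : nat, t^-1 <= M'.+1%:R.
  exists (Num.trunc t^-1); apply: ltW.
  have ti : 0 <= t^-1 by rewrite invr_ge0 ltW.
  by have /andP[] := truncn_itv ti.
set M := M'.+1 in M't.
have M0 : (0 : R) < M%:R by rewrite ltr0n.
pose h := 2 * eta / M%:R.
have h0 : 0 < h by rewrite divr_gt0 // mulr_gt0.
pose pt (g : {ffun 'I_n -> 'I_M}) : 'rV[R]_n := \row_i (- eta + h * (g i)%:R).
have pt_eta g i : `|pt g 0 i| <= eta.
  rewrite mxE ler_norml.
  have h1 : 0 <= h * (g i)%:R by rewrite mulr_ge0 // ltW.
  have : h * (g i)%:R <= 2 * eta.
    rewrite /h mulrAC -mulrA ler_piMr ?mulr_ge0 ?(ltW eta0) //.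
    by rewrite ler_pdivrMr // mul1r ler_nat ltnW.
  lra.
have /choice [x hx] : forall g, exists x, C x /\ f x = pt g.
  by move=> g; have [x Cx fx] := surj _ (pt_eta g); exists x.
have /choice [kap hkap] : forall g, exists k, forall i,
    lo k i <= x g 0 i <= lo k i + w k i.
  by move=> g; apply: cov; case: (hx g).
pose s := h / L.
have s0 : 0 < s by rewrite divr_gt0.
have sep g g' : (forall i, `|x g 0 i - x g' 0 i| < s) -> g = g'.
  move=> hs; apply/ffunP => i.
  have nx : `|x g - x g'| < s.
    have [n0|] := boolP (`|x g - x g'| == 0); first by rewrite (eqP n0).
    move=> n0; have [[a b] /= E] := @mx_norm_neq0 _ _ _ (x g - x g') n0.
    have -> : `|x g - x g'| = `|(x g - x g') a b| by exact: E.
    by rewrite !mxE ord1 hs.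
  have : `|pt g 0 i - pt g' 0 i| < h.
    have [Cg <-] := hx g; have [Cg' <-] := hx g'.
    have lb : `|f (x g) 0 i - f (x g') 0 i| <= `|f (x g) - f (x g')|.
      by have := coord_le_norm (f (x g) - f (x g')) 0 i; rewrite !mxE.
    apply: (le_lt_trans lb); apply: (le_lt_trans (fL _ _ Cg Cg')).
    by rewrite mulrC -ltr_pdivlMr.
  rewrite !mxE.
  have -> : - eta + h * (g i)%:R - (- eta + h * (g' i)%:R)
    = h * ((g i)%:R - (g' i)%:R) by ring.
  rewrite normrM (gtr0_norm h0) -{2}(mulr1 h) ltr_pM2l // ltr_norml => /andP[a1 a2].
  have aux (a b : nat) : a%:R - b%:R < 1 :> R -> (a <= b)%N.
    move=> ab; rewrite leqNgt; apply/negP => ba.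
    have : b.+1%:R <= a%:R :> R by rewrite ler_nat.
    rewrite -natr1; lra.
  by apply/val_inj/eqP; rewrite eqn_leq !aux //; lra.
have card : (M%:R ^+ n : R) <= \sum_(k < m) \prod_(i < n) (w k i / s + 1).
  rewrite -natrX -[M in (M ^ _)%N]card_ord -[n in (_ ^ n)%N]card_ord -card_ffun.
  rewrite -sum1_card (partition_big kap predT) //= natr_sum.
  apply: ler_sum => k _; rewrite sum1_card.
  apply: (@card_separated R n _ _ x (lo k)) => //.
  - by move=> g g' _ _; exact: sep.
  - by move=> g i Dg; have <- : kap g = k by apply/eqP; exact: Dg.
have : 1 <= \sum_(k < m) \prod_(i < n) (q * w k i + t).
  rewrite -(ler_pM2l (exprn_gt0 n M0)) mulr1; apply: (le_trans card).
  rewrite mulr_sumr; apply: ler_sum => k _.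
  rewrite -[n in _ ^+ n]card_ord -prodr_const -big_split /=.
  apply: ler_prodn => i; apply/andP; split.
    by rewrite addr_ge0 // divr_ge0 // ltW.
  have -> : w k i / s = M%:R * (q * w k i).
    by rewrite /s /h /q; field; rewrite !gt_eqF.
  rewrite mulrDr lerD2l.
  by move: M't; rewrite -[t^-1]mul1r ler_pdivrMr.
have : \sum_(k < m) \prod_(i < n) (q * w k i) <= 4^-1.
  have -> : \sum_(k < m) \prod_(i < n) (q * w k i)
    = q ^+ n * \sum_(k < m) \prod_(i < n) w k i.
    rewrite mulr_sumr; apply: eq_bigr => k _.
    by rewrite big_split /= prodr_const card_ord.
  by rewrite mulrC -ler_pdivlMr // exprn_gt0.
lra.
Qed.

Lemma within_continuousP {R : realType} (U V : normedModType R) (K : set U) (f : U -> V) :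
  {within K, continuous f} <->
  forall x, K x -> forall e, 0 < e ->
    exists2 r, 0 < r & forall y, K y -> `|x - y| < r -> `|f x - f y| < e.
Proof.
rewrite subspace_continuousP; split=> [h x Kx e e0|h x Kx].
  have /cvgrPdist_lt/(_ e e0) := h x Kx.
  rewrite /= near_withinE => /nbhs_ballP [r /= r0 hr].
  by exists r => // y Ky xy; apply: hr; rewrite // -ball_normE.
apply/cvgrPdist_lt => e e0; rewrite near_withinE; apply/nbhs_ballP.
have [r r0 hr] := h x Kx e e0; exists r => //= y.
by rewrite -ball_normE /= => xy Ky; apply: hr.
Qed.

Lemma lipschitz_within_continuous {R : realType} (U V : normedModType R)
    (K : set U) (f : U -> V) (L : R) :
  (forall x y, K x -> K y -> `|f x - f y| <= L * `|x - y|) ->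
  {within K, continuous f}.
Proof.
move=> fL; apply/within_continuousP => x Kx e e0.
have L1 : 0 < `|L| + 1 by rewrite ltr_wpDl.
exists (e / (`|L| + 1)); first by rewrite divr_gt0.
move=> y Ky; rewrite ltr_pdivlMr // => h.
apply: le_lt_trans (fL _ _ Kx Ky) (le_lt_trans _ h).
rewrite mulrC ler_wpM2l // (le_trans (ler_norm L)) //; lra.
Qed.

Section compactness.
Context {R : realType} {n : nat}.
Implicit Types (C K N : set 'rV[R]_n) (W : 'rV[R]_n -> R).

(** The index type is arbitrary: [unit] gives a single constraint, and indexing by competitors [y]
    expresses that a point is a maximizer. *)
Lemma compact_family_ge0 (I : Type) (D : set I) K (H : I -> 'rV[R]_n -> R) :
  compact K -> (forall j, D j -> {within K, continuous (H j)}) ->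
  compact [set x | K x /\ forall j, D j -> 0 <= H j x].
Proof.
move=> Kc Hc.
have Kcl : closed K by apply: compact_closed => //; exact: norm_hausdorff.
apply: (subclosed_compact _ Kc) => [|x []//].
move=> x clx; have Kx : K x by apply: Kcl => B /clx [y [[Ky _] By]]; exists y.
split=> // j Dj; rewrite leNgt; apply/negP => Hx.
have := (within_continuousP _ _).1 (Hc j Dj) x Kx (- H j x).
rewrite oppr_gt0 => /(_ Hx) [r r0 hr].
have [y [[Ky Hy]]] := clx _ (nbhsx_ballx x r r0).
rewrite -ball_normE /= => /(hr y Ky); have := Hy j Dj.
rewrite ltr_norml; lra.
Qed.

Lemma dotp_within_continuous (m : nat) K (f g : 'rV[R]_n -> 'rV[R]_m) :
  {within K, continuous f} -> {within K, continuous g} ->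
  {within K, continuous (fun x => dotp (f x) (g x))}.
Proof.
move=> fc gc; rewrite /dotp; apply: continuous_big => [|i _ x].
  exact: add_continuous.
apply: cvgM.
  exact: (cvg_comp _ _ (fc x) (@coord_continuous R 1 m 0 i (f x))).
exact: (cvg_comp _ _ (gc x) (@coord_continuous R 1 m 0 i (g x))).
Qed.

(* Jensen's lemma: the gradient map f sends the set of maximizers of the
   perturbed functions onto a cube, so by the Lipschitz property that set
   cannot be null. *)
Lemma perturbed_max_off_null C Ko N W (f : 'rV[R]_n -> 'rV[R]_n) (L eta : R) :
  compact C -> C !=set0 -> {within C, continuous W} ->
  compact Ko -> Ko `<=` C -> 0 < eta ->
  (forall x y, Ko x -> Ko y -> `|f x - f y| <= L * `|x - y|) ->
  lebesgue_null N ->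
  (forall (p x : 'rV[R]_n), (forall i, `|p 0 i| <= eta) -> C x ->
     (forall y, C y -> W y - dotp p y <= W x - dotp p x) -> Ko x /\ f x = p) ->
  exists p x : 'rV[R]_n, [/\ forall i, `|p 0 i| <= eta, Ko x, ~ N x, f x = p &
    forall y, C y -> W y - dotp p y <= W x - dotp p x].
Proof.
move=> Cc C0 Wc Koc KoC eta0 fL Nn fmax.
apply: contrapT => nex.
have idc K : {within K, continuous (id : 'rV[R]_n -> 'rV[R]_n)}.
  by apply: continuous_subspaceT => x; exact: cvg_id.
have cstc K (V : normedModType R) (c : V) :
    {within K, continuous (fun=> c : V)}.
  by move=> x; exact: cvg_cst.
have fc := lipschitz_within_continuous fL.
(* At a maximizer the perturbation equals [f x]. Substituting this describes all perturbed
   maximizers without mentioning [p], by conditions that are closed since [f] is continuous. *)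
pose E := [set x | (Ko x /\ forall i : 'I_n, setT i -> 0 <= eta - `|f x 0 i|) /\
   forall y, C y -> 0 <= (W x - dotp (f x) x) - (W y - dotp (f x) y)].
have Ec : compact E.
  rewrite /E; pose K1 := [set x | Ko x /\
    forall i : 'I_n, setT i -> 0 <= eta - `|f x 0 i|].
  have K1c : compact K1.
    apply: compact_family_ge0 => // i _ x.
    apply: cvgB; first exact: cvg_cst.
    apply: cvg_norm.
    exact: (cvg_comp _ _ (fc x) (@coord_continuous R 1 n 0 i (f x))).
  have K1Ko : K1 `<=` Ko by move=> x [].
  apply: (@compact_family_ge0 _ C K1
    (fun y x => (W x - dotp (f x) x) - (W y - dotp (f x) y))) => // y Cy.
  have fc1 := continuous_subspaceW K1Ko fc.
  have Wc1 := continuous_subspaceW (subset_trans K1Ko KoC) Wc.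
  move=> x; apply: cvgB.
    by apply: cvgB; [exact: Wc1|exact: (dotp_within_continuous fc1 (idc _))].
  apply: cvgB; first exact: cvg_cst.
  exact: (dotp_within_continuous fc1 (cstc _ _ _)).
apply: (@contact_null R n E N f L eta) => //.
- move=> x [[Kx fx] mx]; apply: contrapT => Nx; apply: nex.
  exists (f x), x; split=> // [i|y Cy]; first by have := fx i I; rewrite subr_ge0.
  by have := mx y Cy; rewrite subr_ge0.
- by move=> x y [[Kx _] _] [[Ky _] _]; exact: fL.
- move=> p hp.
  have Wpc : {within C, continuous (fun x => W x - dotp p x)}.
    move=> x; apply: cvgB; first exact: Wc.
    exact: (dotp_within_continuous (cstc _ _ _) (idc _)).
  have [x /set_mem Cx mx] := EVT_max_rV C0 Cc Wpc.
  have [Kx fx] : Ko x /\ f x = p.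
    by apply: fmax => // y Cy; apply: mx; rewrite inE.
  exists x => //; split; [split=> // i _|move=> y Cy].
    by rewrite fx subr_ge0.
  by rewrite fx subr_ge0; apply: mx; rewrite inE.
Qed.

Lemma lebesgue_nullU N C :
  lebesgue_null N -> lebesgue_null C -> lebesgue_null (N `|` C).
Proof.
move=> hN hC e e0; have e2 : 0 < e / 2 by rewrite divr_gt0.
have [lo [hi [a b c]]] := hN _ e2; have [lo' [hi' [a' b' c']]] := hC _ e2.
pose mix (u v : nat -> 'rV[R]_n) k := if odd k then u k./2 else v k./2.
exists (mix lo lo'), (mix hi hi'); split.
- by move=> k i; rewrite /mix; case: ifP.
- move=> x [/b [k _ hk]|/b' [k _ hk]].
    by exists (k.*2.+1) => //= i; rewrite /mix /= odd_double uphalf_double.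
  by exists (k.*2) => //= i; rewrite /mix odd_double doubleK.
- move=> m; pose F k := \prod_(i < n) (mix hi hi' k 0 i - mix lo lo' k 0 i).
  have F0 k : 0 <= F k.
    by apply: prodr_ge0 => i _; rewrite subr_ge0 /mix; case: ifP.
  have E : \sum_(k < m.*2) F k =
      \sum_(k < m) \prod_(i < n) (hi k 0 i - lo k 0 i) +
      \sum_(k < m) \prod_(i < n) (hi' k 0 i - lo' k 0 i).
    elim: m => [|m IH]; first by rewrite !big_ord0 addr0.
    rewrite doubleS !big_ord_recr /= IH /F /mix /= odd_double /= uphalf_double.
    by rewrite doubleK; ring.
  have : \sum_(k < m) F k <= \sum_(k < m.*2) F k.
    rewrite -!(big_mkord xpredT F) (@big_cat_nat _ _ _ m 0 m.*2) //=.
      by rewrite lerDl sumr_ge0.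
    by rewrite -addnn leq_addr.
  rewrite E; have := c m; have := c' m; lra.
Qed.

End compactness.

(** An exceptional set for one of the two variables has to be excluded in the doubled space.
    Bounding the coordinates by [rho] keeps the volume of the product boxes finite. *)
Lemma lebesgue_null_cylinder {R : realType} (d : nat) (E : set 'rV[R]_d) (rho : R)
    (s : bool) :
  lebesgue_null E -> 0 < rho ->
  lebesgue_null [set w : 'rV[R]_(d + d) |
    E (if s then lsubmx w else rsubmx w) /\ forall i, `|w 0 i| <= rho].
Proof.
move=> hE rho0 e e0.
have v0 : 0 < (2 * rho) ^+ d by rewrite exprn_gt0 // mulr_gt0.
have e'0 : 0 < e / (2 * rho) ^+ d by rewrite divr_gt0.
have [lo [hi [a b c]]] := hE _ e'0.
pose mix (u v : 'rV[R]_d) : 'rV[R]_(d + d) := if s then row_mx u v else row_mx v u.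
exists (fun k => mix (lo k) (const_mx (- rho))),
  (fun k => mix (hi k) (const_mx rho)); split.
- move=> k i; rewrite /mix => {mix}; case: s; case: (split_ordP i) => j ->;
    rewrite ?row_mxEl ?row_mxEr ?mxE //; lra.
- move=> w [Ew hw]; have [k _ hk] := b _ Ew; exists k => //= i.
  have hi' := hw i; rewrite ler_norml in hi'.
  rewrite /mix => {mix Ew}; case: s hk hi' => hk; case: (split_ordP i) => j ->;
    rewrite ?row_mxEl ?row_mxEr ?mxE // => _; by have := hk j; rewrite !mxE.
- move=> m.
  have E1 k : \prod_(i < d + d) (mix (hi k) (const_mx rho) 0 i -
        mix (lo k) (const_mx (- rho)) 0 i) =
      (2 * rho) ^+ d * \prod_(i < d) (hi k 0 i - lo k 0 i).
    rewrite big_split_ord /=.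
    have E2 : (2 * rho) ^+ d = \prod_(i < d) (2 * rho).
      by rewrite prodr_const card_ord.
    rewrite E2 /mix => {mix}; case: s; [rewrite mulrC|]; congr (_ * _);
      apply: eq_bigr => i _; rewrite ?row_mxEl ?row_mxEr ?mxE //; ring.
  under eq_bigr do rewrite E1.
  by rewrite -mulr_sumr mulrC -ler_pdivlMr.
Qed.

(** * Second-order expansions *)

Section calculus_along_lines.
Context {R : realType} {d : nat}.
Implicit Types (u : 'rV[R]_d -> R) (x y v w : 'rV[R]_d).

Lemma is_derive_line u x v (t : R) : derivable u (x + t *: v) v ->
  is_derive t 1 (fun s => u (x + s *: v)) ('D_v u (x + t *: v)).
Proof.
move=> du.
have E : (fun h : R => h^-1 *: (((fun s => u (x + s *: v)) \o shift t) (h *: 1)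
      - u (x + t *: v)))
    = (fun h => h^-1 *: ((u \o shift (x + t *: v)) (h *: v) - u (x + t *: v))).
  apply/funext => h /=; congr (_ *: (u _ - _)).
  by rewrite [h *: 1]mulr1 scalerDl addrCA.
by split; rewrite /derivable ?/derive E.
Qed.

Lemma derive_dotp_grad u x v : differentiable u x ->
  'D_v u x = dotp (grad u x) v.
Proof.
move=> du; rewrite deriveE // [in LHS](row_sum_delta v) linear_sum.
apply: eq_bigr => i _; rewrite linearZ /= mxE /partial deriveE //.
by rewrite [in RHS]mulrC.
Qed.

Lemma is_derive_grad u x v (t : R) : differentiable u (x + t *: v) ->
  is_derive t 1 (fun s => u (x + s *: v)) (dotp (grad u (x + t *: v)) v).
Proof.
move=> du; rewrite -derive_dotp_grad //.
by apply: is_derive_line; exact: diff_derivable.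
Qed.

Lemma differentiable_partial u x i : differentiable (grad u) x ->
  differentiable (partial i u) x.
Proof.
move=> dg.
have -> : partial i u = (fun M : 'rV[R]_d => M 0 i) \o grad u.
  by apply/funext => y; rewrite /= mxE.
by apply: differentiable_comp => //; exact: differentiable_coord.
Qed.

Lemma derive_partial u x v j : differentiable (grad u) x ->
  'D_v (partial j u) x = \sum_i v 0 i * hess u x i j.
Proof.
move=> /(@differentiable_partial _ _ j) dp; rewrite derive_dotp_grad //.
by apply: eq_bigr => i _; rewrite !mxE mulrC.
Qed.

Lemma is_derive_hess u x v w : differentiable (grad u) x ->
  is_derive (0 : R) 1 (fun s => dotp (grad u (x + s *: v)) w)
    (qform (hess u x) v w).
Proof.
move=> dg.
have E : (fun s : R => dotp (grad u (x + s *: v)) w) =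
    \sum_(j < d) (fun s => w 0 j *: partial j u (x + s *: v)).
  apply/funext => s; rewrite fct_sumE; apply: eq_bigr => j _.
  by rewrite mxE mulrC.
rewrite E /qform /dotp.
have -> : \sum_(j < d) (v *m hess u x) 0 j * w 0 j =
    \sum_(j < d) w 0 j *: 'D_v (partial j u) x.
  apply: eq_bigr => j _; rewrite mulrC; congr (_ *: _).
  by rewrite derive_partial // mxE.
apply: is_derive_sum => j; apply: is_deriveZ.
have := @is_derive_line (partial j u) x v 0; rewrite scale0r addr0; apply.
by apply: diff_derivable; exact: differentiable_partial.
Qed.

(** The second derivative is known at the single point 0, as for a C^(1,1) function at almost every
    point. If [c] were positive, [dm] would be positive just to the right of 0, and the mean value
    theorem would make [m] increase. *)
Lemma second_derivative_max (m dm : R -> R) (c r : R) : 0 < r ->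
  (forall t : R, `|t| < r -> is_derive t 1 m (dm t)) ->
  is_derive (0 : R) 1 dm c -> (forall t, `|t| < r -> m t <= m 0) ->
  dm 0 = 0 /\ c <= 0.
Proof.
move=> r0 hm hdm hmax.
have rr (t : R) : (t \in `]-r, r[%R) = (`|t| < r).
  by rewrite in_itv /= -ltr_norml.
have dm0 : dm 0 = 0.
  have h0 : `|0 : R| < r by rewrite normr0.
  have h1 : is_derive (0 : R) 1 m 0.
    apply: (@derive1_at_max _ m (- r) r 0); first by lra.
    - by move=> t; rewrite rr => /hm [].
    - by rewrite rr.
    - by move=> t; rewrite rr; exact: hmax.
  by have [_ e2] := hm 0 h0; have [_ e1] := h1; rewrite -e2 e1.
split=> //; rewrite leNgt; apply/negP => c0.
have [/= dd dE] := hdm; rewrite /derive in dE.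
have /cvgrPdist_lt /(_ _ c0) : (fun h : R => h^-1 *: ((dm \o shift 0) (h *: 1) - dm 0))
   @ 0^' --> c by rewrite -dE; exact: dd.
rewrite /= near_withinE => /nbhs_ballP [e /= e0 he].
pose t := Num.min e r / 2.
have t0 : 0 < t by rewrite divr_gt0 // lt_min e0 r0.
have te : t < e.
  by rewrite ltr_pdivrMr // (@le_lt_trans _ _ e) ?ge_min ?lexx //; lra.
have tr : t < r.
  by rewrite ltr_pdivrMr // (@le_lt_trans _ _ r) ?ge_min ?lexx ?orbT //; lra.
have pos s : 0 < s -> s < e -> 0 < dm s.
  move=> s0 se; have := he s.
  rewrite -ball_normE /= sub0r normrN gtr0_norm // => /(_ se (lt0r_neq0 s0)).
  rewrite dm0 subr0 addr0 [s *: 1]mulr1 ltr_norml => /andP[_].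
  rewrite ltrBlDr -ltrBlDl subrr => h.
  by move: h; rewrite /GRing.scale /= mulrC pmulr_lgt0 // invr_gt0.
have [z] : exists2 z, z \in `]0, t[%R & m t - m 0 = dm z * (t - 0).
  apply: MVT => // [z|].
    by rewrite in_itv /= => /andP[z0 zt]; apply: hm; rewrite gtr0_norm //; lra.
  apply: derivable_within_continuous => z; rewrite in_itv /= => /andP[z0 zt].
  by have := hm z; rewrite ger0_norm // => /(_ (le_lt_trans zt tr)) [].
rewrite in_itv /= subr0 => /andP[z0 zt] E.
have : 0 < dm z * t by rewrite mulr_gt0 // pos //; lra.
have := hmax t; rewrite gtr0_norm // => /(_ tr); lra.
Qed.

(** The vector [p] need not be a gradient on the segment: in the doubling argument it is the
    gradient at a third point. *)
Lemma taylor_segment u x y p (S : R) :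
  (forall t : R, 0 <= t <= 1 -> differentiable u (x + t *: (y - x)) /\
     enorm (grad u (x + t *: (y - x)) - p) <= S) ->
  `|u y - u x - dotp p (y - x)| <= S * enorm (y - x).
Proof.
move=> h.
pose m (t : R) := u (x + t *: (y - x)) - t * dotp p (y - x).
have dm (t : R) : 0 <= t <= 1 ->
    is_derive t 1 m (dotp (grad u (x + t *: (y - x)) - p) (y - x)).
  move=> /h [du _]; rewrite dotpBl.
  apply: is_deriveB; first exact: is_derive_grad.
  have -> : (fun s : R => s * dotp p (y - x)) = dotp p (y - x) \*: id.
    by apply/funext => s; rewrite /= mulrC.
  apply: is_derive_eq; exact: mulr1.
have [z zI E] : exists2 z, z \in `]0, 1[%R & m 1 - m 0 =
    dotp (grad u (x + z *: (y - x)) - p) (y - x) * (1 - 0).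
  apply: MVT => // [z|].
    by rewrite in_itv /= => /andP[z0 z1]; apply: dm; rewrite !ltW.
  by apply: derivable_within_continuous => z; rewrite in_itv /= => /dm [].
have -> : u y - u x - dotp p (y - x) = m 1 - m 0.
  have yE : x + (y - x) = y by rewrite addrC subrK.
  by rewrite /m scale1r scale0r addr0 mul0r mul1r subr0 yE addrAC.
rewrite E subr0 mulr1 (le_trans (dotp_CS _ _)) // ler_wpM2r ?enorm_ge0 //.
move: zI; rewrite in_itv /= => /andP[z0 z1].
have zz : 0 <= z <= 1 by rewrite !ltW.
by have [] := h z zz.
Qed.

Lemma differentiable_first_order (n : nat) (f : 'rV[R]_d -> 'rV[R]_n) x e :
  differentiable f x -> 0 < e -> exists2 r, 0 < r &
    forall h, `|h| < r -> `|f (x + h) - f x - 'd f x h : 'rV[R]_n| <= e * `|h|.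
Proof.
move=> df e0; have /eqaddoP/(_ e e0) /nbhs_ballP [r /= r0 hr] := diff_locally df.
exists r => // h hh; have := hr h; rewrite -ball_normE /= sub0r normrN.
by move=> /(_ hh); rewrite !fctE /= opprD addrA (addrC h).
Qed.

(* The second difference quotient of u is symmetric in i and j and, by the mean
   value theorem, tends to the mixed derivatives taken in either order. *)
Lemma hess_sym u x : (\forall y \near x, differentiable u y) ->
  differentiable (grad u) x -> (hess u x)^T = hess u x.
Proof.
move=> /nbhs_ballP [r1 /= r1p hu] dg.
have dE h : 'd (grad u) x h = h *m hess u x.
  apply/rowP => j; rewrite -deriveE //.
  have := @derive_partial u x h j dg; rewrite mxE => <-.
  have -> : partial j u = (fun M : 'rV[R]_d => M 0 j) \o grad u.
    by apply/funext => y; rewrite /= mxE.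
  have dc : derivable (grad u) x h by exact: diff_derivable.
  by rewrite (derive_mx dc) !mxE.
have key i j e : 0 < e -> \forall t \near (0 : R)^'+,
    `|(u (x + t *: delta_mx 0 i + t *: delta_mx 0 j) - u (x + t *: delta_mx 0 i)
      - (u (x + t *: delta_mx 0 j) - u x)) / t ^+ 2 - hess u x j i| <= e.
  move=> e0; have e3 : 0 < e / 3 by rewrite divr_gt0.
  have [r2 r2p hr] := differentiable_first_order dg e3.
  near=> t.
  have t0 : 0 < t by near: t; exact: nbhs_right_gt.
  have t1 : 2 * t < r1.
    by rewrite mulrC -ltr_pdivlMr //; near: t; apply: nbhs_right_lt; rewrite divr_gt0.
  have t2 : 2 * t < r2.
    by rewrite mulrC -ltr_pdivlMr //; near: t; apply: nbhs_right_lt; rewrite divr_gt0.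
  pose dl k : 'rV[R]_d := delta_mx 0 k.
  have dl1 k : `|dl k| <= 1.
    apply: norm_le_coord => // a b; rewrite !mxE.
    by case: (_ && _); rewrite ?normr1 ?normr0.
  have sm (s : R) (s' : R) : 0 <= s <= t -> 0 <= s' <= t ->
      `|s *: dl i + s' *: dl j| <= 2 * t.
    move=> /andP[a b] /andP[a' b']; rewrite (le_trans (ler_normD _ _)) // !normrZ.
    have := dl1 i; have := dl1 j; rewrite !ger0_norm // => h1 h2.
    have : s * `|dl i| <= t * 1 by apply: ler_pM.
    have : s' * `|dl j| <= t * 1 by apply: ler_pM.
    lra.
  have diffu (s s' : R) : 0 <= s <= t -> 0 <= s' <= t ->
      differentiable u (x + s *: dl i + s' *: dl j).
    move=> hs hs'; apply: hu; rewrite -ball_normE /= -addrA opprD addNKr normrN.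
    exact: le_lt_trans (sm _ _ hs hs') t1.
  have t00 : 0 <= t <= t by rewrite lexx ltW.
  have z00 : 0 <= (0:R) <= t by rewrite lexx ltW.
  pose dm s := partial i u (x + s *: dl i + t *: dl j) - partial i u (x + s *: dl i).
  pose m (s : R) := u ((x + t *: dl j) + s *: dl i) - u (x + s *: dl i).
  have hm (s : R) : 0 <= s <= t -> is_derive s 1 m (dm s).
    move=> hs; apply: is_deriveB; rewrite /partial.
      rewrite addrAC; apply: is_derive_line; apply: diff_derivable.
      by rewrite addrAC; exact: diffu.
    apply: is_derive_line; apply: diff_derivable.
    by have := diffu s 0 hs z00; rewrite scale0r addr0.
  have [s sI E] : exists2 s, s \in `]0, t[%R & m t - m 0 = dm s * (t - 0).
    apply: MVT => // [z|].
      by rewrite in_itv /= => /andP[z0 zt]; apply: hm; rewrite !ltW.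
    by apply: derivable_within_continuous => z; rewrite in_itv /= => /hm [].
  have -> : u (x + t *: delta_mx 0 i + t *: delta_mx 0 j)
      - u (x + t *: delta_mx 0 i) - (u (x + t *: delta_mx 0 j) - u x) = m t - m 0.
    by rewrite /m !scale0r !addr0 [x + t *: dl j + _]addrAC.
  rewrite E subr0.
  move: sI; rewrite in_itv /= => /andP[s0 st].
  have hs : 0 <= s <= t by rewrite !ltW.
  have h1 := hr (s *: dl i + t *: dl j) (le_lt_trans (sm _ _ hs t00) t2).
  have h2 := hr (s *: dl i + 0 *: dl j) (le_lt_trans (sm _ _ hs z00) t2).
  have n1 := sm _ _ hs t00.
  have n2 : `|s *: dl i + 0 *: dl j| <= t.
    rewrite scale0r addr0 normrZ ger0_norm ?(ltW s0) //.
    have : s * `|dl i| <= t * 1 by apply: ler_pM => //; exact: ltW.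
    lra.
  have f1 := le_trans (coord_le_norm _ 0 i) h1.
  have f2 := le_trans (coord_le_norm _ 0 i) h2.
  rewrite !dE !mulmxDl -!scalemxAl -!rowE !mxE addrA in f1.
  rewrite !dE !mulmxDl -!scalemxAl -!rowE !mxE addrA scale0r addr0 in f2.
  have q1 : e / 3 * `|s *: dl i + t *: dl j| <= e / 3 * (2 * t).
    by rewrite ler_wpM2l // ltW.
  have q2 : e / 3 * `|s *: dl i + 0 *: dl j| <= e / 3 * t.
    by rewrite ler_wpM2l // ltW.
  have f3 : `|dm s - t * hess u x j i| <= e * t.
    rewrite /dm.
    move: f1 f2; rewrite !ler_norml !mxE.
    move: q1 q2; rewrite scale0r mul0r.
    move: (partial i u (x + s *: dl i + t *: dl j)) (partial i u (x + s *: dl i))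
      (partial i u x) (partial j (partial i u) x) (partial i (partial i u) x).
    move: `|s *: dl i + t *: dl j| `|s *: dl i + 0| => N1 N2 p1 p2 p3 p4 p5.
    move=> q1 q2 /andP[? ?] /andP[? ?]; apply/andP; split; lra.
  have -> : dm s * t / t ^+ 2 - hess u x j i = (dm s - t * hess u x j i) / t.
    by field; rewrite gt_eqF.
  by rewrite normrM normfV (gtr0_norm t0) ler_pdivrMr.
apply/matrixP => j i; rewrite mxE.
apply/eqP; rewrite -subr_eq0 -normr_le0; apply/ler_addgt0Pl => e e0; rewrite addr0.
have e2 : 0 < e / 2 by rewrite divr_gt0.
have [t [h1 h2]] := filter_ex (filterI (key i j _ e2) (key j i _ e2)).
move: h1 h2; rewrite !ler_norml.
rewrite [x + t *: delta_mx 0 j + _]addrAC.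
set A := u _; set B := u _; set C := u _; set D := u _.
have -> : A - C - (B - D) = A - B - (C - D) by ring.
move: (_ / t ^+ 2) => q; move: (hess u x j i) (hess u x i j) => p1 p2.
by move=> /andP[? ?] /andP[? ?]; apply/andP; split; lra.
Unshelve. all: by end_near. Qed.

End calculus_along_lines.

(** * Exterior balls *)

Section exterior_balls.
Context {R : realType} {d : nat}.
Implicit Types (u : 'rV[R]_d -> R) (x y z a : 'rV[R]_d) (G V : set 'rV[R]_d).

Lemma mvt_symmetric (f df : R -> R) (c : R) :
  (forall s : R, `|s| <= `|c| -> is_derive s 1 f (df s)) ->
  exists2 s, `|s| <= `|c| & f c - f 0 = df s * c.
Proof.
move=> h.
have cont (a b : R) : - `|c| <= a -> b <= `|c| -> {within `[a, b], continuous f}.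
  move=> ac bc; apply: derivable_within_continuous => z.
  rewrite in_itv /= => /andP[az zb].
  by have [|] := h z; first by rewrite ler_norml; apply/andP; split; lra.
have [c0|c0] := leP 0 c.
  have E : `|c| = c by rewrite ger0_norm.
  have [s sI e] : exists2 s, s \in `[0, c]%R & f c - f 0 = df s * (c - 0).
    apply: MVT_segment => // [z|]; last by apply: cont; rewrite E; lra.
    by rewrite in_itv /= => /andP[a b]; apply: h; rewrite E gtr0_norm // ltW.
  exists s; last by rewrite e subr0.
  by move: sI; rewrite in_itv /= E => /andP[a b]; rewrite ger0_norm.
have E : `|c| = - c by rewrite ltr0_norm.
have [s sI e] : exists2 s, s \in `[c, 0]%R & f 0 - f c = df s * (0 - c).
  apply: MVT_segment => // [|z|]; first exact: ltW.
    rewrite in_itv /= => /andP[a b]; apply: h; rewrite E ltr0_norm //; lra.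
  by apply: cont; rewrite E; lra.
exists s; last by move: e; lra.
by move: sI; rewrite in_itv /= E => /andP[a b]; rewrite ler0_norm //; lra.
Qed.

(** [C1_on] provides partial derivatives and not a differential, so the increment is telescoped
    along a path of segments parallel to the axes. *)
Lemma mvt_coordinates u x z a (om : R) : 0 <= om ->
  (forall y, (forall i, `|y 0 i - x 0 i| <= `|z 0 i - x 0 i|) -> forall i,
     derivable u y (delta_mx 0 i) /\ `|partial i u y - a 0 i| <= om) ->
  `|u z - u x - dotp a (z - x)| <= om * \sum_i `|z 0 i - x 0 i|.
Proof.
move=> om0 h.
pose p (k : nat) : 'rV[R]_d := \row_i (if (i < k)%N then z 0 i else x 0 i).
have p0 : p 0%N = x by apply/rowP => i; rewrite mxE.
have pd : p d = z by apply/rowP => i; rewrite mxE ltn_ord.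
have -> : u z - u x = \sum_(k < d) (u (p k.+1) - u (p k)).
  by rewrite -(big_mkord xpredT (fun k => u (p k.+1) - u (p k))) telescope_sumr //
    p0 pd.
rewrite /dotp -sumrB mulr_sumr (le_trans (ler_norm_sum _ _ _)) //.
apply: ler_sum => k _; rewrite !mxE.
set c := z 0 k - x 0 k.
have pS : p k.+1 = p k + c *: delta_mx 0 k.
  apply/rowP => i; rewrite !mxE eqxx /= ltnS leq_eqVlt.
  have [->|ik] := eqVneq i k; first by rewrite !eqxx ltnn /= /c mulr1; ring.
  rewrite -val_eqE /= in ik; rewrite (negbTE ik) /=.
  by case: (i < k)%N; rewrite mulr0 addr0.
have hb (s : R) : `|s| <= `|c| -> forall i,
   `|(p k + s *: delta_mx 0 k) 0 i - x 0 i| <= `|z 0 i - x 0 i|.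
  move=> sc i; rewrite !mxE eqxx /=.
  have [->|ik] := eqVneq i k.
    rewrite ltnn; have -> : x 0 k + s * true%:R - x 0 k = s by rewrite mulr1; ring.
    exact: sc.
  rewrite mulr0 addr0; case: ifP => _ //.
  by rewrite subrr normr0.
have [s sc e] : exists2 s, `|s| <= `|c| &
    u (p k + c *: delta_mx 0 k) - u (p k + 0 *: delta_mx 0 k) =
    partial k u (p k + s *: delta_mx 0 k) * c.
  apply: (@mvt_symmetric (fun s => u (p k + s *: delta_mx 0 k))
    (fun s => partial k u (p k + s *: delta_mx 0 k))) => s sc.
  by apply: is_derive_line; have [] := h _ (hb s sc) k.
rewrite pS; rewrite scale0r addr0 in e; rewrite e -mulrBl normrM.
by rewrite ler_wpM2r //; have [] := h _ (hb s sc) k.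
Qed.

Lemma enorm_delta i : enorm (delta_mx 0 i : 'rV[R]_d) = 1.
Proof. by rewrite /enorm dotp_delta mxE !eqxx sqrtr1. Qed.

Lemma sum_norm_le_enorm x : \sum_i `|x 0 i| <= d%:R * enorm x.
Proof.
rewrite (le_trans (ler_sum _ (fun i _ => coord_le_enorm x i))) //.
by rewrite sumr_const card_ord mulr_natl.
Qed.

Lemma norm_le_enorm x : `|x| <= enorm x.
Proof.
apply: norm_le_coord; first exact: enorm_ge0.
by move=> i j; rewrite ord1; exact: coord_le_enorm.
Qed.

Lemma enorm_le_norm x : enorm x <= d%:R * `|x|.
Proof.
rewrite (le_trans (enorm_le_sum x)) //.
rewrite (le_trans (ler_sum _ (fun i _ => coord_le_norm x 0 i))) //.
by rewrite sumr_const card_ord mulr_natl.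
Qed.

Lemma ler_sum2 (F : 'I_d -> 'I_d -> R) i j : (forall i j, 0 <= F i j) ->
  F i j <= \sum_i \sum_j F i j.
Proof.
move=> F0; rewrite (bigD1 i) //= (bigD1 j) //= -addrA lerDl addr_ge0 //.
  by rewrite sumr_ge0.
by rewrite sumr_ge0 // => k _; rewrite sumr_ge0.
Qed.

Lemma C2_taylor V u x0 : open V -> V x0 -> C2_on V u ->
  exists M r, [/\ 0 < M, 0 < r,
   forall x, `|x - x0| < r -> V x &
   forall x z, `|x - x0| < r -> `|z - x| < r ->
     `|u z - u x - dotp (grad u x) (z - x)| <= M * enorm (z - x) ^+ 2 /\
     enorm (grad u z - grad u x) <= M * enorm (z - x)].
Proof.
move=> oV Vx0 [C1u C2u].
pose B := 1 + \sum_i \sum_j `|partial i (partial j u) x0|.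
have B0 : 0 < B.
  by rewrite ltr_wpDr // sumr_ge0 // => i _; rewrite sumr_ge0.
have Bn i j : \forall y \near x0, `|partial i (partial j u) y| <= B.
  have [_ cij] := C2u j x0 Vx0 i.
  have /cvgrPdist_le/(_ 1 ltr01) := cij.
  apply: filterS => y hy.
  have h := @ler_sum2 (fun i j => `|partial i (partial j u) x0|) i j (fun _ _ => normr_ge0 _).
  apply: le_trans (_ : 1 + `|partial i (partial j u) x0| <= _); last by rewrite lerD2l.
  move: hy; move: (partial i _ x0) (partial i _ y) => p q hy.
  by have := ler_normB p (p - q); rewrite opprB addrCA subrr addr0; lra.
have near0 : \forall y \near x0, V y /\ forall i j, `|partial i (partial j u) y| <= B.
  have Bni i : \forall y \near x0, forall j, `|partial i (partial j u) y| <= B.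
    exact: (filter_forall _ (Bn i)).
  exact: filterI (open_nbhs_nbhs (conj oV Vx0)) (filter_forall _ Bni).
have [r /= r0 hr] := (nbhs_ballP _ _).1 near0.
have inr y : `|y - x0| < r -> V y /\ forall i j, `|partial i (partial j u) y| <= B.
  by move=> h; apply: hr; rewrite -ball_normE /= distrC.
have r2 : 0 < r / 2 by rewrite divr_gt0.
(* The axis-parallel path from [x] to [z] stays in the box that they span, and the max norm makes
   this box stay in the ball. *)
have box x z y : `|x - x0| < r / 2 -> `|z - x| < r / 2 ->
    (forall i, `|y 0 i - x 0 i| <= `|z 0 i - x 0 i|) -> `|y - x0| < r.
  move=> h1 h2 h3.
  have : `|y - x| <= `|z - x|.
    apply: norm_le_coord => // i j; rewrite ord1.
    have := coord_le_norm (z - x) 0 j; rewrite !mxE; exact: le_trans.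
  have := ler_normD (y - x) (x - x0); rewrite addrA subrK; lra.
have S0 x z : 0 <= B * \sum_i `|z 0 i - x 0 i|.
  by rewrite mulr_ge0 ?(ltW B0) // sumr_ge0.
have gradL x z : `|x - x0| < r / 2 -> `|z - x| < r / 2 -> forall j,
    `|partial j u z - partial j u x| <= B * \sum_i `|z 0 i - x 0 i|.
  move=> h1 h2 j; have := @mvt_coordinates (partial j u) x z 0 B (ltW B0).
  rewrite dotp0l subr0; apply => y hy i.
  have [Vy by_] := inr y (box x z y h1 h2 hy).
  by rewrite mxE subr0; split; [have [] := C2u j y Vy i|].
have sumE x z : \sum_i `|z 0 i - x 0 i| <= d%:R * enorm (z - x).
  have := sum_norm_le_enorm (z - x).
  by under eq_bigr do rewrite !mxE.
have dS : (0 : R) <= d%:R by [].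
pose M := B * d%:R ^+ 2 + 1.
exists M, (r / 2); split=> //.
- by rewrite ltr_wpDl // mulr_ge0 ?exprn_ge0 // ltW.
- by move=> x hx; have [] := inr x _ => //; lra.
move=> x z h1 h2; split.
  have := @mvt_coordinates u x z (grad u x) (B * \sum_i `|z 0 i - x 0 i|) (S0 x z).
  have hS : B * (\sum_i `|z 0 i - x 0 i|) * (\sum_i `|z 0 i - x 0 i|)
      <= M * enorm (z - x) ^+ 2.
    apply: (@le_trans _ _ (B * (d%:R * enorm (z - x)) * (d%:R * enorm (z - x)))).
      have s0 : 0 <= \sum_i `|z 0 i - x 0 i| by rewrite sumr_ge0.
      by rewrite -!(mulrA B) ler_wpM2l ?(ltW B0) //; apply: ler_pM => //; exact: sumE.
    rewrite /M; move: (enorm (z - x)) (d%:R) => E D.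
    by have := sqr_ge0 E; lra.
  move=> h; apply: le_trans hS; apply: h => y hy i.
  have hyr := box x z y h1 h2 hy; have [Vy _] := inr y hyr.
  split; first by have [] := C1u y Vy i.
  rewrite mxE.
  have hy2 : `|y - x| < r / 2.
    apply: le_lt_trans h2; apply: norm_le_coord => // k j; rewrite ord1.
    have := coord_le_norm (z - x) 0 j; rewrite !mxE; exact: le_trans.
  apply: (le_trans (gradL x y h1 hy2 i)); rewrite ler_wpM2l ?(ltW B0) //.
  by apply: ler_sum => j _; exact: hy.
rewrite (le_trans (enorm_le_sum _)) //.
have h3 i : `|(grad u z - grad u x) 0 i| <= B * (d%:R * enorm (z - x)).
  rewrite !mxE (le_trans (gradL x z h1 h2 i)) //.
  by rewrite ler_wpM2l ?(ltW B0).
rewrite (le_trans (ler_sum _ (fun i _ => h3 i))) // sumr_const card_ord.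
rewrite -[leLHS]mulr_natl.
have := enorm_ge0 (z - x); rewrite /M; move: (enorm (z - x)) (d%:R) => E D; lra.
Qed.

(** With a vanishing gradient, the i-th component of [psi] would change only quadratically near
    [x0]. But a step [t] along the i-th axis in the image moves [phi] by at most [S t], which gives
    [t <= M (S t)^2] for all small [t]. *)
Lemma straightening_grad_neq0 V W (psi phi : 'rV[R]_d -> 'rV[R]_d) (i : 'I_d) x0 :
  open V -> V x0 -> open W ->
  (forall x, V x -> W (psi x) /\ phi (psi x) = x) ->
  (forall y, W y -> V (phi y) /\ psi (phi y) = y) ->
  C2_on V (fun x => psi x 0 i) -> (forall j, C2_on W (fun y => phi y 0 j)) ->
  grad (fun x => psi x 0 i) x0 <> 0.
Proof.
move=> oV Vx0 oW hV hW Cpsi Cphi g0.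
have [M [r [M0 r0 _ ht]]] := C2_taylor oV Vx0 Cpsi.
have [Wy0 phiy0] := hV x0 Vx0; set y0 := psi x0 in Wy0 phiy0.
have hj j : exists C, 0 < C /\ \forall t \near (0 : R)^'+,
    `|phi (y0 + t *: delta_mx 0 i) 0 j - x0 0 j| <= C * t.
  have [M' [r' [M'0 r'0 _ ht']]] := C2_taylor oW Wy0 (Cphi j).
  pose g := grad (fun y => phi y 0 j) y0 0 i.
  exists (`|g| + M'); split; first by rewrite ltr_wpDl.
  near=> t.
  have t0 : 0 < t by near: t; exact: nbhs_right_gt.
  have t1 : t < 1 by near: t; exact: nbhs_right_lt.
  have tr : t < r' by near: t; exact: nbhs_right_lt.
  have wE : y0 + t *: delta_mx 0 i - y0 = t *: delta_mx 0 i.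
    by rewrite addrAC subrr add0r.
  have nt : `|(y0 + t *: delta_mx 0 i) - y0| < r'.
    rewrite wE; apply: le_lt_trans (norm_le_enorm _) _.
    by rewrite enormZ (gtr0_norm t0) enorm_delta mulr1.
  have n0 : `|y0 - y0| < r' by rewrite subrr normr0.
  have [] := ht' y0 _ n0 nt; rewrite wE dotpZr dotp_delta -/g.
  rewrite enormZ (gtr0_norm t0) enorm_delta mulr1 phiy0.
  move=> h _.
  have a1 := ler_normD (phi (y0 + t *: delta_mx 0 i) 0 j - x0 0 j - t * g) (t * g).
  rewrite subrK normrM (gtr0_norm t0) in a1.
  have a2 : M' * t ^+ 2 <= M' * t.
    by rewrite ler_wpM2l ?(ltW M'0) // expr2 ger_pMl // ltW.
  lra.
have {hj} [C hC] := choice hj.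
pose S := \sum_j C j.
have S0 : 0 < S by rewrite /S (bigD1 i) //= ltr_wpDr ?sumr_ge0 //;
  [move=> j _; have [] := hC j; move=> /ltW| have [] := hC i].
have allj : \forall t \near (0 : R)^'+, forall j,
    `|phi (y0 + t *: delta_mx 0 i) 0 j - x0 0 j| <= C j * t.
  by apply: filter_forall => j; have [] := hC j.
have Wn : \forall t \near (0 : R)^'+, W (y0 + t *: delta_mx 0 i).
  have [e /= e0 he] := (nbhs_ballP _ _).1 (open_nbhs_nbhs (conj oW Wy0)).
  near=> t; have t0 : 0 < t by near: t; exact: nbhs_right_gt.
  apply: he; rewrite -ball_normE /= opprD addNKr normrN.
  apply: le_lt_trans (norm_le_enorm _) _.
  rewrite enormZ (gtr0_norm t0) enorm_delta mulr1.
  by near: t; exact: nbhs_right_lt.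
have bad : \forall t \near (0 : R)^'+, t <= M * (S * t) ^+ 2.
  near=> t; have t0 : 0 < t by near: t; exact: nbhs_right_gt.
  have hphi : enorm (phi (y0 + t *: delta_mx 0 i) - x0) <= S * t.
    rewrite (le_trans (enorm_le_sum _)) // mulr_suml.
    apply: ler_sum => j _; rewrite !mxE.
    have : forall j, `|phi (y0 + t *: delta_mx 0 i) 0 j - x0 0 j| <= C j * t by near: t.
    exact.
  have Wt : W (y0 + t *: delta_mx 0 i) by near: t.
  have St : S * t < r.
    rewrite mulrC -ltr_pdivlMr //; near: t; apply: nbhs_right_lt; exact: divr_gt0.
  have n0 : `|x0 - x0| < r by rewrite subrr normr0.
  have nt : `|phi (y0 + t *: delta_mx 0 i) - x0| < r.
    exact: le_lt_trans (norm_le_enorm _) (le_lt_trans hphi St).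
  have [h _] := ht x0 _ n0 nt.
  have [_ E] := hW _ Wt; rewrite E g0 dotp0l subr0 !mxE !eqxx /= mulr1 in h.
  rewrite -/y0 addrAC subrr add0r gtr0_norm // in h.
  apply: le_trans h _; rewrite ler_wpM2l ?(ltW M0) //.
  by rewrite ler_pXn2r // ?nnegrE ?enorm_ge0 // mulr_ge0 // ltW.
have MS : 0 < M * S ^+ 2 by rewrite mulr_gt0 ?exprn_gt0.
have : \forall t \near (0 : R)^'+, False.
  near=> t; have t0 : 0 < t by near: t; exact: nbhs_right_gt.
  have : t <= M * (S * t) ^+ 2 by near: t.
  have -> : M * (S * t) ^+ 2 = (M * S ^+ 2 * t) * t by ring.
  rewrite ler_pMl // => h.
  have : t < (M * S ^+ 2)^-1.
    by near: t; apply: nbhs_right_lt; rewrite invr_gt0.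
  rewrite -[_^-1]mul1r ltr_pdivlMr //; lra.
by move=> /filter_ex [].
Unshelve. all: by end_near. Qed.

Definition exterior_ball G (r : R) x : Prop :=
  exists2 y, enorm (x - y) = r & forall z, G z -> r <= enorm (z - y).

(** The ball is centred at [x - r n], where [n] is the unit gradient of the defining function [u].
    For [z = x + w] inside it, [dotp n w < - |w|^2 / (2 r)], so for small [r] the linear term beats
    the Taylor error and [u z] is negative, while [u > 0] on [G]. *)
Lemma exterior_ball_near G x0 : C2_boundary G -> frontier G x0 ->
  exists2 rho, 0 < rho & forall x r, `|x - x0| < rho -> frontier G x ->
    0 < r < rho -> exterior_ball G r x.
Proof.
move=> hG fx0.
have [V [W [psi [phi [i [[oV Vx0] oW [hV hW] [Cpsi Cphi] hGV]]]]]] := hG x0 fx0.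
pose u x := psi x 0 i.
have g0 : grad u x0 <> 0.
  exact: (straightening_grad_neq0 oV Vx0 oW hV hW (Cpsi i) Cphi).
have [M [r1 [M0 r10 rV ht]]] := C2_taylor oV Vx0 (Cpsi i).
pose c := enorm (grad u x0) / 2.
have c0 : 0 < c by rewrite divr_gt0 // enorm_gt0.
have d0 : (0 : R) < d%:R by rewrite ltr0n (leq_ltn_trans (leq0n i)).
(* The three bounds keep all points in the range of the Taylor estimate, make the linear term
   dominate, and keep the gradient at [x] at least half as large as at [x0]. *)
pose rho := Num.min (r1 / 4) (Num.min (c / (2 * M)) (c / (M * d%:R) )).
have rho0 : 0 < rho by rewrite !lt_min (divr_gt0 r10) // !(divr_gt0 c0) ?mulr_gt0.
exists rho => // x r xx0 fx /andP[rr0 rrho].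
have rr1 : rho <= r1 / 4 by rewrite ge_min lexx.
have rr2 : rho <= c / (2 * M) by rewrite !ge_min lexx orbT.
have rr3 : rho <= c / (M * d%:R) by rewrite !ge_min lexx !orbT.
have xr1 : `|x - x0| < r1 by lra.
have Vx := rV x xr1.
have ux : u x = 0 by have [_ [h _]] := hGV x Vx; exact: h.
have gx : c <= enorm (grad u x).
  have n0 : `|x0 - x0| < r1 by rewrite subrr normr0.
  have [_ h] := ht x0 x n0 xr1.
  have : M * enorm (x - x0) <= c.
    have h1 : enorm (x - x0) <= d%:R * (c / (M * d%:R)).
      apply: le_trans (enorm_le_norm _) _; rewrite ler_wpM2l //; lra.
    have -> : c = M * (d%:R * (c / (M * d%:R))) by field; rewrite !gt_eqF.
    by rewrite ler_wpM2l // ltW.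
  have := enormD (grad u x0 - grad u x) (grad u x); rewrite subrK enormC.
  rewrite /c; lra.
have gx0 : 0 < enorm (grad u x) by lra.
have [n nn gE] : exists2 n, dotp n n = 1 & grad u x = enorm (grad u x) *: n.
  exists ((enorm (grad u x))^-1 *: grad u x).
    by rewrite dotpZl dotpZr -enormE; field; rewrite gt_eqF.
  by rewrite scalerA mulfV ?scale1r // gt_eqF.
have n1 : enorm n = 1 by rewrite /enorm nn sqrtr1.
exists (x - r *: n).
  by rewrite opprB addrCA subrr addr0 enormZ gtr0_norm // n1 mulr1.
move=> z Gz; rewrite leNgt; apply/negP => zr.
have [w wE] : exists w, w = z - x by exists (z - x).
have zw : z - (x - r *: n) = w + r *: n by rewrite wE opprB addrA addrAC.
have w2 : dotp w w + 2 * r * dotp n w < 0.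
  have : enorm (w + r *: n) ^+ 2 < r ^+ 2.
    by rewrite ltr_pXn2r // ?nnegrE ?enorm_ge0 ?(ltW rr0) // -zw.
  rewrite enormE !dotpE nn (dotpC w n); lra.
have wr : enorm w < r1.
  have : enorm w <= enorm (w + r *: n) + enorm (r *: n).
    by have := enormB (w + r *: n) (r *: n); rewrite addrK.
  rewrite enormZ n1 mulr1 (gtr0_norm rr0) -zw; lra.
have wr1 : `|z - x| < r1 / 2.
  apply: le_lt_trans (norm_le_enorm _) _; rewrite -wE.
  have : enorm w <= enorm (w + r *: n) + enorm (r *: n).
    by have := enormB (w + r *: n) (r *: n); rewrite addrK.
  rewrite enormZ n1 mulr1 (gtr0_norm rr0) -zw; lra.
have Vz : V z.
  apply: rV; have := ler_normD (z - x) (x - x0); rewrite addrA subrK; lra.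
have uz : 0 < u z by have [[h _] _] := hGV z Vz; exact: h.
have zr1 : `|z - x| < r1 by lra.
have [h _] := ht x z xr1 zr1.
rewrite -/(u x) -/(u z) ux subr0 enormE -wE in h.
have {h} := le_trans (ler_norm _) h; rewrite gE dotpZl => h.
have k1 : r * M * 2 <= c.
  have : r * (2 * M) <= c by rewrite -ler_pdivlMr ?mulr_gt0 //; lra.
  lra.
have nw : dotp n w < 0.
  have := dotpxx_ge0 w => ww; rewrite ltNge; apply/negP => nw.
  have : 0 <= 2 * r * dotp n w by rewrite !mulr_ge0 // ltW.
  lra.
have k2 : enorm (grad u x) * dotp n w <= c * dotp n w.
  by rewrite ler_wnM2r // ltW.
have k3 : 0 < c * dotp n w + M * dotp w w by lra.
have k4 : 0 < r * (c * dotp n w + M * dotp w w) by rewrite mulr_gt0.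
have k5 : r * M * 2 * dotp w w <= c * dotp w w by rewrite ler_wpM2r ?dotpxx_ge0.
have : c * (dotp w w + 2 * r * dotp n w) < 0 by rewrite pmulr_rlt0.
lra.
Qed.

Lemma closure_bounded_compact G : bounded_set G -> compact (closure G).
Proof.
move=> [B [_ hB]]; apply: bounded_closed_compact; last exact: closed_closure.
exists (B + 1); split; first exact: num_real.
move=> M hM x clx /=; rewrite leNgt; apply/negP => xM.
have e0 : 0 < `|x| - M by rewrite subr_gt0.
have [y [Gy]] := clx _ (nbhsx_ballx x _ e0).
rewrite -ball_normE /= => xy.
have := hB ((B + M) / 2) _ y Gy => /=; rewrite ltr_pdivlMr // => /(_ _) h.
have {h} : `|y| <= (B + M) / 2 by apply: h; lra.
have := ler_normD (x - y) y; rewrite subrK; lra.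
Qed.

Lemma frontier_compact G : bounded_set G -> compact (frontier G).
Proof.
move=> bG; rewrite /frontier setDE.
apply: compact_closedI; first exact: closure_bounded_compact.
by apply: open_closedC; exact: open_interior.
Qed.

(** The local statement holds for all small radii at once, so compactness of the frontier yields a
    common radius. *)
Lemma uniform_exterior_ball G : C2_bounded_domain G ->
  exists2 r, 0 < r & forall x, frontier G x -> exterior_ball G r x.
Proof.
move=> [_ _ _ bG C2G].
have fc := frontier_compact bG.
have h := (compact_near_coveringP (frontier G)).1 fc.
have := h R ((0 : R)^'+) (fun r x => frontier G x -> exterior_ball G r x)
  (at_right_proper_filter (0 : R)).
have hx x : frontier G x -> \forall x' \near x & r \near (0 : R)^'+,
    (fun r x => frontier G x -> exterior_ball G r x) r x'.
  move=> fx; have [rho rho0 hrho] := exterior_ball_near C2G fx.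
  exists ([set y | `|y - x| < rho], [set r | 0 < r < rho]) => /=.
    split.
      apply/nbhs_ballP; exists rho => // y; rewrite -ball_normE /= distrC //.
    apply: filterS (filterI (nbhs_right_gt (0 : R)) (nbhs_right_lt rho0)).
    by move=> r /= [-> ->].
  by move=> [y r] /= [yx rr] fy; exact: hrho.
move=> /(_ hx) hr.
have [r [hr1 hr2]] : exists r : R,
    frontier G `<=` (fun x => frontier G x -> exterior_ball G r x) /\ 0 < r.
  exact: (@filter_ex _ _ (at_right_proper_filter (0 : R)) _
    (filterI hr (nbhs_right_gt (0 : R)))).
by exists r => // x fx; exact: hr1.
Qed.

End exterior_balls.

(** * Linearization of the cut-off function *)

Section cutoff.
Context {R : realType} {d : nat}.
Implicit Types (m h p : jet R d) (P : jet R d -> R).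
Local Notation pairing := jet_pairing.

Lemma jet_pairingE p m :
  pairing p m = frob p.1.1 m.1.1 + dotp p.1.2 m.1.2 + p.2 * m.2.
Proof. by []. Qed.

Lemma jet_pairingDr p m h : pairing p (m + h) = pairing p m + pairing p h.
Proof. by rewrite !jet_pairingE /= frobDr dotpDr mulrDr; ring. Qed.

Lemma jet_pairingZr (t : R) p m : pairing p (t *: m) = t * pairing p m.
Proof.
rewrite !jet_pairingE /= frobZr dotpZr /GRing.scale /=; ring.
Qed.

Lemma jet_pairingC p m : pairing p m = pairing m p.
Proof. by rewrite !jet_pairingE frobC dotpC mulrC. Qed.

Lemma jet_pairingNr p m : pairing p (- m) = - pairing p m.
Proof. by rewrite -scaleN1r jet_pairingZr mulN1r. Qed.

Lemma jet_pairingDl p m h : pairing (p + h) m = pairing p m + pairing h m.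
Proof. by rewrite jet_pairingC jet_pairingDr !(jet_pairingC m). Qed.

Lemma jet_pairingNl p m : pairing (- p) m = - pairing p m.
Proof. by rewrite jet_pairingC jet_pairingNr jet_pairingC. Qed.

Lemma jet_pairingZl (t : R) p m : pairing (t *: p) m = t * pairing p m.
Proof. by rewrite jet_pairingC jet_pairingZr jet_pairingC. Qed.

Lemma jet_normE m : `|m| = Num.max (Num.max `|m.1.1| `|m.1.2|) `|m.2|.
Proof. by rewrite !prod_normE. Qed.

Lemma jet_norm_components m :
  [/\ `|m.1.1| <= `|m|, `|m.1.2| <= `|m| & `|m.2| <= `|m|].
Proof. by rewrite jet_normE; split; rewrite !le_max lexx ?orbT. Qed.

Local Notation C := (d%:R ^+ 2 + d%:R + 1 : R).

Lemma jet_pairing_le p m : `|pairing p m| <= C * (`|p| * `|m|).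
Proof.
have [p1 p2 p3] := jet_norm_components p.
have [m1 m2 m3] := jet_norm_components m.
have f1 : `|frob p.1.1 m.1.1| <= d%:R ^+ 2 * (`|p| * `|m|).
  rewrite (le_trans (ler_norm_sum _ _ _)) //.
  have h i : `|\sum_j p.1.1 i j * m.1.1 i j| <= d%:R * (`|p| * `|m|).
    rewrite (le_trans (ler_norm_sum _ _ _)) //.
    have h j : `|p.1.1 i j * m.1.1 i j| <= `|p| * `|m|.
      rewrite normrM ler_pM //.
        exact: le_trans (coord_le_norm _ _ _) p1.
      exact: le_trans (coord_le_norm _ _ _) m1.
    rewrite (le_trans (ler_sum _ (fun j _ => h j))) // sumr_const card_ord.
    by rewrite mulr_natl.
  rewrite (le_trans (ler_sum _ (fun i _ => h i))) // sumr_const card_ord.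
  by rewrite expr2 -mulrA [leRHS]mulr_natl.
have f2 : `|dotp p.1.2 m.1.2| <= d%:R * (`|p| * `|m|).
  rewrite (le_trans (ler_norm_sum _ _ _)) //.
  have h j : `|p.1.2 0 j * m.1.2 0 j| <= `|p| * `|m|.
    rewrite normrM ler_pM //.
      exact: le_trans (coord_le_norm _ _ _) p2.
    exact: le_trans (coord_le_norm _ _ _) m2.
  rewrite (le_trans (ler_sum _ (fun j _ => h j))) // sumr_const card_ord.
  by rewrite mulr_natl.
have f3 : `|p.2 * m.2| <= `|p| * `|m| by rewrite normrM ler_pM.
rewrite jet_pairingE.
rewrite !mulrDl mul1r (le_trans (ler_normD _ _)) // lerD //.
by rewrite (le_trans (ler_normD _ _)) // lerD.
Qed.

Lemma jet_norm_pairing m : `|m| ^+ 2 <= pairing m m.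
Proof.
have a1 : 0 <= frob m.1.1 m.1.1 by rewrite -fnorm_sqr sqr_ge0.
have a2 := dotpxx_ge0 m.1.2.
have a3 : 0 <= m.2 * m.2 by rewrite -expr2 sqr_ge0.
have b1 : `|m.1.1| ^+ 2 <= frob m.1.1 m.1.1.
  rewrite -fnorm_sqr ler_pXn2r ?nnegrE ?sqrtr_ge0 //.
  by apply: norm_le_coord; [exact: sqrtr_ge0|exact: coord_le_fnorm].
have b2 : `|m.1.2| ^+ 2 <= dotp m.1.2 m.1.2.
  by rewrite -enormE ler_pXn2r ?nnegrE ?enorm_ge0 ?norm_le_enorm.
have b3 : `|m.2| ^+ 2 <= m.2 * m.2 by rewrite real_normK ?num_real // expr2.
rewrite jet_normE jet_pairingE.
by rewrite /Num.max; case: ifP => _; [|case: ifP => _]; lra.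
Qed.

Lemma compact_mx_ball (m n : nat) (rho : R) :
  compact [set M : 'M[R]_(m, n) | `|M| <= rho].
Proof.
have [rho0|rho0] := ltP rho 0.
  rewrite (_ : mkset _ = set0); first exact: compact0.
  by rewrite predeqE => M; split=> //= h; have := normr_ge0 M; lra.
pose f (w : 'rV[R]_(m * n)) : 'M[R]_(m, n) := vec_mx w.
have -> : [set M : 'M[R]_(m, n) | `|M| <= rho] =
    f @` [set w : 'rV[R]_(m * n) | forall i, [set r : R | r \in `[- rho, rho]%R] (w ord0 i)].
  rewrite predeqE => M; split=> [hM|[w hw <-]].
    exists (mxvec M); last exact: mxvecK.
    move=> i; case/mxvec_indexP: i => i j; rewrite mxvecE /= in_itv /= -ler_norml.
    exact: le_trans (coord_le_norm _ _ _) hM.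
  apply: norm_le_coord => // i j; rewrite mxE.
  by have := hw (mxvec_index i j); rewrite /= in_itv /= -ler_norml.
apply: continuous_compact; last first.
  apply: (@rV_compact R (m * n) (fun=> [set r | r \in `[- rho, rho]%R])) => i.
  exact: segment_compact.
apply: (@lipschitz_within_continuous R 'rV[R]_(m * n) 'M[R]_(m, n) _ f 1) => x y _ _.
rewrite mul1r.
have E : f x - f y = vec_mx (x - y) by rewrite linearB.
rewrite E; apply: (@norm_le_coord R m n) => // i j; rewrite mxE.
exact: coord_le_norm.
Qed.

Lemma sym_jet_closed : closed (@sym_jet R d).
Proof.
move=> m clm; apply/matrixP => i j; rewrite mxE.
apply/eqP; rewrite -subr_eq0 -normr_le0; apply/ler_addgt0Pl => e e0; rewrite addr0.
have e2 : 0 < e / 2 by rewrite divr_gt0.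
have [m' [sm']] := clm _ (nbhsx_ballx m _ e2).
rewrite -ball_normE /= => mm'.
have [h _ _] := jet_norm_components (m - m').
have h1 := le_trans (coord_le_norm (m - m').1.1 i j) (le_trans h (ltW mm')).
have h2 := le_trans (coord_le_norm (m - m').1.1 j i) (le_trans h (ltW mm')).
have : m'.1.1 i j = m'.1.1 j i.
  have sE : m'.1.1^T = m'.1.1 := sm'.
  by rewrite -[in LHS]sE mxE.
move: h1 h2; rewrite /= !mxE.
move: (m.1.1 i j) (m.1.1 j i) (m'.1.1 i j) (m'.1.1 j i) => a b c f.
rewrite !ler_norml => /andP[? ?] /andP[? ?] ?; apply/andP; split; lra.
Qed.

Lemma compact_sym_ball m1 (rho : R) :
  compact [set m : jet R d | sym_jet m /\ `|m - m1| <= rho].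
Proof.
pose B := [set m : jet R d | `|m| <= `|m1| + rho].
have Bc : compact B.
  have -> : B = ([set M | `|M| <= `|m1| + rho] `*` [set q | `|q| <= `|m1| + rho])
      `*` [set z : R | `|z| <= `|m1| + rho].
    rewrite predeqE => -[[M q] z]; rewrite /B /= jet_normE /= !ge_max.
    by split=> [/andP[/andP[-> ->] ->] //|[[-> ->] ->]].
  apply: compact_setX.
    by apply: compact_setX; exact: compact_mx_ball.
  rewrite (_ : [set z : R | _] = [set` `[- (`|m1| + rho), `|m1| + rho]%R]).
    exact: segment_compact.
  by rewrite predeqE => z; rewrite /= in_itv /= -ler_norml.
have -> : [set m : jet R d | sym_jet m /\ `|m - m1| <= rho] =
    B `&` (@sym_jet R d `&` [set m | `|m - m1| <= rho]).
  rewrite predeqE => m; split=> [[sm hm]|[_ [sm hm]]] //; split=> //.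
  by rewrite /B /=; have := ler_normD (m - m1) m1; rewrite subrK; lra.
apply: compact_closedI => //; apply: closedI; first exact: sym_jet_closed.
move=> m clm /=; rewrite leNgt; apply/negP => hm.
have e0 : 0 < `|m - m1| - rho by rewrite subr_gt0.
have [m' [/= hm']] := clm _ (nbhsx_ballx m _ e0).
rewrite -ball_normE /= => h.
have := ler_normD (m - m') (m' - m1); rewrite addrA subrK; lra.
Qed.

Lemma sym_jetD m h : sym_jet m -> sym_jet h -> sym_jet (m + h).
Proof. by rewrite /sym_jet /= linearD /= => -> ->. Qed.

Lemma sym_jetZ (t : R) m : sym_jet m -> sym_jet (t *: m).
Proof. by rewrite /sym_jet /= linearZ /= => ->. Qed.

Lemma sym_jetN m : sym_jet m -> sym_jet (- m).
Proof. by rewrite -scaleN1r; exact: sym_jetZ. Qed.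

Lemma convex_midpoint P m h : @convex_function R (jet R d) (@sym_jet R d) P ->
  sym_jet m -> sym_jet h -> 2 * P m <= P (m + h) + P (m - h).
Proof.
move=> cP sm sh.
have h0 : 0 <= 2^-1 :> R by rewrite invr_ge0.
have h1 : 2^-1 <= 1 :> R by lra.
have a1 : (m + h : convex_lmodType (jet R d)) \in @sym_jet R d.
  by rewrite inE; exact: sym_jetD.
have a2 : (m - h : convex_lmodType (jet R d)) \in @sym_jet R d.
  by rewrite inE; apply: sym_jetD => //; exact: sym_jetN.
move: cP; rewrite /convex_function => /(_ (Itv01 h0 h1) (m + h) (m - h) a1 a2).
rewrite convRE /conv /= /unstable.onem.
have -> : 1 - 2^-1 = 2^-1 :> R by lra.
have -> : 2^-1 *: (m + h) + 2^-1 *: (m - h) = m.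
  rewrite -scalerDr addrACA subrr addr0 -{1 2}[m]scale1r -scalerDl scalerA.
  have -> : 2^-1 * (1 + 1) = 1 :> R by lra.
  by rewrite scale1r.
move: (P m) (P (m + h)) (P (m - h)) => p q r; lra.
Qed.

(* A maximizer m0 of P - |. - m1|^2 / (2 e) is a point of differentiability:
   the convex function P is touched there from above by a paraboloid. *)
Lemma cutoff_linearization P (deltahat K1 th : R) m1 :
  cutoff_function deltahat K1 P -> sym_jet m1 -> 0 < th ->
  exists p, [/\ elliptic deltahat p.1.1, enorm p.1.2 <= K1, p.2 < 0, - K1 <= p.2 &
    `|P m1 - jet_pairing p m1| <= th].
Proof.
move=> [cP hP lP gP _] sm1 th0.
have [L [L0 HL]] : exists L, 0 < L /\ forall m m', sym_jet m -> sym_jet m' ->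
    P m - P m' <= L * `|m - m'|.
  have [M [_ hM]] := lP.
  exists (`|M| + 1); split=> [|m m' sm sm']; first by rewrite ltr_wpDl.
  have hML : M < `|M| + 1 by rewrite (le_lt_trans (ler_norm M)) // ltrDl.
  have := hM _ hML (m, m') (conj sm sm') => /=.
  exact: le_trans (ler_norm _).
have C1 : 1 <= C by rewrite lerDr addr_ge0 ?exprn_ge0.
have C0 : 0 <= C := le_trans ler01 C1.
(* With [rho = 2 L e] the final error [L rho + C rho^2 / e] is exactly [th]. *)
pose e := th / (L ^+ 2 * (2 + 4 * C)).
have L2 : 0 < L ^+ 2 * (2 + 4 * C) by rewrite mulr_gt0 ?exprn_gt0 //; lra.
have e0 : 0 < e by rewrite divr_gt0.
have thE : th = L ^+ 2 * (2 + 4 * C) * e by rewrite /e mulrC divfK // gt_eqF.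
clearbody e.
pose Q m := pairing (m - m1) (m - m1).
pose H m := P m - Q m / (2 * e).
pose rho := 2 * L * e.
have rho0 : 0 <= rho by rewrite /rho mulr_ge0 ?(ltW e0) // mulr_ge0 // ltW.
have Qge m : `|m - m1| ^+ 2 / (2 * e) <= Q m / (2 * e).
  by rewrite ler_pM2r ?invr_gt0 ?mulr_gt0 // jet_norm_pairing.
have H1 : H m1 = P m1 by rewrite /H /Q subrr -(scale0r 0) jet_pairingZr !mul0r subr0.
(* Beyond distance [rho] the quadratic penalty beats the Lipschitz growth of [P], so a maximum over
   a compact ball is a maximum over all symmetric jets. *)
have far m : sym_jet m -> rho < `|m - m1| -> H m < H m1.
  move=> sm hm; rewrite H1 /H.
  have q1 := HL m m1 sm sm1; have q2 := Qge m.
  have : L * `|m - m1| < `|m - m1| ^+ 2 / (2 * e).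
    rewrite ltr_pdivlMr ?mulr_gt0 // expr2.
    have -> : L * `|m - m1| * (2 * e) = rho * `|m - m1| by rewrite /rho; ring.
    by rewrite ltr_pM2r // (le_lt_trans rho0 hm).
  lra.
pose K := [set m : jet R d | sym_jet m /\ `|m - m1| <= rho].
have Hc : {within K, continuous H}.
  apply: (@lipschitz_within_continuous _ _ _ _ _ (L + C * (2 * rho) / (2 * e))).
  move=> m m' [sm hm] [sm' hm'].
  have Qd : Q m - Q m' = pairing (m - m') ((m - m1) + (m' - m1)).
    rewrite /Q !(jet_pairingDl, jet_pairingDr, jet_pairingNl, jet_pairingNr).
    by rewrite (jet_pairingC m' m) (jet_pairingC m1 m) (jet_pairingC m1 m'); ring.
  have q1 : `|Q m - Q m'| <= C * (2 * rho) * `|m - m'|.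
    rewrite Qd (le_trans (jet_pairing_le _ _)) // -mulrA ler_wpM2l //.
    rewrite mulrC ler_wpM2r // (le_trans (ler_normD _ _)) //; lra.
  have q2 : `|P m - P m'| <= L * `|m - m'|.
    rewrite ler_norml; apply/andP; split; last exact: HL.
    by rewrite lerNl opprB distrC HL.
  have -> : H m - H m' = (P m - P m') - (Q m - Q m') / (2 * e) by rewrite /H; ring.
  rewrite (le_trans (ler_normB _ _)) // [leRHS]mulrDl lerD //.
  rewrite normrM normfV (gtr0_norm (_ : 0 < 2 * e)) ?mulr_gt0 //.
  by rewrite mulrAC ler_pM2r ?invr_gt0 ?mulr_gt0.
have K0 : K !=set0 by exists m1; split=> //; rewrite subrr normr0.
have Kc : compact K by exact: compact_sym_ball.
have [m0 /set_mem [sm0 hm0] mx] := compact_EVT_max K0 Kc Hc.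
have maxH m : sym_jet m -> H m <= H m0.
  move=> sm; have [hm|hm] := leP `|m - m1| rho; first by apply: mx; rewrite inE.
  apply: le_trans (ltW (far m sm hm)) _; apply: mx; rewrite inE; split=> //.
  by rewrite subrr normr0.
pose p := e^-1 *: (m0 - m1).
have sp : sym_jet p by apply: sym_jetZ; apply: sym_jetD => //; exact: sym_jetN.
have up h : sym_jet h -> P (m0 + h) - P m0 <= pairing p h + C * `|h| ^+ 2 / (2 * e).
  move=> sh; have := maxH _ (sym_jetD sm0 sh); rewrite /H.
  have -> : Q (m0 + h) = Q m0 + 2 * pairing (m0 - m1) h + pairing h h.
    rewrite /Q addrAC; move: (m0 - m1) => D.
    by rewrite jet_pairingDl !jet_pairingDr (jet_pairingC h D); ring.
  have -> : pairing p h = 2 * pairing (m0 - m1) h / (2 * e).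
    by rewrite /p jet_pairingZl; field; rewrite gt_eqF.
  have : pairing h h / (2 * e) <= C * `|h| ^+ 2 / (2 * e).
    rewrite ler_pM2r ?invr_gt0 ?mulr_gt0 // expr2.
    exact: le_trans (ler_norm _) (jet_pairing_le _ _).
  by rewrite !mulrDl; lra.
(* The upper bound [up] at [- h] and the midpoint inequality of the convex function [P] give the
   matching lower bound at [h]. *)
have grad_p : is_jet_gradient P m0 p.
  split=> // e' e'0; apply/nbhs_ballP; exists (e' / (C / (2 * e))) => /=.
    by rewrite !divr_gt0 ?mulr_gt0 //; lra.
  move=> h; rewrite -ball_normE /= sub0r normrN => hh sh.
  have hC : C * `|h| ^+ 2 / (2 * e) <= e' * `|h|.
    have -> : C * `|h| ^+ 2 / (2 * e) = (C / (2 * e) * `|h|) * `|h|.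
      by field; rewrite gt_eqF.
    rewrite ler_wpM2r // mulrC -ler_pdivlMr ?ltW // divr_gt0 ?mulr_gt0 //; lra.
  have u1 := up h sh; have u2 := up (- h) (sym_jetN sh).
  have u3 := convex_midpoint cP sm0 sh.
  rewrite jet_pairingNr normrN in u2.
  by rewrite ler_norml; apply/andP; split; lra.
have [el q1 p2 p3] := gP m0 p sm0 grad_p.
(* Euler's identity for a function homogeneous of degree one, from the expansion of [P] at [m0] in
   the direction [m0]. *)
have euler : P m0 = pairing p m0.
  apply/eqP; rewrite -subr_eq0 -normr_le0; apply/ler_addgt0Pl => e1 e10; rewrite addr0.
  have e2 : 0 < e1 / (`|m0| + 1) by rewrite divr_gt0 // ltr_wpDl.
  have [_ /(_ _ e2) /nbhs_ballP [r /= r0 hr]] := grad_p.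
  pose t := r / 2 / (`|m0| + 1).
  have t0 : 0 < t by rewrite !divr_gt0 // ltr_wpDl.
  have tm : `|t *: m0| < r.
    rewrite normrZ (gtr0_norm t0) /t mulrAC ltr_pdivrMr ?ltr_wpDl //.
    by have := normr_ge0 m0; nra.
  have := hr (t *: m0); rewrite -ball_normE /= sub0r normrN => /(_ tm (sym_jetZ t sm0)).
  have -> : m0 + t *: m0 = (1 + t) *: m0 by rewrite scalerDl scale1r.
  rewrite hP ?addr_gt0 // jet_pairingZr normrZ (gtr0_norm t0).
  have -> : (1 + t) * P m0 - P m0 - t * pairing p m0 = t * (P m0 - pairing p m0).
    by ring.
  rewrite normrM (gtr0_norm t0) mulrCA ler_pM2l // => /le_trans; apply.
  rewrite mulrAC ler_pdivrMr ?ltr_wpDl // ler_wpM2l ?(ltW e10) //.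
  by rewrite lerDl.
exists p; split=> //.
have -> : P m1 - pairing p m1 = (P m1 - P m0) + pairing p (m0 - m1).
  by rewrite jet_pairingDr jet_pairingNr euler; ring.
have b1 : `|P m1 - P m0| <= L * rho.
  have c1 := HL m1 m0 sm1 sm0; have c2 := HL m0 m1 sm0 sm1.
  rewrite (distrC m1) in c1.
  have : L * `|m0 - m1| <= L * rho by rewrite ler_wpM2l // ltW.
  by rewrite ler_norml => c3; apply/andP; split; lra.
have b2 : `|pairing p (m0 - m1)| <= C * (rho ^+ 2 / e).
  rewrite /p jet_pairingZl normrM gtr0_norm ?invr_gt0 // mulrC mulrA.
  rewrite ler_pM2r ?invr_gt0 //; apply: le_trans (jet_pairing_le _ _) _.
  by rewrite ler_wpM2l // expr2 ler_pM.
apply: le_trans (ler_normD _ _) _.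
have -> : th = L * rho + C * (rho ^+ 2 / e).
  by rewrite thE /rho; field; rewrite gt_eqF.
exact: lerD.
Qed.

End cutoff.

(** * Barriers *)

Section line_jets.
Context {R : realType}.
Implicit Types (m : R -> R) (g h t : R).

(** [g] and [h] are the first two derivatives at 0. Testing maxima along lines makes it possible to
    add jets of solutions, barriers and penalties without computing the matrices [hess] of the
    sums. *)
Definition line_jet m g h : Prop := exists r (dm : R -> R),
  [/\ 0 < r, forall t : R, `|t| < r -> is_derive t 1 m (dm t), dm 0 = g &
    is_derive (0 : R) 1 dm h].

Lemma line_jet_eq m m' g g' h h' :
  line_jet m g h -> m = m' -> g = g' -> h = h' -> line_jet m' g' h'.
Proof. by move=> j <- <- <-. Qed.

Lemma line_jetD m m' g g' h h' : line_jet m g h -> line_jet m' g' h' ->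
  line_jet (fun t => m t + m' t) (g + g') (h + h').
Proof.
move=> [r [dm [r0 d1 e1 d2]]] [r' [dm' [r'0 d1' e1' d2']]].
exists (Num.min r r'), (fun t => dm t + dm' t); split.
- by rewrite lt_min r0.
- by move=> t; rewrite lt_min => /andP[a b]; apply: is_deriveD; [exact: d1|exact: d1'].
- by rewrite e1 e1'.
- exact: is_deriveD.
Qed.

Lemma line_jetZ (k : R) m g h : line_jet m g h ->
  line_jet (fun t => k * m t) (k * g) (k * h).
Proof.
move=> [r [dm [r0 d1 e1 d2]]]; exists r, (fun t => k * dm t); split=> //.
- by move=> t tr; apply: is_deriveZ; exact: d1.
- by rewrite e1.
- exact: is_deriveZ.
Qed.

Lemma line_jetB m m' g g' h h' : line_jet m g h -> line_jet m' g' h' ->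
  line_jet (fun t => m t - m' t) (g - g') (h - h').
Proof.
move=> j /(line_jetZ (-1)) /(line_jetD j) j'.
by apply: line_jet_eq j' _ _ _; [apply/funext => t| |]; rewrite mulN1r.
Qed.

Lemma line_jet_max m g h r : line_jet m g h -> 0 < r ->
  (forall t, `|t| < r -> m t <= m 0) -> g = 0 /\ h <= 0.
Proof.
move=> [r' [dm [r'0 d1 <- d2]]] r0 mx.
apply: (@second_derivative_max R m dm h (Num.min r r')) => //.
- by rewrite lt_min r0.
- by move=> t; rewrite lt_min => /andP[_ /d1].
- by move=> t; rewrite lt_min => /andP[/mx].
Qed.

Lemma is_derive_quad (a b c t : R) :
  is_derive t 1 (fun s => a + b * s + c * s ^+ 2) (b + 2 * c * t).
Proof.
have -> : (fun s => a + b * s + c * s ^+ 2) =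
    cst a + b \*: (id : R -> R) + c \*: ((id : R -> R) ^+ 2).
  by apply/funext => s /=; rewrite !fctE.
by apply: is_derive_eq; rewrite /GRing.scale /= add0r expr1 !mulr1; ring.
Qed.

Lemma line_jet_quad (a b c : R) :
  line_jet (fun t => a + b * t + c * t ^+ 2) b (2 * c).
Proof.
exists 1, (fun t => b + 2 * c * t); split=> //.
- by move=> t _; exact: is_derive_quad.
- by rewrite mulr0 addr0.
- have := is_derive_quad b (2 * c) 0 0; rewrite mulr0 addr0.
  by under [X in is_derive _ _ X]eq_fun do rewrite mul0r addr0.
Qed.

Lemma line_jet_expR_quad (a b c : R) :
  line_jet (fun t => expR (a + b * t + c * t ^+ 2)) (expR a * b)
    (expR a * (b ^+ 2 + 2 * c)).
Proof.
pose q t := a + b * t + c * t ^+ 2.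
have dq (t : R) : is_derive t 1 (fun t => expR (q t)) (expR (q t) * (b + 2 * c * t)).
  have h := is_derive_quad a b c t.
  by have := is_derive1_comp (is_derive_expR (q t)) h; rewrite mulrC.
exists 1, (fun t => expR (q t) * (b + 2 * c * t)); split=> //.
- by rewrite /q !mulr0 expr0n mulr0 !addr0.
- have h1 := dq 0; have [r [dm [r0 h2 e2 _]]] := line_jet_quad b (2 * c) 0.
  have h0 : is_derive (0 : R) 1 (fun t => b + 2 * c * t) (2 * c).
    have := is_derive_quad b (2 * c) 0 0; rewrite mulr0 addr0.
    by under [X in is_derive _ _ X]eq_fun do rewrite mul0r addr0.
  have := is_deriveM h1 h0; rewrite /q !mulr0 expr0n mulr0 !addr0.
  move=> hh; apply: is_derive_eq; rewrite /GRing.scale /=; ring.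
Qed.

End line_jets.

Section line_jets_rV.
Context {R : realType} {d : nat}.
Implicit Types (u : 'rV[R]_d -> R) (x y v : 'rV[R]_d).

Lemma line_jet_hess u x v : (\forall y \near x, differentiable u y) ->
  differentiable (grad u) x ->
  line_jet (fun t => u (x + t *: v)) (dotp (grad u x) v) (qform (hess u x) v v).
Proof.
move=> /nbhs_ballP [r /= r0 hu] dg.
exists (r / (`|v| + 1)), (fun t => dotp (grad u (x + t *: v)) v); split.
- by rewrite divr_gt0 // ltr_wpDl.
- move=> t tr; apply: is_derive_grad; apply: hu.
  rewrite -ball_normE /= opprD addNKr normrN normrZ.
  move: tr; rewrite ltr_pdivlMr ?ltr_wpDl //; apply: le_lt_trans.
  by rewrite ler_wpM2l // lerDl.
- by rewrite scale0r addr0.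
- exact: is_derive_hess.
Qed.

Lemma line_jet_dotp (p x v : 'rV[R]_d) :
  line_jet (fun t => dotp p (x + t *: v)) (dotp p v) 0.
Proof.
apply: line_jet_eq (line_jet_quad (dotp p x) (dotp p v) 0) _ _ _ => //; last ring.
by apply/funext => t; rewrite dotpDr dotpZr; ring.
Qed.

Lemma line_jet_sqr (x v : 'rV[R]_d) :
  line_jet (fun t => dotp (x + t *: v) (x + t *: v)) (2 * dotp x v) (2 * dotp v v).
Proof.
apply: line_jet_eq (line_jet_quad (dotp x x) (2 * dotp x v) (dotp v v)) _ _ _ => //.
by apply/funext => t; rewrite !dotpE (dotpC v x); ring.
Qed.

End line_jets_rV.

Section barrier.
Context {R : realType} {d : nat}.
Implicit Types (x y v : 'rV[R]_d) (a : 'M[R]_d) (b : 'rV[R]_d) (c : R).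

(** The classical exponential barrier for an exterior ball, normalized to vanish on the sphere of
    radius [r] about [y]. Its gradient and Hessian are given below in closed form and are justified
    by [line_jet_barrier]. *)
Definition barrier (mu r : R) y x : R :=
  1 - expR (mu * (r ^+ 2 - dotp (x - y) (x - y))).

Definition barrier_grad (mu r : R) y x : 'rV[R]_d :=
  (2 * mu * expR (mu * (r ^+ 2 - dotp (x - y) (x - y)))) *: (x - y).

Definition barrier_hess (mu r : R) y x : 'M[R]_d :=
  expR (mu * (r ^+ 2 - dotp (x - y) (x - y))) *:
    ((2 * mu) *: 1%:M - (4 * mu ^+ 2) *: ((x - y)^T *m (x - y))).

Lemma line_jet_barrier (mu r : R) y x v :
  line_jet (fun t => barrier mu r y (x + t *: v)) (dotp (barrier_grad mu r y x) v)
    (qform (barrier_hess mu r y x) v v).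
Proof.
have j1 := line_jet_quad (1 : R) 0 0.
have j2 := line_jet_expR_quad (mu * (r ^+ 2 - dotp (x - y) (x - y)))
  (- (2 * mu * dotp (x - y) v)) (- (mu * dotp v v)).
apply: line_jet_eq (line_jetB j1 j2) _ _ _.
- apply/funext => t; rewrite /barrier !mul0r !addr0; congr (1 - expR _).
  have -> : x + t *: v - y = (x - y) + t *: v by rewrite addrAC.
  move: (x - y) => w; rewrite !dotpE (dotpC v w); ring.
- rewrite /barrier_grad; move: (x - y) => w; rewrite dotpZl; ring.
- rewrite /barrier_hess; move: (x - y) => w.
  rewrite !qfE qform_tensor (dotpC v w); ring.
Qed.

Lemma expR_le0_lipschitz (s t : R) : s <= 0 -> t <= 0 ->
  `|expR s - expR t| <= `|s - t|.
Proof.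
wlog st : s t / s <= t.
  move=> h s0 t0; have [st|ts] := leP s t; first exact: h.
  by rewrite distrC (distrC s); apply: h => //; exact: ltW.
move=> s0 t0; rewrite distrC (distrC s) !ger0_norm ?subr_ge0 ?ler_expR //.
have -> : expR t - expR s = expR t * (1 - expR (s - t)).
  by rewrite mulrBr mulr1 -expRD; congr (_ - expR _); ring.
have e1 := expR_ge1Dx (s - t).
have e2 : expR t <= 1 by rewrite -expR0 ler_expR.
have e3 := expR_gt0 t.
have e4 : expR (s - t) <= 1 by rewrite -expR0 ler_expR subr_le0.
apply: (@le_trans _ _ (1 * (1 - expR (s - t)))); last lra.
by rewrite ler_wpM2r // subr_ge0.
Qed.

Definition annulus (r Dm : R) y : set 'rV[R]_d :=
  [set x | r <= enorm (x - y) <= Dm].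

Definition barrier_exponent (mu r : R) y x : R :=
  mu * (r ^+ 2 - dotp (x - y) (x - y)).

Context (mu r Dm : R) (y : 'rV[R]_d) (mu0 : 0 < mu) (r0 : 0 < r).
Local Notation ann := (annulus r Dm y).
Local Notation expo := (barrier_exponent mu r y).

Lemma barrier_exponent_le0 x : ann x -> expo x <= 0.
Proof.
move=> /andP[h _]; rewrite /barrier_exponent pmulr_rle0 // subr_le0 -enormE.
by rewrite ler_pXn2r // ?nnegrE ?enorm_ge0 // ltW.
Qed.

Lemma barrier_exponent_lipschitz x x' : ann x -> ann x' ->
  `|expo x - expo x'| <= mu * (2 * Dm) * enorm (x - x').
Proof.
move=> /andP[_ h] /andP[_ h'].
have -> : expo x - expo x' = - mu * dotp (x - x') ((x - y) + (x' - y)).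
  have -> : x - x' = (x - y) - (x' - y) by rewrite opprB addrA subrK.
  rewrite /barrier_exponent; move: (x - y) (x' - y) => w w'.
  by rewrite !dotpE (dotpC w' w); ring.
rewrite normrM normrN (gtr0_norm mu0) -mulrA ler_wpM2l ?(ltW mu0) //.
rewrite (le_trans (dotp_CS _ _)) // mulrC ler_wpM2r ?enorm_ge0 //.
by rewrite (le_trans (enormD _ _)) //; lra.
Qed.

Lemma barrier_ge0 x : ann x -> 0 <= barrier mu r y x.
Proof. by move=> ax; rewrite /barrier subr_ge0 -expR0 ler_expR barrier_exponent_le0. Qed.

Lemma barrier_le1 x : barrier mu r y x <= 1.
Proof. by rewrite /barrier gerBl expR_ge0. Qed.

Lemma barrier_le_linear x x0 : enorm (x0 - y) = r -> ann x -> ann x0 ->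
  barrier mu r y x <= mu * (2 * Dm) * enorm (x - x0).
Proof.
move=> h ax ax0; have := barrier_exponent_lipschitz ax0 ax.
have e0 : expo x0 = 0 by rewrite /barrier_exponent -enormE h subrr mulr0.
rewrite e0 sub0r normrN enormC; apply: le_trans.
have h1 := expR_ge1Dx (expo x).
have h2 : - expo x <= `|expo x| by rewrite -normrN ler_norm.
by rewrite (le_trans _ h2) // /barrier -/(expo x); lra.
Qed.

Lemma barrier_lipschitz x x' : ann x -> ann x' ->
  `|barrier mu r y x - barrier mu r y x'| <= mu * (2 * Dm) * enorm (x - x').
Proof.
move=> ax ax'; apply: le_trans (barrier_exponent_lipschitz ax ax').
have -> : barrier mu r y x - barrier mu r y x' = expR (expo x') - expR (expo x).
  by rewrite /barrier /barrier_exponent; ring.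
by rewrite (le_trans (expR_le0_lipschitz _ _)) ?barrier_exponent_le0 // distrC.
Qed.

Lemma barrier_grad_lipschitz x x' : ann x -> ann x' ->
  enorm (barrier_grad mu r y x - barrier_grad mu r y x') <=
    (2 * mu * (1 + mu * (2 * Dm) * Dm)) * enorm (x - x').
Proof.
move=> ax ax'; rewrite /barrier_grad -/(expo x) -/(expo x').
have -> : (2 * mu * expR (expo x)) *: (x - y) - (2 * mu * expR (expo x')) *: (x' - y)
  = (2 * mu) *: (expR (expo x) *: (x - x') + (expR (expo x) - expR (expo x')) *: (x' - y)).
  by apply/rowP => i; rewrite !mxE; ring.
have e1 : expR (expo x) <= 1 by rewrite -expR0 ler_expR barrier_exponent_le0.
have e2 := le_trans
  (expR_le0_lipschitz (barrier_exponent_le0 ax) (barrier_exponent_le0 ax'))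
  (barrier_exponent_lipschitz ax ax').
rewrite enormZ ger0_norm ?mulr_ge0 ?(ltW mu0) // -[leRHS]mulrA.
rewrite ler_wpM2l ?mulr_ge0 ?(ltW mu0) //.
rewrite (le_trans (enormD _ _)) // !enormZ mulrDl lerD //.
  by rewrite ler_wpM2r ?enorm_ge0 // ger0_norm ?expR_ge0.
rewrite mulrAC; have /andP[_ h] := ax'.
by rewrite ler_pM ?enorm_ge0.
Qed.

(** The part of the Hessian that is quadratic in [mu] is negative in the radial direction and
    dominates. The equation for [mu] says that it exceeds the trace and drift terms by exactly 1 at
    the inner radius. *)
Lemma barrier_strict (kappa K1 : R) x a b c :
  0 < kappa -> 2 * mu * kappa * r ^+ 2 = d%:R / kappa + K1 * Dm + 1 -> 0 <= K1 ->
  ann x -> elliptic kappa a -> enorm b <= K1 -> 0 <= c ->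
  frob a (barrier_hess mu r y x) + dotp b (barrier_grad mu r y x)
    - c * barrier mu r y x <= - (2 * mu * expR (- (mu * Dm ^+ 2))).
Proof.
move=> k0 muE K10 ax ea bK c0.
have h0 : 0 <= c * barrier mu r y x by rewrite mulr_ge0 ?barrier_ge0.
have E0 := expR_gt0 (expo x).
have [asym ae] := ea; have /andP[rx xD] := ax.
have tr_a : \tr a <= d%:R / kappa.
  have := @frob_le_elliptic R d kappa 1 a 1%:M k0 ea ler01.
  by rewrite frob1 mulr1; apply => v; rewrite qform1 mul1r.
have qa : kappa * r ^+ 2 <= qform a (x - y) (x - y).
  rewrite qformE; have /andP[h _] := ae (x - y); apply: le_trans h.
  by rewrite ler_pM2l // ler_pXn2r // ?nnegrE ?enorm_ge0 // ltW.
have bx : dotp b (x - y) <= K1 * Dm.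
  rewrite (le_trans (dotp_le _ _)) // ler_pM ?enorm_ge0 //.
have Ege : expR (- (mu * Dm ^+ 2)) <= expR (expo x).
  rewrite ler_expR /barrier_exponent -mulrN ler_pM2l // -enormE.
  have : enorm (x - y) ^+ 2 <= Dm ^+ 2.
    by rewrite ler_pXn2r // ?nnegrE ?enorm_ge0 // (le_trans (enorm_ge0 _) xD).
  by have := sqr_ge0 r; lra.
rewrite /barrier_hess /barrier_grad -/(expo x).
rewrite frobZr frobDr frobNr !frobZr frob1 frobC frob_tensor dotpZr.
set E := expR (expo x) in E0 Ege *; set e := expR (- _) in Ege *.
set T := \tr a in tr_a *; set q := qform a _ _ in qa *; set B := dotp b _ in bx *.
have main : T - 2 * mu * q + B <= -1.
  have : 2 * mu * (kappa * r ^+ 2) <= 2 * mu * q by rewrite ler_pM2l // mulr_gt0.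
  by move: muE; rewrite -mulrA; lra.
have m2 : 2 * mu * E * (T - 2 * mu * q + B) <= 2 * mu * E * -1.
  by rewrite ler_pM2l // !mulr_gt0.
have m3 : 2 * mu * e <= 2 * mu * E by rewrite ler_pM2l // mulr_gt0.
lra.
Qed.

End barrier.

(** * Maximum principle *)

Section comparison.
Context {R : realType} {d : nat}.
Implicit Types (u U psi : 'rV[R]_d -> R) (x y z v p q : 'rV[R]_d)
  (G : set 'rV[R]_d) (a : 'M[R]_d) (b : 'rV[R]_d) (c f : R).

Lemma open_line G x v : open G -> G x ->
  exists2 r, 0 < r & forall t : R, `|t| < r -> G (x + t *: v).
Proof.
move=> oG Gx; have [r /= r0 hr] := (nbhs_ballP _ _).1 (open_nbhs_nbhs (conj oG Gx)).
exists (r / (`|v| + 1)); first by rewrite divr_gt0 // ltr_wpDl.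
move=> t; rewrite ltr_pdivlMr ?ltr_wpDl // => tr; apply: hr.
rewrite -ball_normE /= opprD addNKr normrN normrZ; apply: le_lt_trans tr.
by rewrite ler_wpM2l // lerDl.
Qed.

Lemma line_jet_derive (m : R -> R) (g h : R) :
  line_jet m g h -> is_derive (0 : R) 1 m g.
Proof. by move=> [r [dm [r0 d1 <- _]]]; apply: d1; rewrite normr0. Qed.

(** Only differentiability at the point is assumed, because the identity for the gradient is needed
    at every perturbed maximum, including those in the exceptional null set. *)
Lemma derive_local_max (m : R -> R) (g r : R) : is_derive (0 : R) 1 m g ->
  0 < r -> (forall t, `|t| < r -> m t <= m 0) -> g = 0.
Proof.
move=> [dm dE] r0 mx.
have cv : (fun h : R => h^-1 *: ((m \o shift 0) (h *: 1) - m 0)) @ 0^' --> g.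
  by rewrite -dE; exact: dm.
apply/eqP; rewrite -normr_le0 leNgt; apply/negP => g0.
have /cvgrPdist_lt /(_ _ g0) := cv.
rewrite /= near_withinE => /nbhs_ballP [e /= e0 he].
pose t := Num.min e r / 2.
have mr0 : 0 < Num.min e r by rewrite lt_min e0.
have t0 : 0 < t by rewrite divr_gt0.
have [te tr] : t < e /\ t < r.
  have : Num.min e r <= e by rewrite ge_min lexx.
  have : Num.min e r <= r by rewrite ge_min lexx orbT.
  by rewrite /t; move: (Num.min e r) mr0 => M *; split; lra.
have quot s : `|s| = t -> `|g - s^-1 * (m s - m 0)| < `|g|.
  move=> st; have := he s; rewrite -ball_normE /= sub0r normrN st addr0 [s *: 1]mulr1.
  by apply=> //; rewrite -normr_gt0 st.
have mt s : `|s| = t -> m s - m 0 <= 0 by move=> st; rewrite subr_le0 mx // st.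
have q1 := quot t (gtr0_norm t0).
have m1 := mt t (gtr0_norm t0).
have q2 := quot (- t); rewrite normrN in q2; have {}q2 := q2 (gtr0_norm t0).
have m2 := mt (- t); rewrite normrN in m2; have {}m2 := m2 (gtr0_norm t0).
have ti : 0 < t^-1 by rewrite invr_gt0.
have k1 : t^-1 * (m t - m 0) <= 0 by rewrite pmulr_rle0.
have k2 : 0 <= (- t)^-1 * (m (- t) - m 0).
  by rewrite invrN mulNr oppr_ge0 pmulr_rle0.
have [gp|gn] := leP 0 g.
  by move: q1; rewrite (ger0_norm gp) ltr_norml => /andP[_]; lra.
by move: q2; rewrite (ltr0_norm gn) ltr_norml => /andP[+ _]; lra.
Qed.

Lemma lipschitz_inP (V W : normedModType R) (C : set V) (h : V -> W) :
  [lipschitz h x | x in C] ->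
  exists2 L, 0 <= L & forall x y : V, C x -> C y -> `|h x - h y| <= L * `|x - y|.
Proof.
move=> [M [_ hM]]; exists (`|M| + 1) => [|x y Cx Cy]; first by rewrite addr_ge0.
have hML : M < `|M| + 1 by rewrite (le_lt_trans (ler_norm M)) // ltrDl.
exact: (hM _ hML (x, y) (conj Cx Cy)).
Qed.

Lemma frontier_open G x : open G -> closure G x -> ~ frontier G x -> G x.
Proof.
move=> oG cx nf; apply: contrapT => nG; apply: nf; split=> //.
by have := (interior_id G).1 oG => ->.
Qed.

Lemma near_differentiable G u x : open G -> G x ->
  (forall x, G x -> differentiable u x) -> \forall y \near x, differentiable u y.
Proof.
move=> oG Gx du; have := open_nbhs_nbhs (conj oG Gx).
by apply: filterS => y; exact: du.
Qed.

Definition coef_bounds (kappa K1 : R) a b c f : Prop :=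
  [/\ elliptic kappa a, enorm b <= K1, 0 <= c <= K1 & `|f| <= K1].

(** A subsolution inequality for the supremum over all operators of the class, with the supremum
    replaced by a choice that is optimal up to [th]. *)
Definition pucci_sub (kappa K1 : R) U x : Prop :=
  differentiable (grad U) x /\ forall th, 0 < th -> exists a b c f,
    coef_bounds kappa K1 a b c f /\
    - th <= frob a (hess U x) + dotp b (grad U x) - c * U x + f.

Lemma frob_le_psd kappa a (M M' : 'M[R]_d) : 0 < kappa -> elliptic kappa a ->
  (forall v, qform M v v <= qform M' v v) -> frob a M <= frob a M'.
Proof.
move=> k0 [asym ae] h; rewrite -subr_ge0 -frobNr -frobDr.
apply: frob_psd_ge0 => // v; last by rewrite !qfE subr_ge0.
rewrite qformE; have /andP[h1 _] := ae v; apply: le_trans h1.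
by rewrite mulr_ge0 ?sqr_ge0 // ltW.
Qed.

Lemma enorm_le_coord_bound p (eta : R) : 0 <= eta -> (forall i, `|p 0 i| <= eta) ->
  enorm p <= d%:R * eta.
Proof.
move=> e0 h; rewrite (le_trans (enorm_le_sum p)) //.
rewrite (le_trans (ler_sum _ (fun i _ => h i))) //.
by rewrite sumr_const card_ord mulr_natl.
Qed.

(** At a positive maximum of [U - psi], perturbed to lie off the null set, the gradients differ by
    the small vector [p] and the Hessians are ordered. The strictness [sigma] absorbs [p] and the
    error in the choice of the operator. *)
Lemma max_principle G (kappa K1 sigma L : R) U psi
    (gpsi : 'rV[R]_d -> 'rV[R]_d) (hpsi : 'rV[R]_d -> 'M[R]_d) :
  open G -> bounded_set G -> 0 < kappa -> 0 <= K1 -> 0 < sigma ->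
  C11loc G U -> {within closure G, continuous U} ->
  {within closure G, continuous psi} ->
  (forall x y, G x -> G y -> `|gpsi x - gpsi y| <= L * `|x - y|) ->
  (forall x v, G x ->
     line_jet (fun t => psi (x + t *: v)) (dotp (gpsi x) v) (qform (hpsi x) v v)) ->
  (forall x, frontier G x -> U x <= psi x) ->
  ae_in G (pucci_sub kappa K1 U) ->
  (forall x a b c f, G x -> coef_bounds kappa K1 a b c f -> psi x <= U x ->
     frob a (hpsi x) + dotp b (gpsi x) - c * psi x + f <= - sigma) ->
  forall x, G x -> U x <= psi x.
Proof.
move=> oG bG k0 K10 s0 [dU lipU] cU cpsi lpsi jpsi bdry [E Enull hE] super z Gz.
rewrite leNgt; apply/negP => lt_z.
have cG := closure_bounded_compact bG.
pose W x := U x - psi x.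
have Wz : 0 < W z by rewrite subr_gt0.
have [B [B0 hB]] : exists B, 0 < B /\ forall x, closure G x -> enorm x <= B.
  have [M [_ hM]] := compact_bounded cG.
  exists (d%:R * (`|M| + 1) + 1); split.
    by rewrite ltr_wpDl // mulr_ge0 // addr_ge0.
  move=> x cx; rewrite (le_trans (enorm_le_norm x)) //.
  have hM1 : M < `|M| + 1 by rewrite (le_lt_trans (ler_norm M)) // ltrDl.
  have := hM _ hM1 x cx => /= h; rewrite (@le_trans _ _ (d%:R * (`|M| + 1))) //.
    by rewrite ler_wpM2l.
  by rewrite lerDl.
have d1 : (0 : R) < d%:R + 1 by rewrite ltr_wpDl.
(* The first bound changes [W] by at most [W z / 4] on the closure, so perturbed maximizers satisfy
   [W >= W z / 2] and stay off the frontier; the second makes the drift term at most [sigma / 2]. *)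
pose eta := Num.min (W z / (4 * B)) (sigma / (2 * (K1 + 1))) / (d%:R + 1).
have eta0 : 0 < eta.
  by rewrite divr_gt0 // lt_min !divr_gt0 // mulr_gt0 // ltr_wpDl.
have etaE : d%:R * eta <= Num.min (W z / (4 * B)) (sigma / (2 * (K1 + 1))).
  rewrite /eta mulrCA ger_pMr.
    by rewrite ler_pdivrMr // mul1r lerDl.
  by rewrite lt_min !divr_gt0 // mulr_gt0 // ltr_wpDl.
have pB p x : (forall i, `|p 0 i| <= eta) -> closure G x -> `|dotp p x| <= W z / 4.
  move=> hp cx; rewrite (le_trans (dotp_CS _ _)) //.
  have e1 := enorm_le_coord_bound (ltW eta0) hp.
  apply: (@le_trans _ _ (W z / (4 * B) * B)).
    rewrite ler_pM ?enorm_ge0 ?hB // (le_trans e1) // (le_trans etaE) //.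
    by rewrite ge_min lexx.
  by rewrite le_eqVlt; apply/orP; left; apply/eqP; field; rewrite gt_eqF.
have pK p : (forall i, `|p 0 i| <= eta) -> K1 * enorm p <= sigma / 2.
  move=> hp; have e1 := enorm_le_coord_bound (ltW eta0) hp.
  apply: (@le_trans _ _ ((K1 + 1) * (sigma / (2 * (K1 + 1))))).
    rewrite ler_pM ?enorm_ge0 //; first by rewrite lerDl.
    by rewrite (le_trans e1) // (le_trans etaE) // ge_min lexx orbT.
  have K11 : K1 + 1 != 0 by rewrite gt_eqF // ltr_wpDl.
  by rewrite le_eqVlt; apply/orP; left; apply/eqP; field.
have cW : {within closure G, continuous W}.
  by move=> x; apply: cvgB; [exact: cU|exact: cpsi].
pose Ko := [set x | closure G x /\ forall _ : unit, True -> 0 <= W x - W z / 2].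
have Koc : compact Ko.
  apply: (@compact_family_ge0 _ _ unit (fun=> True) (closure G) (fun _ x => W x - W z / 2)) => //.
  by move=> _ _ x; apply: cvgB; [exact: cW|exact: cvg_cst].
have KoG : Ko `<=` G.
  move=> x [cx hx]; apply: frontier_open => // /bdry; rewrite -subr_le0 => h.
  by have := le_trans (hx tt I) (lerB h (lexx _)); rewrite sub0r oppr_ge0 leNgt divr_gt0.
have [LU _ hLU] := lipschitz_inP (lipU Ko Koc KoG).
pose F x := grad U x - gpsi x.
have FL x y : Ko x -> Ko y -> `|F x - F y| <= (LU + L) * `|x - y|.
  move=> Kx Ky; have -> : F x - F y = (grad U x - grad U y) - (gpsi x - gpsi y).
    by apply/rowP => i; rewrite !mxE; ring.
  rewrite (le_trans (ler_normB _ _)) // mulrDl lerD //; first exact: hLU.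
  by apply: lpsi; exact: KoG.
have z_cl : closure G z by exact: subset_closure.
have mx_line p x v : G x ->
    (forall y, closure G y -> W y - dotp p y <= W x - dotp p x) ->
    exists2 r, 0 < r & forall t : R, `|t| < r ->
      U (x + t *: v) - psi (x + t *: v) - dotp p (x + t *: v) <=
      U (x + 0 *: v) - psi (x + 0 *: v) - dotp p (x + 0 *: v).
  move=> Gx mx; have [r r0 hr] := open_line v oG Gx.
  exists r => // t tr; rewrite scale0r addr0; apply: mx.
  by apply: subset_closure; exact: hr.
have fermat p x : G x ->
    (forall y, closure G y -> W y - dotp p y <= W x - dotp p x) -> F x = p.
  move=> Gx mx; suff h v : dotp (F x - p) v = 0.
    by apply/eqP; rewrite -subr_eq0; apply/eqP; apply: dotpxx_eq0; exact: h.
  have [r r0 hr] := mx_line p x v Gx mx.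
  have dm : is_derive (0 : R) 1 (fun t => U (x + t *: v) - psi (x + t *: v)
      - dotp p (x + t *: v)) (dotp (F x - p) v).
    rewrite dotpBl /F dotpBl.
    apply: is_deriveB; last exact: line_jet_derive (line_jet_dotp p x v).
    apply: is_deriveB; last exact: line_jet_derive (jpsi x v Gx).
    have := @is_derive_grad R d U x v 0; rewrite scale0r addr0; apply; exact: dU.
  exact: derive_local_max dm r0 hr.
have [p [x [hp Kx nEx Fx mx]]] : exists p x : 'rV[R]_d,
    [/\ forall i, `|p 0 i| <= eta, Ko x, ~ E x, F x = p &
      forall y, closure G y -> W y - dotp p y <= W x - dotp p x].
  apply: (@perturbed_max_off_null R d (closure G) Ko E W F (LU + L) eta) => //.
  - by exists z.
  - by move=> x [].
  - move=> p x hp cx mx.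
    have Wx : W z / 2 <= W x.
      have := mx z z_cl; have := pB p z hp z_cl; have := pB p x hp cx.
      rewrite !ler_norml => /andP[? ?] /andP[? ?] ?; lra.
    have Kx : Ko x by split=> // _ _; rewrite subr_ge0.
    by split=> //; apply: fermat => //; exact: KoG.
have Gx := KoG x Kx.
have [dgU hU] := hE x Gx nEx.
have hess_le v : qform (hess U x) v v <= qform (hpsi x) v v.
  have [r r0 hr] := mx_line p x v Gx mx.
  have j1 := line_jet_hess v (near_differentiable oG Gx dU) dgU.
  have := line_jetB (line_jetB j1 (jpsi x v Gx)) (line_jet_dotp p x v).
  move=> j; have [_] := line_jet_max j r0 hr; lra.
have s4 : 0 < sigma / 4 by rewrite divr_gt0.
have [a [b [c [f [cb h1]]]]] := hU _ s4.
have UW : psi x <= U x.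
  have [_ /(_ tt I)] := Kx; rewrite subr_ge0 => h.
  by rewrite -subr_ge0 (le_trans _ h) // divr_ge0 // ltW.
have h2 := super x a b c f Gx cb UW.
have [ea bK /andP[c0 _] _] := cb.
have h3 := frob_le_psd k0 ea hess_le.
have h4 : dotp b (grad U x) = dotp b (gpsi x) + dotp b p.
  by rewrite -dotpDr -Fx /F addrCA subrr addr0.
have h5 : dotp b p <= sigma / 2.
  rewrite (le_trans (dotp_le _ _)) // (le_trans _ (pK p hp)) //.
  by rewrite ler_wpM2r ?enorm_ge0.
have h6 : c * psi x <= c * U x by rewrite ler_wpM2l.
rewrite h4 in h1; lra.
Qed.

End comparison.

(** * Boundary estimate *)

Ltac nonneg := repeat (first
  [done | apply: addr_ge0 | apply: mulr_ge0 | apply: exprn_ge0]).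

Section boundary.
Context {R : realType} {d : nat}.
Implicit Types (u U g : 'rV[R]_d -> R) (x y z v p q : 'rV[R]_d)
  (G : set 'rV[R]_d).

(** A summand is bounded by the sum only if the other two are nonnegative. A pair of distinct points
    ensures this, since the supremum of the empty set is [-oo]. *)
Lemma C1norm_bounds (chi Q : R) G u : 0 < chi -> offdiag G !=set0 ->
  (C1norm chi G u <= Q%:E)%E ->
  [/\ 0 <= Q, forall x, G x -> `|u x| <= Q,
      forall x y, G x -> G y -> `|u x - u y| <= Q * enorm (x - y) &
      forall x y, G x -> G y ->
        enorm (grad u x - grad u y) <= Q * enorm (x - y) `^ chi].
Proof.
move=> chi0 [[x0 y0] xy0]; rewrite /C1norm.
set s1 := ereal_sup _; set s2 := ereal_sup _; set s3 := ereal_sup _ => hQ.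
have a1 x : G x -> (`|u x|%:E <= s1)%E.
  by move=> Gx; apply: ereal_sup_ubound; exists x.
have a2 (p : _ * _) : offdiag G p -> ((`|u p.1 - u p.2| / enorm (p.1 - p.2))%:E <= s2)%E.
  by move=> hp; apply: ereal_sup_ubound; exists p.
have a3 (p : _ * _) : offdiag G p ->
  ((enorm (grad u p.1 - grad u p.2) / enorm (p.1 - p.2) `^ chi)%:E <= s3)%E.
  by move=> hp; apply: ereal_sup_ubound; exists p.
have [Gx0 _ _] := xy0.
have p1 : (0 <= s1)%E by apply: le_trans (a1 x0 Gx0); rewrite lee_fin.
have p2 : (0 <= s2)%E.
  by apply: le_trans (a2 _ xy0); rewrite lee_fin divr_ge0 // enorm_ge0.
have p3 : (0 <= s3)%E.
  by apply: le_trans (a3 _ xy0); rewrite lee_fin divr_ge0 ?enorm_ge0 ?powR_ge0.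
have q1 : (s1 <= Q%:E)%E.
  by apply: le_trans hQ; rewrite -addeA; apply: leeDl; exact: adde_ge0.
have q2 : (s2 <= Q%:E)%E.
  apply: le_trans hQ; apply: (@le_trans _ _ (s1 + s2)%E); first exact: leeDr.
  exact: leeDl.
have q3 : (s3 <= Q%:E)%E.
  by apply: le_trans hQ; apply: leeDr; exact: adde_ge0.
have Q0 : 0 <= Q by rewrite -lee_fin (le_trans p1 q1).
split=> //.
- by move=> x Gx; rewrite -lee_fin (le_trans (a1 x Gx) q1).
- move=> x y Gx Gy; have [->|/eqP xy] := eqVneq x y.
    by rewrite !subrr normr0 enorm0 mulr0.
  have := le_trans (a2 (x, y) _) q2; rewrite lee_fin /= ler_pdivrMr; first exact.
  by apply: enorm_gt0 => /eqP; rewrite subr_eq0 => /eqP.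
- move=> x y Gx Gy; have [->|/eqP xy] := eqVneq x y.
    by rewrite !subrr enorm0 mulr_ge0 // powR_ge0.
  have := le_trans (a3 (x, y) _) q3; rewrite lee_fin /= ler_pdivrMr; first exact.
  by apply: powR_gt0; apply: enorm_gt0 => /eqP; rewrite subr_eq0 => /eqP.
Qed.

Lemma partial_le (Q : R) u x i : 0 <= Q -> derivable u x (delta_mx 0 i) ->
  (\forall y \near x, `|u y - u x| <= Q * enorm (y - x)) ->
  `|partial i u x| <= Q.
Proof.
move=> Q0 du /nbhs_ballP [r /= r0 hr].
rewrite leNgt; apply/negP => hQ.
have e0 : 0 < `|partial i u x| - Q by rewrite subr_gt0.
have /cvgrPdist_lt /(_ _ e0) := (du : (_ @ _ --> _)).
rewrite /= near_withinE => /nbhs_ballP [e /= e1 he].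
pose t := Num.min e r / 2.
have mr0 : 0 < Num.min e r by rewrite lt_min e1.
have t0 : 0 < t by rewrite divr_gt0.
have [te tr] : t < e /\ t < r.
  have : Num.min e r <= e by rewrite ge_min lexx.
  have : Num.min e r <= r by rewrite ge_min lexx orbT.
  by rewrite /t; move: (Num.min e r) mr0 => M *; split; lra.
have h1 : `|partial i u x - t^-1 *: (u (t *: delta_mx 0 i + x) - u x)|
    < `|partial i u x| - Q.
  apply: he; last by rewrite gt_eqF.
  by rewrite -ball_normE /= sub0r normrN gtr0_norm.
have h2 : `|u (t *: delta_mx 0 i + x) - u x| <= Q * t.
  have := hr (t *: delta_mx 0 i + x).
  rewrite -ball_normE /= opprD addrCA subrr addr0 normrN.
  rewrite addrK enormZ (gtr0_norm t0) enorm_delta mulr1; apply.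
  apply: le_lt_trans (norm_le_enorm _) _.
  by rewrite enormZ (gtr0_norm t0) enorm_delta mulr1.
have h3 : `|t^-1 *: (u (t *: delta_mx 0 i + x) - u x)| <= Q.
  rewrite normrZ gtr0_norm ?invr_gt0 // mulrC ler_pdivrMr //.
have := ler_normD (partial i u x - t^-1 *: (u (t *: delta_mx 0 i + x) - u x))
  (t^-1 *: (u (t *: delta_mx 0 i + x) - u x)).
rewrite subrK; move: h1 h3; move: `|_ - _| `|_ *: _| `|partial _ _ _| => A B C; lra.
Qed.

Lemma enorm_grad_le (Q : R) u x : 0 <= Q -> differentiable u x ->
  (\forall y \near x, `|u y - u x| <= Q * enorm (y - x)) ->
  enorm (grad u x) <= d%:R * Q.
Proof.
move=> Q0 du h; apply: enorm_le_coord_bound => // i; rewrite mxE.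
by apply: partial_le => //; exact: diff_derivable.
Qed.

Definition C11_bound (K0 : R) g : Prop :=
  (forall x, differentiable g x) /\ forall x y,
    [/\ `|g x| <= K0, `|g x - g y| <= K0 * enorm (x - y) &
        enorm (grad g x - grad g y) <= K0 * enorm (x - y)].

Lemma gradN u x : differentiable u x -> grad (fun y => - u y) x = - grad u x.
Proof.
move=> du; apply/rowP => i; rewrite !mxE /partial -deriveN //.
exact: diff_derivable.
Qed.

Lemma C11_boundN (K0 : R) g : C11_bound K0 g -> C11_bound K0 (fun x => - g x).
Proof.
move=> [dg hg]; split=> [x|x y]; first exact: differentiableN.
have [h1 h2 h3] := hg x y; rewrite !gradN // normrN; split=> //.
  by have -> : - g x - - g y = - (g x - g y) by [rewrite opprD]; rewrite normrN.
by have -> : - grad g x - - grad g y = - (grad g x - grad g y) by [rewrite opprD];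
  rewrite enormN.
Qed.

Lemma closure_enorm_ge G y (r : R) : (forall z, G z -> r <= enorm (z - y)) ->
  forall z, closure G z -> r <= enorm (z - y).
Proof.
move=> h z clz; rewrite leNgt; apply/negP => hz.
have d1 : (0 : R) < d%:R + 1 by rewrite ltr_wpDl.
have e0 : 0 < (r - enorm (z - y)) / (d%:R + 1) by rewrite divr_gt0 ?subr_gt0.
have [w [Gw]] := clz _ (nbhsx_ballx z _ e0).
rewrite -ball_normE /= distrC (ltr_pdivlMr _ _ d1) => zw.
have h1 := h w Gw; have h2 := enorm_triangle z w y.
have h3 := enorm_le_norm (w - z).
have h4 := normr_ge0 (w - z).
lra.
Qed.

Lemma bounded_enorm G : bounded_set G ->
  exists B, 0 < B /\ forall x, closure G x -> enorm x <= B.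
Proof.
move=> bG; have [M [_ hM]] := compact_bounded (closure_bounded_compact bG).
exists (d%:R * (`|M| + 1) + 1); split.
  by rewrite ltr_wpDl // mulr_ge0 // addr_ge0.
move=> x cx; rewrite (le_trans (enorm_le_norm x)) //.
have hM1 : M < `|M| + 1 by rewrite (le_lt_trans (ler_norm M)) // ltrDl.
have := hM _ hM1 x cx => /= h; rewrite (@le_trans _ _ (d%:R * (`|M| + 1))) //.
  by rewrite ler_wpM2l.
by rewrite lerDl.
Qed.

(** Only the centre depends on the boundary point. The uniform constants make the boundary estimate
    uniform and let a single barrier serve the whole domain in the comparison. *)
Lemma exterior_barrier G (kappa K1 : R) : C2_bounded_domain G ->
  0 < kappa -> 0 <= K1 ->
  exists mu r Dm c0 : R, [/\ 0 < mu, 0 < r, 0 < c0, 0 < Dm &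
    forall x0, frontier G x0 -> exists y0, [/\ enorm (x0 - y0) = r,
      forall x, closure G x -> annulus r Dm y0 x &
      forall x a b c f, annulus r Dm y0 x -> coef_bounds kappa K1 a b c f ->
        frob a (barrier_hess mu r y0 x) + dotp b (barrier_grad mu r y0 x)
          - c * barrier mu r y0 x <= - c0]].
Proof.
move=> GC k0 K10; have [r r0 hr] := uniform_exterior_ball GC.
have [G0 oG _ bG _] := GC.
have [B [B0 hB]] := bounded_enorm bG.
pose Dm := 2 * B + r.
have Dm0 : 0 < Dm by rewrite addr_gt0 // mulr_gt0.
pose mu := (d%:R / kappa + K1 * Dm + 1) / (2 * kappa * r ^+ 2).
have den0 : 0 < 2 * kappa * r ^+ 2 by rewrite !mulr_gt0 // exprn_gt0.
have mu0 : 0 < mu.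
  rewrite divr_gt0 // ltr_wpDl // addr_ge0 //; first by rewrite divr_ge0 // ltW.
  by rewrite mulr_ge0 // ltW.
have muE : 2 * mu * kappa * r ^+ 2 = d%:R / kappa + K1 * Dm + 1.
  have -> : 2 * mu * kappa * r ^+ 2 = mu * (2 * kappa * r ^+ 2) by ring.
  by rewrite /mu divfK // gt_eqF.
exists mu, r, Dm, (2 * mu * expR (- (mu * Dm ^+ 2))); split=> //.
  by rewrite mulr_gt0 ?expR_gt0 // mulr_gt0.
move=> x0 fx0; have [y0 e0 hy] := hr x0 fx0; exists y0; split=> //.
  move=> x cx; apply/andP; split; first exact: closure_enorm_ge hy x cx.
  rewrite (le_trans (enorm_triangle x0 x y0)) // e0 lerD2r.
  rewrite (le_trans (enormB _ _)) //; have := hB x cx.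
  by have := hB x0; case: (fx0) => cx0 _ /(_ cx0); lra.
move=> x a b c f ax [ea bK /andP[c0 _] _].
apply: (barrier_strict mu0 r0 k0 muE K10 ax ea bK c0).
Qed.

(** The comparison function is the first-order Taylor polynomial of [g] at [x0], plus
    [K0 |y - x0|^2] to stay above [g] on the frontier, plus a multiple of the barrier to be a strict
    supersolution. It grows at most linearly away from [x0]. *)
Lemma boundary_upper G (kappa K0 K1 : R) : C2_bounded_domain G ->
  0 < kappa -> 0 <= K0 -> 0 <= K1 ->
  exists N, 0 < N /\ forall g U, C11_bound K0 g -> C11loc G U ->
    {within closure G, continuous U} -> (forall x, frontier G x -> U x = g x) ->
    ae_in G (pucci_sub kappa K1 U) ->
    forall x x0, G x -> frontier G x0 -> U x <= g x0 + N * enorm (x - x0).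
Proof.
move=> GC k0 K00 K10.
have [mu [r [Dm [c0 [mu0 r0 c00 Dm0 hbar]]]]] := exterior_barrier GC k0 K10.
have [G0 oG _ bG _] := GC.
have [B [B0 hB]] := bounded_enorm bG.
have B_ge := ltW B0; have mu_ge := ltW mu0; have Dm_ge := ltW Dm0.
(* [M1] bounds the polynomial part on the closure of [G], and [M2] what any operator of the class
   makes of it together with [f]. Then [N c0 = M2 + 1] leaves the margin 1 as [sigma]. *)
pose M1 := K0 + d%:R * K0 * (2 * B) + K0 * (2 * B) ^+ 2.
pose M2 := 2 * K0 * (d%:R * 1 / kappa) + K1 * (d%:R * K0 + 2 * K0 * (2 * B)) + K1 * M1 + K1.
have M10 : 0 <= M1.
  by rewrite /M1; nonneg.
have M20 : 0 <= M2.
  have kk : 0 <= d%:R * 1 / kappa :> R by rewrite mulr1 divr_ge0 // ltW.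
  by rewrite /M2; nonneg.
pose N := (M2 + 1) / c0.
have N0 : 0 < N by rewrite divr_gt0 // ltr_wpDl.
have N_ge := ltW N0.
have Nc0 : N * c0 = M2 + 1 by rewrite /N divfK // gt_eqF.
clearbody N.
pose N' := d%:R * K0 + K0 * (2 * B) + N * (mu * (2 * Dm)) .
have N'0 : 0 <= N'.
  by rewrite /N'; nonneg.
exists (N' + 1); split; first by rewrite ltr_wpDl.
move=> g U [dg hg] CU cU bU aeU x x0 Gx fx0.
have [y0 [e0 ann strict]] := hbar x0 fx0.
have cx0 : closure G x0 by case: fx0.
pose q := grad g x0.
have qK : enorm q <= d%:R * K0.
  by apply: enorm_grad_le => //; apply: filterE => y; have [] := hg y x0.
pose psi y := g x0 + dotp q (y - x0) + K0 * dotp (y - x0) (y - x0)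
  + N * barrier mu r y0 y.
pose gpsi y := q + (2 * K0) *: (y - x0) + N *: barrier_grad mu r y0 y.
pose hpsi y := (2 * K0) *: 1%:M + N *: barrier_hess mu r y0 y.
have yB y : closure G y -> enorm (y - x0) <= 2 * B.
  by move=> cy; rewrite (le_trans (enormB _ _)) //; have := hB y cy; have := hB x0 cx0; lra.
have quadK y : closure G y ->
    `|g x0 + dotp q (y - x0) + K0 * dotp (y - x0) (y - x0)| <= M1.
  move=> cy; rewrite /M1 (le_trans (ler_normD _ _)) // lerD //.
    rewrite (le_trans (ler_normD _ _)) // lerD //; first by have [] := hg x0 x0.
    by rewrite (le_trans (dotp_CS _ _)) // ler_pM ?enorm_ge0 ?yB.
  rewrite -enormE ger0_norm ?mulr_ge0 ?enorm_ge0 // ler_wpM2l //.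
  by rewrite ler_pXn2r ?nnegrE ?enorm_ge0 ?yB // mulr_ge0.
have Ux : U x <= psi x.
  apply: (@max_principle R d G kappa K1 1 (2 * K0 +
    N * ((2 * mu * (1 + mu * (2 * Dm) * Dm)) * d%:R)) U psi gpsi hpsi) => //.
  - have lipK : forall y z, closure G y -> closure G z ->
        `|psi y - psi z| <= ((d%:R * K0 + K0 * (4 * B)
           + N * (mu * (2 * Dm))) * d%:R) * `|y - z|.
      move=> y z cy cz; rewrite -mulrA (@le_trans _ _ ((d%:R * K0 + K0 * (4 * B)
           + N * (mu * (2 * Dm))) * enorm (y - z))) //; last first.
        by rewrite ler_wpM2l ?enorm_le_norm //; nonneg.
      have -> : psi y - psi z = dotp q (y - z) +
          K0 * dotp (y - z) ((y - x0) + (z - x0)) +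
          N * (barrier mu r y0 y - barrier mu r y0 z).
        have -> : y - z = (y - x0) - (z - x0) by rewrite opprB addrA subrK.
        rewrite /psi; move: (y - x0) (z - x0) => w w'.
        by rewrite !dotpE (dotpC w' w); ring.
      rewrite [leRHS]mulrDl (le_trans (ler_normD _ _)) // lerD //; last first.
        rewrite normrM (gtr0_norm N0) -[leRHS]mulrA ler_wpM2l ?(ltW N0) //.
        exact: (barrier_lipschitz mu0 r0 (ann y cy) (ann z cz)).
      rewrite [leRHS]mulrDl (le_trans (ler_normD _ _)) // lerD //.
        by rewrite (le_trans (dotp_CS _ _)) // ler_wpM2r ?enorm_ge0.
      rewrite normrM (ger0_norm K00) -[leRHS]mulrA ler_wpM2l //.
      rewrite (le_trans (dotp_CS _ _)) // mulrC ler_wpM2r ?enorm_ge0 //.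
      by rewrite (le_trans (enormD _ _)) //; have := yB y cy; have := yB z cz; lra.
    exact: lipschitz_within_continuous lipK.
  - move=> y z Gy Gz.
    have ay := ann y (subset_closure Gy); have az := ann z (subset_closure Gz).
    have -> : gpsi y - gpsi z = (2 * K0) *: (y - z) +
        N *: (barrier_grad mu r y0 y - barrier_grad mu r y0 z).
      by apply/rowP => i; rewrite !mxE; ring.
    rewrite (le_trans (ler_normD _ _)) // (normrZ (2 * K0)) (normrZ N) [leRHS]mulrDl lerD //.
      by rewrite ger0_norm ?mulr_ge0.
    rewrite (gtr0_norm N0) -[leRHS]mulrA ler_wpM2l ?(ltW N0) //.
    rewrite (le_trans (norm_le_enorm _)) //.
    rewrite (le_trans (barrier_grad_lipschitz mu0 r0 ay az)) // -[leRHS]mulrA.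
    have L0 : 0 <= 2 * mu * (1 + mu * (2 * Dm) * Dm).
      by nonneg.
    by rewrite ler_wpM2l // enorm_le_norm.
  - move=> y v Gy.
    have j1 := line_jet_quad (g x0) 0 0.
    have j2 := line_jet_dotp q (y - x0) v.
    have j3 := line_jetZ K0 (line_jet_sqr (y - x0) v).
    have j4 := line_jetZ N (line_jet_barrier mu r y0 y v).
    apply: line_jet_eq (line_jetD (line_jetD (line_jetD j1 j2) j3) j4) _ _ _.
    + apply/funext => t; rewrite /psi !mul0r !addr0.
      by have -> : y + t *: v - x0 = y - x0 + t *: v by rewrite addrAC.
    + rewrite /gpsi; move: (y - x0) => w; rewrite !dotpDl !dotpZl; ring.
    + rewrite /hpsi !qfE; ring.
  - move=> y fy; have cy : closure G y by case: fy.
    rewrite bU //; have := barrier_ge0 mu0 r0 (ann y cy).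
    have h1 : `|g y - g x0 - dotp q (y - x0)| <= K0 * enorm (y - x0) * enorm (y - x0).
      apply: taylor_segment => t /andP[t0 t1]; split; first exact: dg.
      have [_ _ h] := hg (x0 + t *: (y - x0)) x0; apply: le_trans h _.
      rewrite addrAC subrr add0r ler_wpM2l // enormZ ger0_norm //.
      by rewrite ler_piMl // enorm_ge0.
    have : 0 <= N * barrier mu r y0 y.
      by rewrite mulr_ge0 ?(ltW N0) // (barrier_ge0 mu0 r0 (ann y cy)).
    move: h1; rewrite -mulrA -expr2 enormE /psi ler_norml => /andP[_ h1] h2 _; lra.
  - move=> y a b c f Gy cb _.
    have cy := subset_closure Gy.
    have st := strict y a b c f (ann y cy) cb.
    have [ea bK /andP[c1 c2] fK] := cb.
    have tr_a : \tr a <= d%:R * 1 / kappa.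
      have := @frob_le_elliptic R d kappa 1 a 1%:M k0 ea ler01.
      by rewrite frob1; apply => v; rewrite qform1 mul1r.
    have E1 : frob a (hpsi y) = 2 * K0 * \tr a + N * frob a (barrier_hess mu r y0 y).
      by rewrite /hpsi frobDr (frobZr (2 * K0)) frob1 (frobZr N).
    have E2 : dotp b (gpsi y) = dotp b q + 2 * K0 * dotp b (y - x0) +
        N * dotp b (barrier_grad mu r y0 y).
      by rewrite /gpsi dotpDr dotpDr (dotpZr (2 * K0)) (dotpZr N).
    rewrite E1 E2 /psi.
    have t1 : 2 * K0 * \tr a <= 2 * K0 * (d%:R * 1 / kappa).
      by rewrite ler_wpM2l // mulr_ge0.
    have t2 : dotp b q + 2 * K0 * dotp b (y - x0) <=
        K1 * (d%:R * K0 + 2 * K0 * (2 * B)).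
      rewrite mulrDr lerD //.
        by rewrite (le_trans (dotp_le _ _)) // ler_pM ?enorm_ge0.
      rewrite mulrCA ler_wpM2l ?mulr_ge0 //.
      by rewrite (le_trans (dotp_le _ _)) // ler_pM ?enorm_ge0 ?yB.
    have t3 : - (c * (g x0 + dotp q (y - x0) + K0 * dotp (y - x0) (y - x0))) <= K1 * M1.
      rewrite -mulrN (le_trans (ler_norm _)) // normrM normrN ler_pM ?quadK //.
      by rewrite ger0_norm.
    have t4 : f <= K1 by exact: le_trans (ler_norm _) fK.
    have t5 : N * (frob a (barrier_hess mu r y0 y) + dotp b (barrier_grad mu r y0 y)
        - c * barrier mu r y0 y) <= - (M2 + 1).
      by have := ler_wpM2l N_ge st; rewrite mulrN Nc0.
    move: t1 t2 t3 t4 t5; rewrite /M2.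
    move: (g x0 + _ + _) (barrier mu r y0 y) => P3 P4.
    move: (frob a (barrier_hess mu r y0 y)) (dotp b (barrier_grad mu r y0 y)) => F3 F4.
    move: (\tr a) (dotp b q) (dotp b (y - x0)) => T b1 b2.
    move=> *; lra.
have cx := subset_closure Gx.
apply: (le_trans Ux); rewrite /psi.
have h1 : dotp q (x - x0) <= d%:R * K0 * enorm (x - x0).
  by rewrite (le_trans (dotp_le _ _)) // ler_wpM2r ?enorm_ge0.
have h2 : K0 * dotp (x - x0) (x - x0) <= K0 * (2 * B) * enorm (x - x0).
  by rewrite -enormE expr2 -mulrA ler_wpM2l // ler_wpM2r ?enorm_ge0 ?yB.
have h3 : N * barrier mu r y0 x <= N * (mu * (2 * Dm)) * enorm (x - x0).
  rewrite -[leRHS]mulrA ler_wpM2l ?(ltW N0) //.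
  exact: (barrier_le_linear mu0 e0 (ann x cx) (ann x0 cx0)).
have := enorm_ge0 (x - x0); move: h1 h2 h3; rewrite /N'.
move: (enorm (x - x0)) (barrier mu r y0 x) => e bb.
by move: (dotp q (x - x0)) (dotp (x - x0) (x - x0)) => Q1 Q2 *; lra.
Qed.

End boundary.

(** * Doubling of variables *)

Section doubling.
Context {R : realType} {d : nat}.
Implicit Types (x y v xi zeta q : 'rV[R]_d).

Lemma dotp_row_mx (q1 q2 x y : 'rV[R]_d) :
  dotp (row_mx q1 q2) (row_mx x y) = dotp q1 x + dotp q2 y.
Proof.
rewrite /dotp big_split_ord /=; congr (_ + _); apply: eq_bigr => i _.
  by rewrite !row_mxEl.
by rewrite !row_mxEr.
Qed.

Lemma norm_row_mx_le x y : `|row_mx x y| <= `|x| + `|y|.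
Proof.
apply: norm_le_coord => [|i j]; first by rewrite addr_ge0.
rewrite ord1; case: (split_ordP j) => k ->.
  by rewrite row_mxEl (le_trans (coord_le_norm x 0 k)) // lerDl.
by rewrite row_mxEr (le_trans (coord_le_norm y 0 k)) // lerDr.
Qed.

Lemma norm_lsubmx_le (w : 'rV[R]_(d + d)) : `|lsubmx w| <= `|w|.
Proof. by apply: norm_le_coord => // i j; rewrite mxE; exact: coord_le_norm. Qed.

Lemma norm_rsubmx_le (w : 'rV[R]_(d + d)) : `|rsubmx w| <= `|w|.
Proof. by apply: norm_le_coord => // i j; rewrite mxE; exact: coord_le_norm. Qed.

Lemma lsubmx_within_continuous (K : set 'rV[R]_(d + d)) :
  {within K, continuous (lsubmx : 'rV[R]_(d + d) -> 'rV[R]_d)}.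
Proof.
apply: (@lipschitz_within_continuous _ _ _ _ _ 1) => x y _ _.
by rewrite mul1r -linearB /= norm_lsubmx_le.
Qed.

Lemma rsubmx_within_continuous (K : set 'rV[R]_(d + d)) :
  {within K, continuous (rsubmx : 'rV[R]_(d + d) -> 'rV[R]_d)}.
Proof.
apply: (@lipschitz_within_continuous _ _ _ _ _ 1) => x y _ _.
by rewrite mul1r -linearB /= norm_rsubmx_le.
Qed.

Lemma cst_within_continuous (m : nat) (K : set 'rV[R]_m) (V : normedModType R) (c : V) :
  {within K, continuous (fun=> c : V)}.
Proof. by move=> x; exact: cvg_cst. Qed.

Lemma compact_box (m : nat) (B : R) : compact [set w : 'rV[R]_m | forall i, `|w 0 i| <= B].
Proof.
have -> : [set w : 'rV[R]_m | forall i, `|w 0 i| <= B] =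
    [set w : 'rV[R]_m | forall i, [set` `[- B, B]%R] (w ord0 i)].
  by rewrite predeqE => w; split=> h i; have := h i; rewrite /= in_itv /= ler_norml.
apply: (@rV_compact R m (fun=> [set` `[- B, B]%R])) => i; exact: segment_compact.
Qed.

Lemma compact_enorm_ball (z : 'rV[R]_d) (r : R) : 0 <= r ->
  compact [set x | enorm (x - z) <= r].
Proof.
move=> r0; pose B := enorm z + r.
have E : [set x | enorm (x - z) <= r] = [set x : 'rV[R]_d | (forall i, `|x 0 i| <= B) /\
    forall _ : unit, True -> 0 <= r ^+ 2 - dotp (x - z) (x - z)].
  rewrite predeqE => x; split=> /= [hx|[_ /(_ tt I)]].
    split=> [i|_ _]; last by rewrite subr_ge0 -enormE ler_pXn2r ?nnegrE ?enorm_ge0.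
    rewrite (le_trans (coord_le_enorm _ _)) // /B.
    by have := enormD z (x - z); rewrite addrCA subrr addr0; lra.
  by rewrite subr_ge0 -enormE ler_pXn2r ?nnegrE ?enorm_ge0.
rewrite E; apply: (@compact_family_ge0 R d unit (fun=> True)
  [set w : 'rV[R]_d | forall i, `|w 0 i| <= B]
  (fun _ w => r ^+ 2 - dotp (w - z) (w - z)) (@compact_box d B)) => _ _.
have c1 : {within [set w : 'rV[R]_d | forall i, `|w 0 i| <= B],
    continuous (fun w : 'rV[R]_d => w - z)}.
  by apply: (@lipschitz_within_continuous _ _ _ _ _ 1) => x y _ _;
    rewrite mul1r opprB addrA subrK.
move=> x; apply: cvgB; first exact: cvg_cst.
exact: (dotp_within_continuous c1 c1).
Qed.

Context (G : set 'rV[R]_d) (U V h : 'rV[R]_d -> R) (gh : 'rV[R]_d -> 'rV[R]_d)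
  (Hh : 'rV[R]_d -> 'M[R]_d) (z p : 'rV[R]_d) (lam nu kap r S Lh : R).
Hypotheses (oG : open G) (CU : C11loc G U) (CV : C11loc G V)
  (jh : forall x v,
     line_jet (fun t => h (x + t *: v)) (dotp (gh x) v) (qform (Hh x) v v))
  (r0 : 0 < r) (ballG : forall x, enorm (x - z) <= 2 * r -> G x)
  (hL : forall x y, enorm (x - z) <= 2 * r -> enorm (y - z) <= 2 * r ->
     `|h x - h y| <= Lh * enorm (x - y) /\
     enorm (gh x - gh y) <= Lh * enorm (x - y))
  (S0 : 0 < S) (nu0 : 0 < nu) (lam0 : 0 <= lam) (Lh0 : 0 <= Lh)
  (gradV : forall y, enorm (y - z) <= 2 * r -> enorm (grad V y - p) <= S)
  (maxz : forall x, enorm (x - z) <= r -> U x - V x - lam * h x <= U z - V z - lam * h z)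
  (Snu : 2 * S / nu <= r) (kapE : kap = 4 * S ^+ 2 / (nu * r ^+ 2)).

(** Subtracting the linear term leaves of [V x - V y] at most [S |x - y|], instead of a full
    Lipschitz increment. *)
Definition doubled x y : R := U x - lam * h x - V y - dotp p (x - y)
  - nu * dotp (x - y) (x - y) - kap * dotp (x - z) (x - z).

(** The ball for [y] has twice the radius: once [x] is interior and [|x - y| <= r], the point [y] is
    interior too and needs no penalty of its own. *)
Definition is_doubled_max (q1 q2 : 'rV[R]_d) x y : Prop :=
  forall x' y', enorm (x' - z) <= r -> enorm (y' - z) <= 2 * r ->
    doubled x' y' - dotp q1 x' - dotp q2 y' <= doubled x y - dotp q1 x - dotp q2 y.

Lemma doubled_location (eta : R) (q1 q2 : 'rV[R]_d) x y :
  0 <= eta -> 3 * eta * r <= S ^+ 2 / nu -> enorm q1 <= eta -> enorm q2 <= eta ->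
  enorm (x - z) <= r -> enorm (y - z) <= 2 * r -> is_doubled_max q1 q2 x y ->
  [/\ enorm (x - z) < r, enorm (y - z) < 2 * r & enorm (x - y) <= 2 * S / nu].
Proof.
move=> eta0 eta_r q1e q2e xz yz mx.
have z0 : enorm (z - z) <= r by rewrite subrr enorm0 ltW.
have z00 : enorm (z - z) <= 2 * r by rewrite subrr enorm0 mulr_ge0 // ltW.
have xz2 : enorm (x - z) <= 2 * r.
  by rewrite (le_trans xz) // mulr_natl mulr2n lerDl ltW.
have := mx z z z0 z00; rewrite /doubled subrr !dotp0r !mulr0 !subr0.
have V1 : `|V x - V y - dotp p (x - y)| <= S * enorm (x - y).
  apply: taylor_segment => t /andP[t0 t1].
  have in_ball : enorm (y + t *: (x - y) - z) <= 2 * r.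
    have -> : y + t *: (x - y) - z = (1 - t) *: (y - z) + t *: (x - z).
      by apply/rowP => i; rewrite !mxE; ring.
    rewrite (le_trans (enormD _ _)) // !enormZ !ger0_norm ?subr_ge0 //.
    have : (1 - t) * enorm (y - z) <= (1 - t) * (2 * r) by rewrite ler_wpM2l ?subr_ge0.
    have : t * enorm (x - z) <= t * (2 * r) by rewrite ler_wpM2l.
    lra.
  by split; [apply CV.1; exact: ballG|exact: gradV].
have Q1 : `|dotp q1 (x - z)| <= eta * r.
  by rewrite (le_trans (dotp_CS _ _)) // ler_pM ?enorm_ge0.
have Q2 : `|dotp q2 (y - z)| <= eta * (2 * r).
  by rewrite (le_trans (dotp_CS _ _)) // ler_pM ?enorm_ge0.
have Zx := maxz xz.
set t := enorm (x - y) in V1 *.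
have t0 : 0 <= t := enorm_ge0 _.
rewrite -!enormE -/t => main.
(* Comparison with the pair [(z, z)]. The linear perturbations contribute at most [3 eta r], which
   the term [S^2 / nu] covers. *)
have key : nu * t ^+ 2 + kap * enorm (x - z) ^+ 2 <= S * t + S ^+ 2 / nu.
  move: V1 Q1 Q2 main Zx; rewrite !ler_norml !dotpBr.
  by move=> /andP[_ V1] /andP[Q1 _] /andP[Q2 _] *; lra.
have kap0 : 0 < kap by rewrite kapE divr_gt0 // mulr_gt0 // exprn_gt0.
have S2 : 0 < S ^+ 2 by rewrite exprn_gt0.
have t_le : t <= 2 * S / nu.
  rewrite leNgt; apply/negP => ht.
  have a1 : 2 * S < nu * t by move: ht; rewrite ltr_pdivrMr // (mulrC t).
  have a2 : 2 * S * t <= nu * t * t := ler_wpM2r t0 (ltW a1).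
  have a3 : S ^+ 2 / nu < S * t.
    rewrite ltr_pdivrMr //.
    have : 2 * S * S < nu * t * S by rewrite ltr_pM2r.
    by rewrite expr2; lra.
  have a4 : 0 <= kap * enorm (x - z) ^+ 2 by rewrite mulr_ge0 ?sqr_ge0 // ltW.
  by move: key; rewrite expr2; lra.
(* At distance [r] the penalty would be [4 S^2 / nu], but [key] and the bound on [t] allow only
   [3 S^2 / nu]; this is the origin of [kap]. *)
have xr : enorm (x - z) < r.
  rewrite ltNge; apply/negP => hr.
  have b1 : r ^+ 2 <= enorm (x - z) ^+ 2.
    by rewrite ler_pXn2r ?nnegrE ?enorm_ge0 // ltW.
  have b2 : 4 * S ^+ 2 / nu <= kap * enorm (x - z) ^+ 2.
    have -> : 4 * S ^+ 2 / nu = kap * r ^+ 2.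
      by rewrite kapE; field; rewrite !gt_eqF.
    by rewrite ler_wpM2l // ltW.
  have b3 : S * t <= 2 * (S ^+ 2 / nu).
    have : S * t <= S * (2 * S / nu) by rewrite ler_wpM2l // ltW.
    by rewrite expr2; lra.
  have b4 : 0 <= nu * t ^+ 2 by rewrite mulr_ge0 ?sqr_ge0 // ltW.
  have b5 : 0 < S ^+ 2 / nu by rewrite divr_gt0.
  lra.
split=> //; have := enorm_triangle x y z; rewrite (enormC y x) -/t.
by move: t_le Snu; lra.
Qed.

Lemma line_jet_doubled_rest (q1 q2 : 'rV[R]_d) x y xi zeta :
  line_jet (fun t => lam * h (x + t *: xi) +
      dotp p ((x + t *: xi) - (y + t *: zeta)) +
      nu * dotp ((x + t *: xi) - (y + t *: zeta)) ((x + t *: xi) - (y + t *: zeta)) +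
      kap * dotp (x + t *: xi - z) (x + t *: xi - z) +
      dotp q1 (x + t *: xi) + dotp q2 (y + t *: zeta))
    (lam * dotp (gh x) xi + dotp p (xi - zeta) + nu * (2 * dotp (x - y) (xi - zeta))
      + kap * (2 * dotp (x - z) xi) + dotp q1 xi + dotp q2 zeta)
    (lam * qform (Hh x) xi xi + nu * (2 * dotp (xi - zeta) (xi - zeta)) +
      kap * (2 * dotp xi xi)).
Proof.
have j1 := line_jetZ lam (jh x xi).
have j2 := line_jet_dotp p (x - y) (xi - zeta).
have j3 := line_jetZ nu (line_jet_sqr (x - y) (xi - zeta)).
have j4 := line_jetZ kap (line_jet_sqr (x - z) xi).
have j5 := line_jet_dotp q1 x xi.
have j6 := line_jet_dotp q2 y zeta.
apply: line_jet_eq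
  (line_jetD (line_jetD (line_jetD (line_jetD (line_jetD j1 j2) j3) j4) j5) j6) _ _ _ => //.
  apply/funext => t.
  have -> : x + t *: xi - (y + t *: zeta) = x - y + t *: (xi - zeta).
    by apply/rowP => i; rewrite !mxE; ring.
  by have -> : x + t *: xi - z = x - z + t *: xi by rewrite addrAC.
by rewrite !addr0.
Qed.

Definition doubled_grad1 x y : 'rV[R]_d :=
  grad U x - lam *: gh x - p - (2 * nu) *: (x - y) - (2 * kap) *: (x - z).

Definition doubled_grad2 x y : 'rV[R]_d := - grad V y + p + (2 * nu) *: (x - y).

(** The two points move along independent directions [xi] and [zeta], which yields the Hessian
    inequality in the form required by the coupling. The gradient identities need no second
    derivatives and hold at every maximum. *)
Lemma doubled_jets (q1 q2 : 'rV[R]_d) x y :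
  enorm (x - z) < r -> enorm (y - z) < 2 * r -> is_doubled_max q1 q2 x y ->
  [/\ doubled_grad1 x y = q1, doubled_grad2 x y = q2 &
   differentiable (grad U) x -> differentiable (grad V) y -> forall xi zeta,
     qform (hess U x) xi xi - qform (hess V y) zeta zeta <=
     lam * qform (Hh x) xi xi + nu * (2 * dotp (xi - zeta) (xi - zeta)) +
      kap * (2 * dotp xi xi)].
Proof.
move=> xz yz mx.
have Gx : G x by apply: ballG; have := r0; lra.
have Gy : G y by apply: ballG; exact: ltW.
have mxl xi zeta : exists2 e, 0 < e & forall t : R, `|t| < e ->
   U (x + t *: xi) - V (y + t *: zeta) - (lam * h (x + t *: xi) +
      dotp p ((x + t *: xi) - (y + t *: zeta)) +
      nu * dotp ((x + t *: xi) - (y + t *: zeta)) ((x + t *: xi) - (y + t *: zeta)) +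
      kap * dotp (x + t *: xi - z) (x + t *: xi - z) +
      dotp q1 (x + t *: xi) + dotp q2 (y + t *: zeta)) <=
   U (x + 0 *: xi) - V (y + 0 *: zeta) - (lam * h (x + 0 *: xi) +
      dotp p ((x + 0 *: xi) - (y + 0 *: zeta)) +
      nu * dotp ((x + 0 *: xi) - (y + 0 *: zeta)) ((x + 0 *: xi) - (y + 0 *: zeta)) +
      kap * dotp (x + 0 *: xi - z) (x + 0 *: xi - z) +
      dotp q1 (x + 0 *: xi) + dotp q2 (y + 0 *: zeta)).
  pose e := Num.min ((r - enorm (x - z)) / (enorm xi + 1))
    ((2 * r - enorm (y - z)) / (enorm zeta + 1)).
  have x1 : 0 < enorm xi + 1 by rewrite ltr_wpDl ?enorm_ge0.
  have y1 : 0 < enorm zeta + 1 by rewrite ltr_wpDl ?enorm_ge0.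
  exists e; first by rewrite lt_min !divr_gt0 ?subr_gt0.
  move=> t; rewrite lt_min !ltr_pdivlMr // => /andP[ht1 ht2].
  rewrite !scale0r !addr0.
  have X : enorm (x + t *: xi - z) <= r.
    have -> : x + t *: xi - z = (x - z) + t *: xi by rewrite addrAC.
    rewrite (le_trans (enormD _ _)) // enormZ.
    by have := normr_ge0 t; move: ht1; rewrite mulrDr mulr1; lra.
  have Y : enorm (y + t *: zeta - z) <= 2 * r.
    have -> : y + t *: zeta - z = (y - z) + t *: zeta by rewrite addrAC.
    rewrite (le_trans (enormD _ _)) // enormZ.
    by have := normr_ge0 t; move: ht2; rewrite mulrDr mulr1; lra.
  by have := mx _ _ X Y; rewrite /doubled; lra.
have first_order xi zeta :
    dotp (doubled_grad1 x y - q1) xi + dotp (doubled_grad2 x y - q2) zeta = 0.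
  have [e e0 he] := mxl xi zeta.
  have jr := line_jet_derive (line_jet_doubled_rest q1 q2 x y xi zeta).
  have dU : is_derive (0 : R) 1 (fun t => U (x + t *: xi)) (dotp (grad U x) xi).
    have := @is_derive_grad R d U x xi 0; rewrite scale0r addr0; apply; exact: CU.1.
  have dV : is_derive (0 : R) 1 (fun t => V (y + t *: zeta)) (dotp (grad V y) zeta).
    have := @is_derive_grad R d V y zeta 0; rewrite scale0r addr0; apply; exact: CV.1.
  have := derive_local_max (is_deriveB (is_deriveB dU dV) jr) e0 he.
  rewrite /doubled_grad1 /doubled_grad2.
  move: (grad U x) (grad V y) (x - y) (x - z) => gU gV w1 w2.
  by rewrite !dotpE => <-; ring.
split.
- apply/eqP; rewrite -subr_eq0; apply/eqP; apply: dotpxx_eq0.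
  by have := first_order (doubled_grad1 x y - q1) 0; rewrite dotp0r addr0.
- apply/eqP; rewrite -subr_eq0; apply/eqP; apply: dotpxx_eq0.
  by have := first_order 0 (doubled_grad2 x y - q2); rewrite dotp0r add0r.
- move=> dgU dgV xi zeta; have [e e0 he] := mxl xi zeta.
  have jU := line_jet_hess xi (near_differentiable oG Gx CU.1) dgU.
  have jV := line_jet_hess zeta (near_differentiable oG Gy CV.1) dgV.
  have j := line_jetB (line_jetB jU jV) (line_jet_doubled_rest q1 q2 x y xi zeta).
  by have [_] := line_jet_max j e0 he; lra.
Qed.

Lemma within_continuous_comp (m : nat) (K : set 'rV[R]_m) (u : 'rV[R]_d -> R)
    (g : 'rV[R]_m -> 'rV[R]_d) :
  {within K, continuous g} -> (forall w, K w -> {for g w, continuous u}) ->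
  {within K, continuous (fun w => u (g w))}.
Proof.
move=> /subspace_continuousP gc uc; apply/subspace_continuousP => w Kw.
exact: (cvg_comp _ _ (gc w Kw) (uc w Kw)).
Qed.

Let ball1 := [set x : 'rV[R]_d | enorm (x - z) <= 2 * r].
Let C := [set w : 'rV[R]_(d + d) |
  enorm (lsubmx w - z) <= r /\ enorm (rsubmx w - z) <= 2 * r].
Let B := enorm z + 2 * r + 1.

Let C_box w : C w -> forall i, `|w 0 i| <= B.
Proof.
move=> [hl hr] i.
have bnd x : enorm (x - z) <= 2 * r -> forall j, `|x 0 j| <= B.
  move=> hx j; rewrite (le_trans (coord_le_enorm _ _)) //.
  by have := enormD z (x - z); rewrite addrCA subrr addr0 /B; lra.
case: (split_ordP i) => j ->.
  by have := bnd (lsubmx w) _ j; rewrite mxE; apply; have := r0; lra.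
by have := bnd (rsubmx w) hr j; rewrite mxE.
Qed.

Let C_compact : compact C.
Proof.
pose H (b : bool) (w : 'rV[R]_(d + d)) : R :=
  if b then r ^+ 2 - dotp (lsubmx w - z) (lsubmx w - z)
  else (2 * r) ^+ 2 - dotp (rsubmx w - z) (rsubmx w - z).
have r2 : 0 <= 2 * r by rewrite mulr_ge0 // ltW.
have HP w : (forall b : bool, True -> 0 <= H b w) <-> C w.
  split=> [h1|[h1 h2] [] _]; rewrite /H.
  - have := h1 true I; have := h1 false I.
    rewrite /H !subr_ge0 -!enormE !ler_pXn2r ?nnegrE ?enorm_ge0 //; exact: ltW.
  - by rewrite subr_ge0 -enormE ler_pXn2r ?nnegrE ?enorm_ge0 // ltW.
  - by rewrite subr_ge0 -enormE ler_pXn2r ?nnegrE ?enorm_ge0.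
pose K := [set w : 'rV[R]_(d + d) | forall i, `|w 0 i| <= B].
have -> : C = [set w | K w /\ forall b : bool, True -> 0 <= H b w].
  rewrite predeqE => w; split=> [Cw|[_ /HP]] //.
  by split; [exact: C_box|exact/HP].
apply: compact_family_ge0; first exact: compact_box.
have lc : {within K, continuous (fun w => lsubmx w - z : 'rV[R]_d)}.
  by move=> w; apply: cvgB; [exact: lsubmx_within_continuous|exact: cvg_cst].
have rc : {within K, continuous (fun w => rsubmx w - z : 'rV[R]_d)}.
  by move=> w; apply: cvgB; [exact: rsubmx_within_continuous|exact: cvg_cst].
move=> [] _ w; apply: cvgB; try exact: cvg_cst.
  exact: (dotp_within_continuous lc lc).
exact: (dotp_within_continuous rc rc).
Qed.

Let W (w : 'rV[R]_(d + d)) := doubled (lsubmx w) (rsubmx w).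

Let W_continuous : {within C, continuous W}.
Proof.
have lc := @lsubmx_within_continuous C; have rc := @rsubmx_within_continuous C.
have Cl w : C w -> enorm (lsubmx w - z) <= 2 * r by move=> [h1 _]; have := r0; lra.
have Uc : {within C, continuous (fun w => U (lsubmx w))}.
  apply: within_continuous_comp => // w /Cl hw.
  by apply: differentiable_continuous; apply: CU.1; exact: ballG.
have Vc : {within C, continuous (fun w => V (rsubmx w))}.
  apply: within_continuous_comp => // w [_ hw].
  by apply: differentiable_continuous; apply: CV.1; exact: ballG.
have hc : {within C, continuous (fun w => h (lsubmx w))}.
  apply: (@lipschitz_within_continuous _ _ _ _ _ (Lh * d%:R)) => w w' Cw Cw'.
  have [h1 _] := hL (Cl w Cw) (Cl w' Cw'); apply: le_trans h1 _.
  rewrite -mulrA ler_wpM2l // (le_trans (enorm_le_norm _)) // ler_wpM2l //.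
  by rewrite -linearB /= norm_lsubmx_le.
have lrc : {within C, continuous (fun w => lsubmx w - rsubmx w : 'rV[R]_d)}.
  by move=> w; apply: cvgB; [exact: lc|exact: rc].
have lzc : {within C, continuous (fun w => lsubmx w - z : 'rV[R]_d)}.
  by move=> w; apply: cvgB; [exact: lc|exact: cvg_cst].
move=> w; apply: cvgB; last first.
  by apply: cvgM; [exact: cvg_cst|exact: (dotp_within_continuous lzc lzc)].
apply: cvgB; last first.
  by apply: cvgM; [exact: cvg_cst|exact: (dotp_within_continuous lrc lrc)].
apply: cvgB; last first.
  exact: (dotp_within_continuous (@cst_within_continuous _ _ _ p) lrc).
apply: cvgB; last exact: Vc.
apply: cvgB; first exact: Uc.
by apply: cvgM; [exact: cvg_cst|exact: hc].
Qed.

Let F (w : 'rV[R]_(d + d)) : 'rV[R]_(d + d) :=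
  row_mx (doubled_grad1 (lsubmx w) (rsubmx w)) (doubled_grad2 (lsubmx w) (rsubmx w)).

(** The constant involves the C^(1,1) bounds of [U] and [V] on a ball, which are not uniform in K;
    only its existence is used. *)
Let F_lipschitz : exists L, forall w w', C w -> C w' ->
  `|F w - F w'| <= L * `|w - w'|.
Proof.
have r2 : 0 <= 2 * r by rewrite mulr_ge0 // ltW.
have kap0 : 0 < kap by rewrite kapE divr_gt0 // mulr_gt0 // exprn_gt0.
have [LU LU0 hU] := lipschitz_inP (CU.2 ball1 (@compact_enorm_ball z (2 * r) r2) ballG).
have [LV LV0 hV] := lipschitz_inP (CV.2 ball1 (@compact_enorm_ball z (2 * r) r2) ballG).
exists (LU + lam * (Lh * d%:R) + 4 * nu + 2 * kap + (LV + 4 * nu)).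
move=> w w' [Cl Cr] [Cl' Cr'].
have Cl2 : ball1 (lsubmx w) by rewrite /ball1 /=; have := r0; lra.
have Cl2' : ball1 (lsubmx w') by rewrite /ball1 /=; have := r0; lra.
set D := `|w - w'|.
have nl : `|lsubmx w - lsubmx w'| <= D by rewrite -linearB /= norm_lsubmx_le.
have nr : `|rsubmx w - rsubmx w'| <= D by rewrite -linearB /= norm_rsubmx_le.
rewrite /F opp_row_mx add_row_mx (le_trans (norm_row_mx_le _ _)) // [leRHS]mulrDl lerD //.
- have -> : doubled_grad1 (lsubmx w) (rsubmx w) - doubled_grad1 (lsubmx w') (rsubmx w')
    = (grad U (lsubmx w) - grad U (lsubmx w')) - lam *: (gh (lsubmx w) - gh (lsubmx w'))
     - (2 * nu) *: ((lsubmx w - lsubmx w') - (rsubmx w - rsubmx w'))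
     - (2 * kap) *: (lsubmx w - lsubmx w').
    by rewrite /doubled_grad1; apply/rowP => i; rewrite !mxE; ring.
  rewrite [leRHS]mulrDl (le_trans (ler_normB _ _)) // lerD //; last first.
    by rewrite normrZ ger0_norm ?mulr_ge0 ?(ltW kap0) // ler_wpM2l // mulr_ge0 // ltW.
  rewrite [leRHS]mulrDl (le_trans (ler_normB _ _)) // lerD //; last first.
    rewrite normrZ ger0_norm ?mulr_ge0 ?(ltW nu0) //.
    have : `|lsubmx w - lsubmx w' - (rsubmx w - rsubmx w')| <= 2 * D.
      by rewrite (le_trans (ler_normB _ _)) //; lra.
    move=> hh; have : 2 * nu * `|lsubmx w - lsubmx w' - (rsubmx w - rsubmx w')|
      <= 2 * nu * (2 * D) by rewrite ler_wpM2l // mulr_ge0 // ltW.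
    by lra.
  rewrite [leRHS]mulrDl (le_trans (ler_normB _ _)) // lerD //.
    by rewrite (le_trans (hU _ _ Cl2 Cl2')) // ler_wpM2l.
  rewrite normrZ ger0_norm // -[leRHS]mulrA ler_wpM2l //.
  rewrite (le_trans (norm_le_enorm _)) //; have [_ h2] := hL Cl2 Cl2'.
  rewrite (le_trans h2) // -mulrA ler_wpM2l // (le_trans (enorm_le_norm _)) //.
  by rewrite ler_wpM2l.
- have -> : doubled_grad2 (lsubmx w) (rsubmx w) - doubled_grad2 (lsubmx w') (rsubmx w')
    = (2 * nu) *: ((lsubmx w - lsubmx w') - (rsubmx w - rsubmx w')) -
     (grad V (rsubmx w) - grad V (rsubmx w')).
    by rewrite /doubled_grad2; apply/rowP => i; rewrite !mxE; ring.
  rewrite [LV + _]addrC [leRHS]mulrDl (le_trans (ler_normB _ _)) // lerD //.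
    rewrite normrZ ger0_norm ?mulr_ge0 ?(ltW nu0) //.
    have : `|lsubmx w - lsubmx w' - (rsubmx w - rsubmx w')| <= 2 * D.
      by rewrite (le_trans (ler_normB _ _)) //; lra.
    move=> hh; have : 2 * nu * `|lsubmx w - lsubmx w' - (rsubmx w - rsubmx w')|
      <= 2 * nu * (2 * D) by rewrite ler_wpM2l // mulr_ge0 // ltW.
    by lra.
  by rewrite (le_trans (hV _ _ Cr Cr')) // ler_wpM2l.
Qed.

(** Jensen's lemma in twice the dimension, with both null sets turned into cylinders. The map [F] of
    partial gradients is Lipschitz on all of [C], so [C] also serves as the contact region. *)
Lemma doubled_point (E1 E2 : set 'rV[R]_d) (eta : R) :
  lebesgue_null E1 -> lebesgue_null E2 ->
  0 < eta -> 3 * eta * r <= S ^+ 2 / nu ->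
  exists x y q1 q2, [/\ [/\ enorm q1 <= eta, enorm q2 <= eta, ~ E1 x & ~ E2 y],
    enorm (x - z) < r, enorm (y - z) < 2 * r, enorm (x - y) <= 2 * S / nu &
    is_doubled_max q1 q2 x y].
Proof.
move=> E1n E2n eta0 eta_r.
have [L FL] := F_lipschitz.
have B0 : 0 < B by rewrite /B ltr_wpDl // addr_ge0 ?enorm_ge0 // mulr_ge0 // ltW.
pose N := [set w : 'rV[R]_(d + d) | E1 (lsubmx w) /\ forall i, `|w 0 i| <= B] `|`
  [set w : 'rV[R]_(d + d) | E2 (rsubmx w) /\ forall i, `|w 0 i| <= B].
have Nnull : lebesgue_null N.
  apply: lebesgue_nullU.
    exact: (@lebesgue_null_cylinder R d E1 B true).
  exact: (@lebesgue_null_cylinder R d E2 B false).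
have d1 : (0 : R) < d%:R + 1 by rewrite ltr_wpDl.
pose e' := eta / (d%:R + 1).
have e'0 : 0 < e' by rewrite divr_gt0.
have small (q : 'rV[R]_d) : (forall i, `|q 0 i| <= e') -> enorm q <= eta.
  move=> hq; rewrite (le_trans (enorm_le_coord_bound (ltW e'0) hq)) // /e'.
  by rewrite mulrCA ger_pMr // ler_pdivrMr // mul1r lerDl.
have sub_max (q w : 'rV[R]_(d + d)) : C w ->
    (forall w', C w' -> W w' - dotp q w' <= W w - dotp q w) ->
    is_doubled_max (lsubmx q) (rsubmx q) (lsubmx w) (rsubmx w).
  move=> Cw mx x' y' hx hy.
  have := mx (row_mx x' y'); rewrite /W /C /= row_mxKl row_mxKr.
  rewrite -{1}(hsubmxK q) -{3}(hsubmxK q) -{3}(hsubmxK w) !dotp_row_mx.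
  by move=> /(_ (conj hx hy)); lra.
have sub_small (q : 'rV[R]_(d + d)) : (forall i, `|q 0 i| <= e') ->
    enorm (lsubmx q) <= eta /\ enorm (rsubmx q) <= eta.
  by move=> hq; split; apply: small => i; rewrite mxE.
have [q [w [hq Cw nN Fw mx]]] : exists q w : 'rV[R]_(d + d),
    [/\ forall i, `|q 0 i| <= e', C w, ~ N w, F w = q &
    forall w', C w' -> W w' - dotp q w' <= W w - dotp q w].
  apply: (perturbed_max_off_null C_compact _ W_continuous C_compact _ e'0 FL Nnull) => //.
    exists (row_mx z z); rewrite /C /= row_mxKl row_mxKr subrr enorm0.
    by split; rewrite ?mulr_ge0 // ltW.
  move=> q w hq Cw mx; split=> //.
  have [hl hr] := Cw; have dm := sub_max q w Cw mx; have [q1 q2] := sub_small q hq.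
  have [xz yz _] := doubled_location (ltW eta0) eta_r q1 q2 hl hr dm.
  have [g1 g2 _] := doubled_jets xz yz dm.
  by rewrite /F g1 g2 hsubmxK.
have [hl hr] := Cw; have dm := sub_max q w Cw mx; have [q1 q2] := sub_small q hq.
have [xz yz xy] := doubled_location (ltW eta0) eta_r q1 q2 hl hr dm.
exists (lsubmx w), (rsubmx w), (lsubmx q), (rsubmx q); split=> //.
by split=> // hE; apply: nN; [left|right]; split=> //; exact: C_box.
Qed.

End doubling.

(** * One-sided Isaacs inequalities *)

(** Needed because [grad (- V) = - grad V] is known only near the point, where [V] is
    differentiable. *)
Lemma near_eq_differentiable (R : numFieldType) (V W : normedModType R)
    (f k : V -> W) (x : V) :
  (\forall y \near x, f y = k y) -> differentiable f x -> differentiable k x.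
Proof.
move=> fk /diff_locallyP [dc df].
have E : k \o shift x = cst (k x) + 'd f x +o_ (0 : V) id.
  apply/eqaddoP => e e0; move/eqaddoP: df => /(_ e e0) df.
  have := fk; rewrite (near_shift 0) /= subr0 => fk0.
  near=> h.
  have fkh : f (h + x) = k (h + x) by near: h.
  have : `|(f \o shift x - (cst (f x) + 'd f x)) h| <= e * `|h| by near: h.
  by rewrite !fctE /= fkh (nbhs_singleton fk).
by apply/diff_locallyP; rewrite (diff_unique dc E).
Unshelve. all: by end_near.
Qed.

Section game.
Context {R : realType} {d : nat} (A B : metricType R).
Context (D : @coefficients R d A B) (P : jet R d -> R).
Context (delta deltahat chi K0 K1 : R) (omega : R -> R) (g : 'rV[R]_d -> R).
Implicit Types (u v U V : 'rV[R]_d -> R) (x y z : 'rV[R]_d) (G : set 'rV[R]_d).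

(** The sup-inf is unfolded into strategies with an error [th]: [al] is chosen first and must work
    against every [be]. In [isaacs_super] a [be] answers each [al], and the cut-off acts on the
    negated jet, as in the min equation. *)
Definition isaacs_sub (K : R) U x : Prop :=
  differentiable (grad U) x /\
  ((forall th, 0 < th -> exists al, forall be,
      - th <= linear_op D al be (jet_of U x) x + coef_f D al be x) \/
   K <= P (jet_of U x)).

Definition isaacs_super (K : R) V x : Prop :=
  differentiable (grad V) x /\
  ((forall th al, 0 < th -> exists be,
      linear_op D al be (jet_of V x) x + coef_f D al be x <= th) \/
   K <= P (- jet_of V x)).

Lemma linear_opE al be U x : linear_op D al be (jet_of U x) x =
  frob (coef_a D al be x) (hess U x) + dotp (coef_b D al be x) (grad U x)
  - coef_c D al be x * U x.
Proof. by []. Qed.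

Hypotheses (delta0 : 0 < deltahat) (deltaH : deltahat < delta) (K01 : K0 <= K1)
  (Dadm : admissible delta chi K0 omega D g).

Lemma coef_boundsP al be x : coef_bounds deltahat K1 (coef_a D al be x)
  (coef_b D al be x) (coef_c D al be x) (coef_f D al be x).
Proof.
have [_ _ _ /(_ al be x) [[aT ha] c0 _ hb [hc hf]] _] := Dadm.
have dl0 := lt_trans delta0 deltaH.
split.
- split=> // xi; have /andP [h1 h2] := ha xi.
  have s0 : 0 <= enorm xi ^+ 2 by rewrite exprn_ge0 // enorm_ge0.
  rewrite (le_trans _ h1) ?ler_wpM2r ?(ltW deltaH) //=.
  by rewrite (le_trans h2) // ler_wpM2r // lef_pV2 ?posrE // ltW.
- exact: le_trans K01.
- by rewrite c0 (le_trans (ler_norm _)) // (le_trans hc).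
- exact: le_trans K01.
Qed.

(** Boundedness is what makes [sup] and [inf] in [isaacs] genuine extrema and not default values. *)
Lemma linear_op_bounded U x : exists Mx, forall al be,
  `|linear_op D al be (jet_of U x) x + coef_f D al be x| <= Mx.
Proof.
exists (\sum_i \sum_j K1 * `|hess U x i j| + K1 * enorm (grad U x) + K1 * `|U x| + K1).
move=> al be; have [ha hb /andP [c0 hc] hf] := coef_boundsP al be x.
have [_ _ _ /(_ al be x) [_ _ hn _ _] _] := Dadm.
rewrite (le_trans (ler_normD _ _)) // lerD // linear_opE.
rewrite (le_trans (ler_normB _ _)) // lerD //; last first.
  by rewrite normrM ler_wpM2r // ger0_norm.
rewrite (le_trans (ler_normD _ _)) // lerD //; last first.
  by rewrite (le_trans (dotp_CS _ _)) // ler_wpM2r // enorm_ge0.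
rewrite /frob (le_trans (ler_norm_sum _ _ _)) // ler_sum // => i _.
rewrite (le_trans (ler_norm_sum _ _ _)) // ler_sum // => j _.
rewrite normrM ler_wpM2r // (le_trans (coord_le_fnorm _ _ _)) //.
exact: le_trans K01.
Qed.

Lemma isaacs_ge0 U x : 0 <= isaacs D U x -> forall th, 0 < th ->
  exists al, forall be, - th <= linear_op D al be (jet_of U x) x + coef_f D al be x.
Proof.
have [[[a0 _] [b0 _] _ _] _ _ _ _] := Dadm.
have [Mx hM] := linear_op_bounded U x => h th th0.
pose S := range (fun al : A => inf (range (fun be : B =>
    linear_op D al be (jet_of U x) x + coef_f D al be x))).
have hi al : has_inf (range (fun be : B =>
    linear_op D al be (jet_of U x) x + coef_f D al be x)).
  split; first by exists (linear_op D al b0 (jet_of U x) x + coef_f D al b0 x), b0.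
  by exists (- Mx) => _ [be _ <-]; have := hM al be; rewrite ler_norml => /andP [].
have hs : has_sup S.
  split; first by eexists; exists a0.
  exists Mx => _ [al _ <-].
  apply: (@le_trans _ _ (linear_op D al b0 (jet_of U x) x + coef_f D al b0 x)).
    by apply: ge_inf; [exact: (hi al).2 | exists b0].
  by have := hM al b0; rewrite ler_norml => /andP [].
have [_ [al _ <-]] := sup_adherent th0 hs.
rewrite -/(isaacs D U x) => hal; exists al => be.
have hb : inf (range (fun be : B => linear_op D al be (jet_of U x) x + coef_f D al be x))
    <= linear_op D al be (jet_of U x) x + coef_f D al be x.
  by apply: ge_inf; [exact: (hi al).2 | exists be].
apply: le_trans hb; apply: le_trans (ltW hal).
by rewrite -[leLHS]add0r lerB.
Qed.

Lemma isaacs_le0 U x : isaacs D U x <= 0 -> forall th al, 0 < th ->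
  exists be, linear_op D al be (jet_of U x) x + coef_f D al be x <= th.
Proof.
have [[[a0 _] [b0 _] _ _] _ _ _ _] := Dadm.
have [Mx hM] := linear_op_bounded U x => h th al th0.
have hi al' : has_inf (range (fun be : B =>
    linear_op D al' be (jet_of U x) x + coef_f D al' be x)).
  split; first by exists (linear_op D al' b0 (jet_of U x) x + coef_f D al' b0 x), b0.
  by exists (- Mx) => _ [be _ <-]; have := hM al' be; rewrite ler_norml => /andP [].
have hle : inf (range (fun be : B => linear_op D al be (jet_of U x) x + coef_f D al be x))
    <= 0.
  apply: le_trans h; apply: ub_le_sup; last by exists al.
  exists Mx => _ [al' _ <-].
  apply: (@le_trans _ _ (linear_op D al' b0 (jet_of U x) x + coef_f D al' b0 x)).
    by apply: ge_inf; [exact: (hi al').2 | exists b0].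
  by have := hM al' b0; rewrite ler_norml => /andP [].
have [_ [be _ <-] hbe] := inf_adherent th0 (hi al).
exists be; apply: (le_trans (ltW hbe)); rewrite -[leRHS]add0r lerD2r //.
Qed.

(* Both u_K and v_K have all these properties, which is why the comparison can
   be applied in both directions. *)
Definition two_sided G (K : R) U : Prop :=
  [/\ C11loc G U, {within closure G, continuous U},
      forall x, frontier G x -> U x = g x,
      ae_in G (isaacs_sub K U) & ae_in G (isaacs_super K U)].

(** If the maximum is 0, the Isaacs operator is nonpositive without exception, and it is 0 unless
    [P] reaches [K]. The min equation is the mirror image. *)
Lemma solves_max_two_sided G K u : solves_max D P G g K u -> two_sided G K u.
Proof.
move=> [Cu cu bu [E E0 hE]]; split=> //; exists E => // x Gx Ex.
  have [du /= h] := hE x Gx Ex; split=> //.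
  have [hP|hP] := leP K (P (jet_of u x)); [by right|left].
  apply: isaacs_ge0; have : 0 <= Num.max (isaacs D u x) (P (jet_of u x) - K) by rewrite h.
  by rewrite le_max subr_ge0 [K <= _]leNgt hP orbF.
have [du /= h] := hE x Gx Ex; split=> //.
by left; apply: isaacs_le0; rewrite -h le_max lexx.
Qed.

Lemma jet_ofN G U x : open G -> C11loc G U -> G x -> differentiable (grad U) x ->
  jet_of (fun y => - U y) x = - jet_of U x.
Proof.
move=> oG [dU _] Gx dgU.
have nU := near_differentiable oG Gx dU.
rewrite /jet_of gradN; last exact: nbhs_singleton nU.
congr (_, _, _); apply/matrixP => i j; rewrite !mxE.
have dj : derivable (partial j U) x (delta_mx 0 i).
  by apply: diff_derivable; exact: differentiable_partial.
rewrite [partial i (partial j U) x]/partial -(deriveN dj); apply: near_eq_derive; near=> y.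
rewrite /= fctE [LHS]/partial deriveN //.
by apply: diff_derivable; near: y.
Unshelve. all: by end_near.
Qed.

Lemma solves_min_two_sided G K v : open G ->
  solves_min D P G g K v -> two_sided G K v.
Proof.
move=> oG [Cv cv bv [E E0 hE]]; split=> //; exists E => // x Gx Ex.
  have [dv /= h] := hE x Gx Ex; split=> //.
  by left; apply: isaacs_ge0; rewrite -h ge_min lexx.
have [dv /= h] := hE x Gx Ex; split=> //.
rewrite -(jet_ofN oG Cv Gx dv); move: h.
have [hP|hP] := leP K (P (jet_of (fun y => - v y) x)); first by right.
set Q := P _ in hP *; move=> h; left; apply: isaacs_le0.
have : Num.min (isaacs D v x) (- Q + K) <= 0 by rewrite h.
by rewrite ge_min addrC subr_le0 [K <= _]leNgt hP orbF.
Qed.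

End game.

Section bounds.
Context {R : realType} {d : nat} (A B : metricType R).
Context (D : @coefficients R d A B) (P : jet R d -> R).
Context (delta deltahat chi K0 K1 : R) (omega : R -> R) (g : 'rV[R]_d -> R).
Implicit Types (u v U V : 'rV[R]_d -> R) (x y z : 'rV[R]_d) (G : set 'rV[R]_d).
Hypotheses (d_gt0 : (0 < d)%N) (delta0 : 0 < deltahat) (deltaH : deltahat < delta)
  (K00 : 0 <= K0) (K01 : K0 <= K1) (Pcut : cutoff_function deltahat K1 P)
  (Dadm : admissible delta chi K0 omega D g).

Lemma admissible_C11_bound : C11_bound K0 g.
Proof.
have [_ _ [_ _ _ _ [dg gK]] _ _] := Dadm.
have O : offdiag [set: 'rV[R]_d] !=set0.
  exists (delta_mx 0 (Ordinal d_gt0), 0); split=> //= /(congr1 enorm).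
  by rewrite enorm_delta enorm0 => /eqP; rewrite oner_eq0.
have [_ h1 h2 h3] := C1norm_bounds ltr01 O gK.
split=> // x y; split; [exact: h1|exact: h2|].
by have := h3 x y I I; rewrite powRr1 ?enorm_ge0.
Qed.

(** Where the cut-off is active, [P >= K >= 0] and a linearization of [P] is an operator of the
    class with [f = 0]. Thus the Pucci inequality holds with constants independent of K. *)
Lemma isaacs_sub_pucci K U x : 0 <= K -> (hess U x)^T = hess U x ->
  isaacs_sub D P K U x -> pucci_sub deltahat K1 U x.
Proof.
move=> K0' sU [dU h]; split=> // th th0; case: h => [/(_ th th0) [al hal]|hP].
  have [[_ [be _] _ _] _ _ _ _] := Dadm.
  exists (coef_a D al be x), (coef_b D al be x), (coef_c D al be x), (coef_f D al be x).
  by split; [exact: (coef_boundsP delta0 deltaH K01 Dadm)|exact: hal].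
have [[[a b] c] /= [ha hb c0 hc]] := cutoff_linearization Pcut (sU : sym_jet (jet_of U x)) th0.
rewrite jet_pairingE /= ler_norml => /andP [_ h].
exists a, b, (- c), 0; split.
  by split=> //; [rewrite oppr_ge0 ltW //= lerNl | rewrite normr0 (le_trans K00)].
by move: h hP; move: (frob _ _) (dotp _ _) => X Y; lra.
Qed.

Lemma isaacs_super_pucci G K V x : open G -> C11loc G V -> G x -> 0 <= K ->
  isaacs_super D P K V x -> pucci_sub deltahat K1 (fun y => - V y) x.
Proof.
move=> oG CV Gx K0' [dV h].
have nV := near_differentiable oG Gx CV.1.
have E := jet_ofN oG CV Gx dV.
have [EH EG] : hess (fun y => - V y) x = - hess V x /\ grad (fun y => - V y) x = - grad V x.
  by rewrite -[hess _ x]/((jet_of _ x).1.1) -[grad (fun _ => _) x]/((jet_of _ x).1.2) E.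
split=> [|th th0].
  apply: (@near_eq_differentiable _ _ _ (fun y => - grad V y)); last exact: differentiableN.
  by apply: filterS nV => y dVy; rewrite gradN.
rewrite EH EG; case: h => [h|hP].
  have [[[al _] _ _ _] _ _ _ _] := Dadm.
  have [be hbe] := h th al th0.
  have [ha hb hc hf] := coef_boundsP delta0 deltaH K01 Dadm al be x.
  exists (coef_a D al be x), (coef_b D al be x), (coef_c D al be x), (- coef_f D al be x).
  split; first by split; rewrite ?normrN.
  move: hbe; rewrite linear_opE frobNr dotpNr mulrN.
  by move: (frob _ _) (dotp _ _) (coef_c _ _ _ _ * _) (coef_f _ _ _ _) => *; lra.
have sV : sym_jet (- jet_of V x) by apply: sym_jetN; exact: hess_sym.
have [[[a b] c] /= [ha hb c0 hc]] := cutoff_linearization Pcut sV th0.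
rewrite jet_pairingE /= ler_norml frobNr dotpNr => /andP [_ h].
exists a, b, (- c), 0; split.
  by split=> //; [rewrite oppr_ge0 ltW //= lerNl | rewrite normr0 (le_trans K00)].
by rewrite frobNr dotpNr; move: h hP; move: (frob _ _) (dotp _ _) => X Y; lra.
Qed.

End bounds.

(** The order of quantifiers matters: [N] is fixed before the coefficients, [g] and [K]. The lower
    bound is the upper one for [- U], with data [- g]. *)
Lemma two_sided_boundary {R : realType} {d : nat} (P : jet R d -> R)
    (delta deltahat chi K0 K1 : R) (G : set 'rV[R]_d) :
  (0 < d)%N -> 0 < deltahat -> deltahat < delta -> 0 <= K0 -> K0 <= K1 ->
  cutoff_function deltahat K1 P -> C2_bounded_domain G ->
  exists N, 0 < N /\ forall (omega : R -> R) (A B : metricType R)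
    (D : @coefficients R d A B) (g : 'rV[R]_d -> R) (K : R) (U : 'rV[R]_d -> R),
    admissible delta chi K0 omega D g -> 0 <= K -> two_sided D P g G K U ->
    forall x x0, G x -> frontier G x0 -> `|U x - g x0| <= N * enorm (x - x0).
Proof.
move=> d0 dh0 dh K00 K01 Pcut GC.
have [N [N0 hN]] := boundary_upper GC dh0 K00 (le_trans K00 K01).
exists N; split=> // om A B D g K U Dadm KK [CU cU bU [E1 E10 h1] [E2 E20 h2]] x x0 Gx Fx0.
have [_ oG _ _ _] := GC.
have gB := admissible_C11_bound d0 Dadm.
rewrite ler_distl; apply/andP; split.
  rewrite lerBlDr -subr_ge0.
  have CN : C11loc G (fun y => - U y).
    split=> [y Gy|C cC CG]; first exact/differentiableN/CU.1.
    have [M [Mr hM]] := CU.2 C cC CG.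
    exists M; split; first exact: Mr.
    move=> L /hM hL [y y'] /= [Cy Cy'].
    rewrite !gradN; try by apply: CU.1; exact: CG.
    by have := hL (y, y') (conj Cy Cy'); rewrite /= -opprD normrN.
  have cN : {within closure G, continuous (fun y => - U y)}.
    by move=> y; apply: cvgN; exact: cU.
  have aN : ae_in G (pucci_sub deltahat K1 (fun y => - U y)).
    exists E2 => // y Gy Ey.
    exact: (isaacs_super_pucci dh0 dh K00 K01 Pcut Dadm oG CU Gy KK (h2 y Gy Ey)).
  have bN y : frontier G y -> - U y = - g y by move=> /bU ->.
  have := hN _ _ (C11_boundN gB) CN cN bN aN x x0 Gx Fx0.
  by move: (N * _) => W; lra.
apply: hN Fx0 => //; exists E1 => // y Gy Ey.
apply: (isaacs_sub_pucci dh0 dh K00 K01 Pcut Dadm KK _ (h1 y Gy Ey)).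
exact: hess_sym (near_differentiable oG Gy CU.1) (h1 y Gy Ey).1.
Qed.

(** * Comparison *)

Lemma qform0l {R : realType} {d : nat} (M : 'M[R]_d) (x : 'rV[R]_d) : qform M 0 x = 0.
Proof. by rewrite /qform mul0mx dotp0l. Qed.

(** * Contradiction at a doubled maximum *)

Section contradiction.
Context {R : realType} {d : nat} (A B : metricType R).
Context (D : @coefficients R d A B) (P : jet R d -> R).
Context (delta deltahat chi K0 K1 : R) (omega : R -> R) (g : 'rV[R]_d -> R).
Hypotheses (delta0 : 0 < deltahat) (deltaH : deltahat < delta)
  (K00 : 0 <= K0) (K01 : K0 <= K1) (Pcut : cutoff_function deltahat K1 P)
  (Dadm : admissible delta chi K0 omega D g).
(** In the application [e] is [x - y], [s] is [x - z], [p] is the gradient of [V] at [z], and [hx],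
    [gx], [Hx] form the jet of the barrier at [x]. Opaque names keep the estimates linear in few
    atoms. *)
Context (U V : 'rV[R]_d -> R) (x y e p s q1 q2 gx : 'rV[R]_d) (Hx HU HV : 'M[R]_d).
Context (hx lam nu kap k w H M eta th r t K c0 : R).
Hypotheses (lam0 : 0 <= lam) (lam1 : lam <= 1) (nu0 : 0 <= nu) (kap0 : 0 <= kap)
  (c00 : 0 <= c0) (hx0 : 0 <= hx) (hx1 : hx <= 1) (th0 : 0 < th).
Hypotheses (EHU : hess U x = HU) (EHV : hess V y = HV) (sU : HU^T = HU) (sV : HV^T = HV).
Hypotheses
  (gU : grad U x = lam *: gx + p + (2 * nu) *: e + (2 * kap) *: s + q1)
  (gV : grad V y = p + (2 * nu) *: e - q2)
  (jUV : forall xi zeta, qform (HU) xi xi - qform (HV) zeta zeta <=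
     lam * qform Hx xi xi + nu * (2 * dotp (xi - zeta) (xi - zeta))
     + kap * (2 * dotp xi xi))
  (bar : forall a b c f, coef_bounds deltahat K1 a b c f ->
     frob a Hx + dotp b gx - c * hx <= - c0).
Hypotheses (q1e : enorm q1 <= eta) (q2e : enorm q2 <= eta) (sr : enorm s <= r)
  (xyt : enorm e <= t) (pH : enorm p <= H) (VH : enorm (grad V y) <= H)
  (UM : `|U x| <= M) (VM : `|V y| <= M)
  (UV : lam * hx + dotp p e - 3 * eta * r <= U x - V y).

Let K10 : 0 <= K1 := le_trans K00 K01.
Let eta0 : 0 <= eta := le_trans (enorm_ge0 q1) q1e.
Let r0 : 0 <= r := le_trans (enorm_ge0 s) sr.
Let t0 : 0 <= t := le_trans (enorm_ge0 e) xyt.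
Let H0 : 0 <= H := le_trans (enorm_ge0 p) pH.
Let M0 : 0 <= M := le_trans (normr_ge0 (U x)) UM.

Let dotp_bound (b q : 'rV[R]_d) (m1 m2 : R) : enorm b <= m1 -> enorm q <= m2 ->
  `|dotp b q| <= m1 * m2.
Proof.
move=> hb hq; rewrite (le_trans (dotp_CS _ _)) // ler_pM ?enorm_ge0 //.
Qed.

Let symU : (hess U x)^T = hess U x.
Proof. by rewrite EHU. Qed.

Let symV : (hess V y)^T = hess V y.
Proof. by rewrite EHV. Qed.

Let kb := d%:R / deltahat * (2 * nu + 2 * kap)
  + K1 * (H + 2 * nu * t + 2 * kap * r + M + 2 + eta) + th.

(** Taking [zeta = 0] in [jUV] bounds the Hessian of [U - lam h] from above. With [P] replaced by a
    linear operator up to [th], hypothesis [bar] controls the barrier part. *)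
Let cutoff_U : P (jet_of U x) <= kb.
Proof.
have [[[a b] c] /= [ha hb c_lt0 hc]] :=
  cutoff_linearization Pcut (symU : sym_jet (jet_of U x)) th0.
rewrite jet_pairingE /= ler_norml EHU gU !dotpDr !dotpZr => /andP [_ h].
have cb : coef_bounds deltahat K1 a b (- c) 0.
  by split=> //; [rewrite oppr_ge0 ltW //= lerNl | rewrite normr0].
have hbar := bar cb.
have hA : frob a (HU - lam *: Hx) <= d%:R * (2 * nu + 2 * kap) / deltahat.
  apply: frob_le_elliptic => // [|v]; first by nonneg.
  have := jUV v 0; rewrite !qfE subr0.
  rewrite qform0l.
  by move: (qform _ v v) (qform Hx _ _) (dotp v v) => *; lra.
have frobA (Q : 'M[R]_d) : frob a (Q - lam *: Hx) = frob a Q - lam * frob a Hx.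
  by rewrite !frobE.
move: hA; rewrite frobA => hA.
have l1 : lam * (frob a Hx + dotp b gx - - c * hx) <= 0.
  rewrite mulr_ge0_le0 // (le_trans hbar) // oppr_le0 //.
have l2 : lam * (- c * hx) <= K1.
  rewrite -[leRHS]mul1r ler_pM // ?mulr_ge0 ?oppr_ge0 ?(ltW c_lt0) //.
  by rewrite -[leRHS]mulr1 ler_pM // ?oppr_ge0 ?(ltW c_lt0) // lerNl.
have l3 : 2 * nu * dotp b e <= 2 * nu * (K1 * t).
  rewrite ler_wpM2l //; first by nonneg.
  by apply: le_trans (ler_norm _) _; exact: dotp_bound.
have l4 : 2 * kap * dotp b s <= 2 * kap * (K1 * r).
  rewrite ler_wpM2l //; first by nonneg.
  by apply: le_trans (ler_norm _) _; exact: dotp_bound.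
have l5 : dotp b q1 <= K1 * eta by apply: le_trans (ler_norm _) _; exact: dotp_bound.
have l6 : dotp b p <= K1 * H by apply: le_trans (ler_norm _) _; exact: dotp_bound.
have l7 : c * U x <= K1 * M.
  apply: le_trans (ler_norm _) _; rewrite normrM ler_pM //.
  by rewrite ltr0_norm // lerNl.
rewrite /kb; move: h hA l1 l2 l3 l4 l5 l6 l7.
move: (frob _ _) (frob _ _) (dotp b p) (dotp b gx) (dotp b e) (dotp b s) (dotp b q1).
move: (P _) (U x) => PU Ux F1 F2 d1 d2 d3 d4 d5 h hA l1 l2 l3 l4 l5 l6 l7.
have -> : d%:R / deltahat * (2 * nu + 2 * kap) = d%:R * (2 * nu + 2 * kap) / deltahat
  by rewrite mulrAC.
move: (d%:R * _ / _) hA => X hA; have := K10; nra.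
Qed.

(** Here [xi = 0] in [jUV], which bounds [- HV] from above without any barrier term. *)
Let cutoff_V : P (- jet_of V y) <= kb.
Proof.
have [[[a b] c] /= [ha hb c_lt0 hc]] :=
  cutoff_linearization Pcut (sym_jetN (symV : sym_jet (jet_of V y))) th0.
rewrite jet_pairingE /= ler_norml EHV gV !dotpNr !dotpDr dotpNr !dotpZr frobNr => /andP [_ h].
have hA : frob a (- HV) <= d%:R * (2 * nu) / deltahat.
  apply: frob_le_elliptic => // [|v]; first by nonneg.
  have := jUV 0 v; rewrite !qfE sub0r dotpNl dotpNr opprK.
  rewrite !qform0l dotp0l; move: (qform _ v v) (dotp v v) => *; lra.
move: hA; rewrite frobNr => hA.
have l3 : 2 * nu * - dotp b e <= 2 * nu * (K1 * t).
  rewrite ler_wpM2l //; first by nonneg.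
  by apply: le_trans (ler_norm _) _; rewrite normrN; exact: dotp_bound.
have l5 : dotp b q2 <= K1 * eta by apply: le_trans (ler_norm _) _; exact: dotp_bound.
have l6 : - dotp b p <= K1 * H.
  by apply: le_trans (ler_norm _) _; rewrite normrN; exact: dotp_bound.
have l7 : c * - V y <= K1 * M.
  apply: le_trans (ler_norm _) _; rewrite normrM normrN ler_pM //.
  by rewrite ltr0_norm // lerNl.
have l8 : d%:R * (2 * nu) / deltahat <= d%:R / deltahat * (2 * nu + 2 * kap).
  rewrite [leRHS]mulrAC ler_wpM2r ?invr_ge0 ?(ltW delta0) // ler_wpM2l //.
  by rewrite lerDl; nonneg.
have l9 : 0 <= K1 * (2 * kap * r) by nonneg.
rewrite /kb; move: h hA l3 l5 l6 l7 l8 l9.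
move: (frob _ _) (dotp b p) (dotp b e) (dotp b q2) (P _) (V y).
move: (d%:R / deltahat * _) (d%:R * _ / deltahat).
move=> X X' F1 d1 d3 d5 PV Vy h hA l3 l5 l6 l7 l8 l9; have := K10; nra.
Qed.

Hypotheses (k0 : 0 < k) (kd : k <= delta)
  (aw : forall al be, frob (coef_a D al be x - coef_a D al be y)
     (coef_a D al be x - coef_a D al be y) <= 4 * delta * k)
  (bw : forall al be, enorm (coef_b D al be x - coef_b D al be y) <= w)
  (cw : forall al be, `|coef_c D al be x - coef_c D al be y| <= w)
  (fw : forall al be, `|coef_f D al be x - coef_f D al be y| <= w).

(** The gain [- lam * c0] comes from the operator with coefficients at [x] acting on [lam h]; the
    other terms are errors from the coefficients at two different points, the localization and the
    perturbations. *)
Lemma linear_op_coupling al be :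
  linear_op D al be (jet_of U x) x + coef_f D al be x
    - (linear_op D al be (jet_of V y) y + coef_f D al be y) <=
  4 * nu * k * d%:R + 2 * kap * (d%:R / deltahat) + 2 * kap * (K1 * r)
    + w * (H + M + 1) + K1 * (H * t) + K1 * (eta * (3 * r + 2)) - lam * c0.
Proof.
rewrite !linear_opE EHU EHV.
have [_ _ _ hx' _] := Dadm.
have [[aT ea] _ _ _ _] := hx' al be x; have [[aT' ea'] _ _ _ _] := hx' al be y.
have cb := coef_boundsP delta0 deltaH K01 Dadm al be x.
move: aT ea aT' ea' cb (bar cb) (aw al be) (bw al be) (cw al be) (fw al be).
move: (coef_a _ _ _ x) (coef_a _ _ _ y) (coef_b _ _ _ x) (coef_b _ _ _ y) => a a' b b'.
move: (coef_c _ _ _ x) (coef_c _ _ _ y) (coef_f _ _ _ x) (coef_f _ _ _ y) => c c' f f'.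
move=> aT ea aT' ea' [ha hb /andP [c_ge0 cK] _] hbar haw hbw hcw hfw.
(* Moving the barrier and the localization to the Hessian at [x] puts [jUV] into the form required
   by [coupling_frob]. *)
have l1 : frob a (HU - lam *: Hx - (2 * kap) *: 1%:M) - frob a' (HV)
    <= 4 * nu * k * d%:R.
  apply: (coupling_frob aT aT' nu0 k0 kd _ _ haw) => [v|v|xi zeta].
  - by rewrite -enormE qformE; have /andP [] := ea v.
  - by rewrite -enormE qformE; have /andP [] := ea' v.
  - have := jUV xi zeta; rewrite !qfE.
    by move: (qform _ xi xi) (qform Hx xi xi) (qform _ zeta zeta) (dotp xi xi)
      (dotp (_ - _) _) => *; lra.
have frobA (Q : 'M[R]_d) : frob a (Q - lam *: Hx - (2 * kap) *: 1%:M) =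
    frob a Q - lam * frob a Hx - 2 * kap * \tr a by rewrite !frobE.
move: l1; rewrite frobA => l1.
have l2 : \tr a <= d%:R / deltahat.
  rewrite -frob1 -[d%:R]mulr1; apply: (frob_le_elliptic delta0 ha ler01) => v.
  by rewrite !qfE mul1r.
have l2' : 2 * kap * \tr a <= 2 * kap * (d%:R / deltahat) by rewrite ler_wpM2l //; nonneg.
have l3 : dotp b (grad U x) - dotp b' (grad V y) =
    lam * dotp b gx + 2 * kap * dotp b s + dotp b q1 + dotp b q2 + dotp (b - b') (grad V y).
  by rewrite gU gV dotpBl !dotpDr !dotpNr !dotpZr; ring.
have l4 : 2 * kap * dotp b s <= 2 * kap * (K1 * r).
  rewrite ler_wpM2l //; first by nonneg.
  by apply: le_trans (ler_norm _) _; exact: dotp_bound.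
have l5 : dotp b q1 <= K1 * eta by apply: le_trans (ler_norm _) _; exact: dotp_bound.
have l6 : dotp b q2 <= K1 * eta by apply: le_trans (ler_norm _) _; exact: dotp_bound.
have l7 : dotp (b - b') (grad V y) <= w * H.
  by apply: le_trans (ler_norm _) _; exact: dotp_bound.
have l8 : c' * V y - c * V y <= w * M.
  apply: le_trans (ler_norm _) _; rewrite -mulrBl normrM ler_pM //.
  by rewrite distrC.
(* As [c >= 0], the lower bound on [U x - V y] supplies the term [- c * lam * hx] that completes the
   operator applied to the barrier. *)
have l9 : c * (lam * hx + dotp p e - 3 * eta * r) <= c * (U x - V y) by rewrite ler_wpM2l.
have l10 : - dotp p e <= H * t.
  by apply: le_trans (ler_norm _) _; rewrite normrN; exact: dotp_bound.
have l11 : c * (- dotp p e + 3 * eta * r) <= K1 * (H * t + 3 * eta * r).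
  apply: (@le_trans _ _ (c * (H * t + 3 * eta * r))); first by rewrite ler_wpM2l // lerD2r.
  by rewrite ler_wpM2r // addr_ge0 //; nonneg.
have l12 : f - f' <= w := le_trans (ler_norm _) hfw.
have l13 : lam * (frob a Hx + dotp b gx - c * hx) <= lam * - c0 by rewrite ler_wpM2l.
move: l1 l2' l3 l4 l5 l6 l7 l8 l9 l11 l12 l13.
move: (frob a _) (frob a' _) (frob a _) (\tr a) (dotp (b - b') _) (dotp b _) (dotp b' _)
  (dotp b _) (dotp b _) (dotp b _) (dotp b _) (dotp p e) (U x) (V y).
by move=> F1 F2 F3 T d1 d2 d3 d4 d5 d6 d7 d8 Ux Vy *; lra.
Qed.

Hypotheses (subU : isaacs_sub D P K U x) (superV : isaacs_super D P K V y).

(** If neither cut-off is active, take [al] from the inequality for [U] and the answer [be] from the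
    one for [V]: the same pair serves both points, contrary to the coupling estimate. So [K] is
    below one of the two cut-off bounds. *)
Lemma doubling_contradiction :
  4 * nu * k * d%:R + 2 * kap * (d%:R / deltahat) + 2 * kap * (K1 * r)
    + w * (H + M + 1) + K1 * (H * t) + K1 * (eta * (3 * r + 2)) + 2 * th < lam * c0 ->
  K <= d%:R / deltahat * (2 * nu + 2 * kap)
    + K1 * (H + 2 * nu * t + 2 * kap * r + M + 2 + eta) + th.
Proof.
move=> err; case: subU => _ [hU|hU]; last exact: le_trans hU cutoff_U.
case: superV => _ [hV|hV]; last exact: le_trans hV cutoff_V.
have [al hal] := hU th th0; have [be hbe] := hV th al th0.
have := linear_op_coupling al be; have := hal be; move: err hbe.
move: (linear_op _ _ _ _ _) (linear_op _ _ _ _ _) => L1 L2.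
by move: (4 * _ * _ * _) (2 * _ * _) (2 * _ * _) (w * _) (K1 * _) (K1 * _) => *; lra.
Qed.

End contradiction.

(** * Distance to the boundary *)

Section distance.
Context {R : realType} {d : nat}.
Implicit Types (x y z : 'rV[R]_d) (E G : set 'rV[R]_d).

Lemma dist_to_le E x y : E y -> dist_to E x <= enorm (x - y).
Proof.
move=> Ey; apply: ge_inf; last by exists y.
by exists 0 => _ [w _ <-]; exact: enorm_ge0.
Qed.

Lemma dist_to_lt E x t : E !=set0 -> dist_to E x < t ->
  exists y, E y /\ enorm (x - y) < t.
Proof.
move=> [y0 Ey0] /inf_lt [|_ [y Ey <-] lt_t]; last by exists y.
by exists (enorm (x - y0)), y0.
Qed.

Lemma dist_to_lipschitz E x y : E !=set0 ->
  dist_to E x <= dist_to E y + enorm (x - y).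
Proof.
move=> E0; apply/ler_addgt0Pr => e e0.
have [w [Ew hw]] : exists w, E w /\ enorm (y - w) < dist_to E y + e.
  by apply: dist_to_lt; rewrite ?ltrDl.
apply: le_trans (dist_to_le x Ew) _.
by have := enorm_triangle y x w; lra.
Qed.

(** The point taken is the supremum of the parameters of the segment that lie in [G]. It is a limit
    of points of [G], and openness would allow a larger parameter if it were in [G]. *)
Lemma frontier_crossing G z x : open G -> G z -> ~ G x ->
  exists y, frontier G y /\ enorm (z - y) <= enorm (z - x).
Proof.
move=> oG Gz Gx.
pose T := [set t : R | 0 <= t <= 1 /\ G (z + t *: (x - z))].
have T0 : T 0 by split; rewrite ?lexx ?ler01 // scale0r addr0.
have hT : has_sup T by split; [exists 0 | exists 1 => t [/andP []]].
pose s := sup T; pose y := z + s *: (x - z).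
have s0 : 0 <= s by apply: ub_le_sup => //; exact: hT.2.
have s1 : s <= 1 by apply: ge_sup => [|t [/andP []]]; first exact: hT.1.
have xz0 : 0 < `|x - z|.
  by rewrite normr_gt0 subr_eq0; apply: contra_notN Gx => /eqP ->.
have near_s (e : R) : 0 < e -> forall t, `|t - s| < e / `|x - z| ->
    ball y e (z + t *: (x - z)).
  move=> e0 t ht; rewrite -ball_normE /= /y opprD addrACA subrr add0r -scalerBl.
  by rewrite normrZ distrC -ltr_pdivlMr.
have cy : closure G y.
  move=> W /nbhs_ballP [e /= e0 hW].
  have es0 : 0 < e / `|x - z| by rewrite divr_gt0.
  have [t [ht Gt] tlt] := sup_adherent es0 hT.
  exists (z + t *: (x - z)); split=> //; apply: hW; apply: near_s => //.
  have ts : t <= s by apply: ub_le_sup; [exact: hT.2|split].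
  by rewrite distrC ger0_norm ?subr_ge0 // ltrBlDr -ltrBlDl.
exists y; split; last first.
  have -> : z - y = s *: (z - x) by rewrite /y opprD addrA subrr sub0r -scalerN opprB.
  by rewrite enormZ ger0_norm // ler_piMl // enorm_ge0.
split=> // /interior_subset Gy.
have s_lt : s < 1.
  rewrite lt_neqAle s1 andbT; apply: contra_notN Gx => /eqP sE.
  by move: Gy; rewrite /y sE scale1r addrC subrK.
have [e /= e0 he] := (@nbhs_ballP _ _ _ _).1 (open_nbhs_nbhs (conj oG Gy)).
pose t := s + Num.min (1 - s) (e / `|x - z| / 2).
have m0 : 0 < Num.min (1 - s) (e / `|x - z| / 2).
  by rewrite lt_min subr_gt0 s_lt /= !divr_gt0.
have Tt : T t.
  split; first by rewrite /t addr_ge0 ?(ltW m0) //= -lerBrDl ge_min lexx.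
  apply: he; apply: near_s => //; rewrite /t addrAC subrr add0r gtr0_norm //.
  rewrite (@le_lt_trans _ _ (e / `|x - z| / 2)) ?ge_min ?lexx ?orbT //.
  by have : 0 < e / `|x - z| by [rewrite divr_gt0]; move: (e / _) => q; lra.
have := ub_le_sup hT.2 Tt; rewrite -/s /t; lra.
Qed.

Lemma frontier_nonempty G : (0 < d)%N -> G !=set0 -> open G -> bounded_set G ->
  frontier G !=set0.
Proof.
move=> d0 [z Gz] oG bG; have [B [B0 hB]] := bounded_enorm bG.
have [|y [fy _]] := @frontier_crossing G z ((B + 1) *: delta_mx 0 (Ordinal d0)) oG Gz.
  move=> /subset_closure /hB; rewrite enormZ enorm_delta mulr1 gtr0_norm; last by lra.
  by lra.
by exists y.
Qed.

Lemma ball_inner_set G z (eps s : R) : frontier G !=set0 -> open G -> G z ->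
  0 < eps -> eps + s < dist_to (frontier G) z ->
  forall x, enorm (x - z) <= s -> inner_set G eps x.
Proof.
move=> fG oG Gz e0 hz x xz.
have h1 := dist_to_lipschitz z x fG; rewrite (enormC z x) in h1.
split; last by lra.
apply: contrapT => Gx; have [y [fy hy]] := frontier_crossing oG Gz Gx.
by have := dist_to_le z fy; rewrite (enormC z x) in hy; lra.
Qed.

End distance.

Section comparison.
Context {R : realType} {d : nat} (A B : metricType R).
Context (D : @coefficients R d A B) (P : jet R d -> R).
Context (delta deltahat chi K0 K1 : R) (omega : R -> R) (g : 'rV[R]_d -> R).
Hypotheses (d_gt0 : (0 < d)%N) (delta0 : 0 < deltahat) (deltaH : deltahat < delta)
  (chi01 : 0 < chi < 1)
  (K00 : 0 <= K0) (K01 : K0 <= K1) (Pcut : cutoff_function deltahat K1 P)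
  (Dadm : admissible delta chi K0 omega D g).
Context (G : set 'rV[R]_d) (U V : 'rV[R]_d -> R) (K : R).
Hypotheses (GC : C2_bounded_domain G)
  (solU : two_sided D P g G K U) (solV : two_sided D P g G K V).
Context (mu rb Dm c0 : R) (y0 : 'rV[R]_d).
Hypotheses (mu0 : 0 < mu) (rb0 : 0 < rb) (Dm0 : 0 < Dm) (c00 : 0 < c0)
  (ann : forall x, closure G x -> annulus rb Dm y0 x)
  (bar : forall x a b c f, annulus rb Dm y0 x -> coef_bounds deltahat K1 a b c f ->
     frob a (barrier_hess mu rb y0 x) + dotp b (barrier_grad mu rb y0 x)
       - c * barrier mu rb y0 x <= - c0).
Context (lam eps Q M r nu k w : R).
Let S := Q * (2 * r) `^ chi.
Let t := 2 * S / nu.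
Let kap := 4 * S ^+ 2 / (nu * r ^+ 2).
Let H := d%:R * Q.
Hypotheses (lam0 : 0 < lam) (lam1 : lam <= 1) (eps0 : 0 < eps) (Q0 : 0 < Q)
  (r0 : 0 < r) (r_eps : 2 * r < eps) (nu0 : 0 < nu) (t_r : t <= r)
  (k0 : 0 < k) (kd : k <= delta)
  (kt : (K0 * t `^ gamma_of chi) ^+ 2 <= 4 * delta * k) (wt : K0 * omega t <= w)
  (UM : forall x, G x -> `|U x| <= M) (VM : forall x, G x -> `|V x| <= M)
  (VQ : forall x y, inner_set G eps x -> inner_set G eps y ->
     `|V x - V y| <= Q * enorm (x - y) /\
     enorm (grad V x - grad V y) <= Q * enorm (x - y) `^ chi)
  (err : 4 * nu * k * d%:R + 2 * kap * (d%:R / deltahat) + 2 * kap * (K1 * r)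
    + w * (H + M + 1) + K1 * (H * t) < lam * c0)
  (Klarge : d%:R / deltahat * (2 * nu + 2 * kap)
    + K1 * (H + 2 * nu * t + 2 * kap * r + M + 3) + 1 < K).

Let h := barrier mu rb y0.

Let S0 : 0 < S.
Proof. by rewrite mulr_gt0 // powR_gt0 // mulr_gt0. Qed.

Let coefs_close x y : enorm (x - y) <= t -> forall al be,
  [/\ frob (coef_a D al be x - coef_a D al be y) (coef_a D al be x - coef_a D al be y)
        <= 4 * delta * k,
      enorm (coef_b D al be x - coef_b D al be y) <= w,
      `|coef_c D al be x - coef_c D al be y| <= w &
      `|coef_f D al be x - coef_f D al be y| <= w].
Proof.
move=> xyt al be; have [_ [_ om _] _ _ /(_ al be x y) [ha hb hc hf]] := Dadm.
have ow : K0 * omega (enorm (x - y)) <= w.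
  apply: le_trans wt; rewrite ler_wpM2l // om // ?in_itv /= ?andbT ?enorm_ge0 //.
  exact: le_trans (enorm_ge0 _) xyt.
split; try exact: le_trans ow.
rewrite -fnorm_sqr; apply: le_trans kt; rewrite ler_pXn2r ?nnegrE ?sqrtr_ge0 //; last first.
  by rewrite mulr_ge0 // powR_ge0.
apply: (le_trans ha); rewrite ler_wpM2l //; apply: ge0_ler_powR => //.
- have /andP [c1 c2] := chi01; rewrite /gamma_of divr_ge0 //; lra.
- by rewrite nnegrE enorm_ge0.
- by rewrite nnegrE (le_trans (enorm_ge0 _) xyt).
Qed.

(** A distance above [2 eps] puts the ball of radius [eps] about [z] into [inner_set G eps], where
    the Hoelder bound on the gradient of [V] is available. The strict inequality [err] leaves a gap
    from which the perturbation and the error [th] are paid. *)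
Let no_interior_max z : G z -> 2 * eps < dist_to (frontier G) z ->
  0 <= U z - V z - lam * h z ->
  (forall x, G x -> U x - V x - lam * h x <= U z - V z - lam * h z) -> False.
Proof.
move=> Gz dz Zz0 mz.
have [G0 oG _ bG _] := GC.
have [CU cU bU [E1 E1n subU] _] := solU; have [CV cV bV _ [E2 E2n supV]] := solV.
have fG := frontier_nonempty d_gt0 G0 oG bG.
have inz x : enorm (x - z) <= eps -> inner_set G eps x.
  by move=> hx; apply: (ball_inner_set fG oG Gz eps0 _ hx); lra.
have ballG x : enorm (x - z) <= 2 * r -> G x.
  by move=> hx; have [] := inz x (le_trans hx (ltW r_eps)).
have annG x : G x -> annulus rb Dm y0 x by move=> /subset_closure /ann.
have HV x : enorm (x - z) < eps -> enorm (grad V x) <= H.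
  move=> xz; apply: enorm_grad_le; first exact: ltW.
    by apply: CV.1; have [] := inz x (ltW xz).
  have d1 : (0 : R) < d%:R + 1 by rewrite ltr_wpDl.
  have e0 : 0 < (eps - enorm (x - z)) / (d%:R + 1) by rewrite divr_gt0 // subr_gt0.
  apply/nbhs_ballP; exists ((eps - enorm (x - z)) / (d%:R + 1)) => //= y.
  rewrite -ball_normE /= distrC ltr_pdivlMr // => hy.
  have yin : inner_set G eps y.
    apply: inz; have := enorm_triangle x y z; have := enorm_le_norm (y - x).
    by have := normr_ge0 (y - x); lra.
  by have [] := VQ yin (inz x (ltW xz)).
pose p := grad V z.
have zz : enorm (z - z) = 0 by rewrite subrr enorm0.
pose Lh := Num.max (mu * (2 * Dm)) (2 * mu * (1 + mu * (2 * Dm) * Dm)).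
have mu_ge := ltW mu0; have Dm_ge := ltW Dm0.
have Lh0 : 0 <= Lh by rewrite le_max; apply/orP; left; nonneg.
have hL x y : enorm (x - z) <= 2 * r -> enorm (y - z) <= 2 * r ->
    `|h x - h y| <= Lh * enorm (x - y) /\
    enorm (barrier_grad mu rb y0 x - barrier_grad mu rb y0 y) <= Lh * enorm (x - y).
  move=> /ballG /annG ax /ballG /annG ay; split.
    apply: le_trans (barrier_lipschitz mu0 rb0 ax ay) _.
    by rewrite ler_wpM2r ?enorm_ge0 // le_max lexx.
  apply: le_trans (barrier_grad_lipschitz mu0 rb0 ax ay) _.
  by rewrite ler_wpM2r ?enorm_ge0 // le_max lexx orbT.
have gradV y : enorm (y - z) <= 2 * r -> enorm (grad V y - p) <= S.
  have zin : inner_set G eps z by apply: inz; rewrite zz ltW.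
  move=> hy; have [_ h2] := VQ (inz y (le_trans hy (ltW r_eps))) zin.
  apply: le_trans h2 _.
  rewrite ler_wpM2l ?(ltW Q0) //; apply: ge0_ler_powR; rewrite ?nnegrE ?enorm_ge0 //.
    by have /andP [/ltW] := chi01.
  by rewrite mulr_ge0 // ltW.
have maxz x : enorm (x - z) <= r -> U x - V x - lam * h x <= U z - V z - lam * h z.
  by move=> hx; apply/mz/ballG; have := r0; lra.
move: err; set Err := (X in X < _) => err'.
pose gap := lam * c0 - Err.
have gap0 : 0 < gap by rewrite subr_gt0.
have K10 := le_trans K00 K01.
have m0 : 0 < K1 * (3 * r + 2) + 1.
  by rewrite ltr_wpDl // mulr_ge0 // addr_ge0 // mulr_ge0 // ltW.
(* The bounds serve, in order, the cut-off estimate [Klarge], the localization of the doubled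
   maximum, and the coupling error. With [th <= gap / 8] the perturbations cost at most half of the
   gap. *)
pose eta := Num.min 1 (Num.min (S ^+ 2 / nu / (3 * r)) (gap / (4 * (K1 * (3 * r + 2) + 1)))).
have eta0 : 0 < eta.
  rewrite !lt_min ltr01 /=; apply/andP; split; last by rewrite divr_gt0 // mulr_gt0.
  by apply: divr_gt0; [rewrite divr_gt0 // exprn_gt0 | rewrite mulr_gt0].
have eta1 : eta <= 1 by rewrite ge_min lexx.
have eta_r : 3 * eta * r <= S ^+ 2 / nu.
  have : eta <= S ^+ 2 / nu / (3 * r) by rewrite !ge_min lexx orbT.
  rewrite ler_pdivlMr ?mulr_gt0 //; by rewrite mulrCA mulrA.
have eta_gap : K1 * (eta * (3 * r + 2)) <= gap / 4.
  have : eta <= gap / (4 * (K1 * (3 * r + 2) + 1)) by rewrite !ge_min lexx !orbT.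
  rewrite ler_pdivlMr ?mulr_gt0 // => he.
  rewrite mulrCA; move: (K1 * (3 * r + 2)) he => X; have := eta0; lra.
pose th := Num.min 1 (gap / 8).
have th0 : 0 < th by rewrite lt_min ltr01 /= divr_gt0.
have th1 : th <= 1 by rewrite ge_min lexx.
have thg : th <= gap / 8 by rewrite ge_min lexx orbT.
have [x [y [q1 [q2 [[q1e q2e nE1 nE2] xz yz xyt mx]]]]] :=
  doubled_point oG CU CV (line_jet_barrier mu rb y0) r0 ballG hL S0 nu0 (ltW lam0) Lh0
    gradV maxz t_r erefl E1n E2n eta0 eta_r.
have Gx : G x by apply: ballG; have := r0; lra.
have Gy : G y by apply: ballG; exact: ltW.
have [g1 g2 jUV] := doubled_jets oG CU CV (line_jet_barrier mu rb y0) r0 ballG xz yz mx.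
have sx := subU x Gx nE1; have sy := supV y Gy nE2.
have {}jUV := jUV sx.1 sy.1.
have sU := hess_sym (near_differentiable oG Gx CU.1) sx.1.
have sV := hess_sym (near_differentiable oG Gy CV.1) sy.1.
have gU : grad U x = lam *: barrier_grad mu rb y0 x + p + (2 * nu) *: (x - y)
    + (2 * kap) *: (x - z) + q1.
  have eqv (a1 a2 a3 a4 a5 : 'rV[R]_d) : a1 = lam *: a2 + a3 + (2 * nu) *: a4
      + (2 * kap) *: a5 + (a1 - lam *: a2 - a3 - (2 * nu) *: a4 - (2 * kap) *: a5).
    by apply/rowP => i; rewrite !mxE; ring.
  by rewrite -g1; exact: eqv.
have gV : grad V y = p + (2 * nu) *: (x - y) - q2.
  have eqv (a1 a2 a3 : 'rV[R]_d) :
      a1 = a2 + (2 * nu) *: a3 - (- a1 + a2 + (2 * nu) *: a3).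
    by apply/rowP => i; rewrite !mxE; ring.
  by rewrite -g2; exact: eqv.
(* Compare with the pair [(z, z)], where [U z - V z - lam * h z] is nonnegative, and drop the
   penalties. *)
have UV : lam * h x + dotp p (x - y) - 3 * eta * r <= U x - V y.
  have := mx z z; rewrite zz mulr_ge0 ?(ltW r0) // => /(_ isT isT).
  rewrite /doubled !subrr.
  move=> mxz; have b1 : `|dotp q1 (x - z)| <= eta * r.
    by rewrite (le_trans (dotp_CS _ _)) // ler_pM ?enorm_ge0 // ltW.
  have b2 : `|dotp q2 (y - z)| <= eta * (2 * r).
    by rewrite (le_trans (dotp_CS _ _)) // ler_pM ?enorm_ge0 // ltW.
  move: b1; rewrite dotpBr ler_norml => /andP [b1 b1'].
  move: b2; rewrite dotpBr ler_norml => /andP [b2 b2'].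
  have n1 : 0 <= nu * dotp (x - y) (x - y).
    by rewrite -enormE mulr_ge0 ?(ltW nu0) // exprn_ge0 // enorm_ge0.
  have n2 : 0 <= kap * dotp (x - z) (x - z).
    rewrite -enormE mulr_ge0 ?exprn_ge0 ?enorm_ge0 // /kap divr_ge0 //.
      by rewrite mulr_ge0 // exprn_ge0 // ltW.
    by rewrite mulr_ge0 ?exprn_ge0 // ltW.
  move: mxz; rewrite (dotpC p 0) !dotp0l !mulr0 -!/(h _).
  move: n1 n2 b1 b1' b2 b2' Zz0; rewrite -!/(h _).
  move: (nu * dotp _ _) (kap * dotp _ _) => N1 N2.
  move: (dotp p _) (dotp _ _) (dotp _ _) (dotp _ _) (dotp _ _).
  by move: (lam * h x) (lam * h z) (U _) (U _) (V _) (V _) => *; lra.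
have ag : annulus rb Dm y0 x := annG x Gx.
have xe : enorm (x - z) <= r := ltW xz.
have zeps : enorm (z - z) < eps by rewrite zz.
have yeps : enorm (y - z) < eps := lt_trans yz r_eps.
have cc := coefs_close xyt.
have := @doubling_contradiction R d A B D P delta deltahat chi K0 K1 omega g
  delta0 deltaH K00 K01 Pcut Dadm U V x y (x - y) p (x - z) q1 q2
  (barrier_grad mu rb y0 x) (barrier_hess mu rb y0 x) (hess U x) (hess V y)
  (h x) lam nu kap k w H M eta th r t K c0 (ltW lam0) lam1 (ltW nu0).
have kap0 : 0 <= kap.
  rewrite /kap divr_ge0 //; first by rewrite mulr_ge0 // exprn_ge0 // ltW.
  by rewrite mulr_ge0 ?exprn_ge0 // ltW.
move=> /(_ kap0 (ltW c00) (barrier_ge0 mu0 rb0 ag) (barrier_le1 _ _ _ _) th0 erefl erefl).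
move=> /(_ sU sV gU gV jUV (fun a b c f => @bar x a b c f ag) q1e q2e xe xyt).
move=> /(_ (HV z zeps) (HV y yeps) (UM Gx) (VM Gy) UV k0 kd).
move=> /(_ (fun al be => let: And4 e _ _ _ := cc al be in e)).
move=> /(_ (fun al be => let: And4 _ e _ _ := cc al be in e)).
move=> /(_ (fun al be => let: And4 _ _ e _ := cc al be in e)).
move=> /(_ (fun al be => let: And4 _ _ _ e := cc al be in e) sx sy).
have aux (e X Y th' : R) : 0 < X - e -> Y <= (X - e) / 4 -> th' <= (X - e) / 8 ->
  e + Y + 2 * th' < X by lra.
have e1 := aux _ _ _ _ gap0 eta_gap thg.
move=> /(_ e1) KK; have := lt_le_trans Klarge KK.
rewrite ltNge => /negP; apply; rewrite lerD // lerD2l ler_wpM2l //.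
by rewrite -[leLHS]addrA lerD2l; move: eta1; lra.
Qed.

(** Take a maximum point of [U - V - lam h] on the closure. If the value is positive, the point is
    not on the frontier, where [U = V] and [h >= 0], nor deep inside, so [near_bd] applies there.
    The bound [h <= 1] accounts for [lam]. *)
Lemma comparison (Bd : R) : 0 <= Bd ->
  (forall z, G z -> dist_to (frontier G) z <= 2 * eps -> U z - V z <= Bd) ->
  forall x, G x -> U x - V x <= lam + Bd.
Proof.
move=> Bd0 near_bd x Gx.
have [G0 oG _ bG _] := GC.
have [CU cU bU _ _] := solU; have [CV cV bV _ _] := solV.
have cG := closure_bounded_compact bG.
have hlip x1 x2 : closure G x1 -> closure G x2 ->
    `|h x1 - h x2| <= (mu * (2 * Dm) * d%:R) * `|x1 - x2|.
  move=> /ann a1 /ann a2; apply: le_trans (barrier_lipschitz mu0 rb0 a1 a2) _.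
  have mu_ge := ltW mu0; have Dm_ge := ltW Dm0.
  by rewrite -[leRHS]mulrA ler_wpM2l ?enorm_le_norm //; nonneg.
pose Z x := U x - V x - lam * h x.
have cZ : {within closure G, continuous Z}.
  have ch : {within closure G, continuous h} by exact: lipschitz_within_continuous hlip.
  move=> y; apply: cvgB; first by apply: cvgB; [exact: cU | exact: cV].
  by apply: cvgM; [exact: cvg_cst | exact: ch].
have G1 : closure G !=set0 by case: G0 => z Gz; exists z; exact: subset_closure.
have [z /set_mem cz mz] := EVT_max_rV G1 cG cZ.
have mzG y : G y -> Z y <= Z z by move=> Gy; apply: mz; rewrite inE; exact: subset_closure.
have hx1 : lam * h x <= lam by rewrite ler_piMr ?(ltW lam0) // barrier_le1.
have hz0 : 0 <= lam * h z by rewrite mulr_ge0 ?(ltW lam0) // (barrier_ge0 mu0 rb0 (ann cz)).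
have := mzG x Gx; rewrite /Z => Zx.
have [Zz|Zz] := leP (Z z) 0; first by move: Zz; rewrite /Z; lra.
have Gz : G z.
  apply: frontier_open => // fz; move: Zz; rewrite /Z (bU z fz) (bV z fz) subrr sub0r.
  by rewrite oppr_gt0 ltNge hz0.
have [dz|dz] := leP (dist_to (frontier G) z) (2 * eps).
  by have := near_bd z Gz dz; lra.
by case: (no_interior_max Gz dz (ltW Zz) mzG).
Qed.

End comparison.

(** * Choice of parameters *)

(* S is the oscillation of the gradient, t bounds |x - y| at the doubled
   maximum.  The powers of r in nu and k are chosen so that nu * k, kap and
   Q * t are O(r^(chi / 8)) and t^(2 gamma) = O(k); they leave room for this
   because 2 gamma (2 - chi) = 2 - 3 chi / 2. *)
Lemma doubling_rates {R : realType} (d : nat) (delta deltahat chi K0 K1 M : R) :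
  0 < delta -> 0 < deltahat -> 0 < chi < 1 -> 0 <= K0 -> 0 <= K1 -> 0 <= M ->
  exists C, 0 < C /\ forall r Q, 0 < r <= 1 -> 1 <= Q -> Q * r `^ (chi / 16) <= 1 ->
    C * r `^ (chi / 8) <= 1 -> exists nu k,
    let S := Q * (2 * r) `^ chi in let t := 2 * S / nu in
    let kap := 4 * S ^+ 2 / (nu * r ^+ 2) in
    [/\ 0 < nu, t <= r, 0 < k <= delta,
        (K0 * t `^ gamma_of chi) ^+ 2 <= 4 * delta * k &
        4 * nu * k * d%:R + 2 * kap * (d%:R / deltahat) + 2 * kap * (K1 * r)
          + K1 * (d%:R * Q * t) <= C * r `^ (chi / 8) /\
        d%:R / deltahat * (2 * nu + 2 * kap)
          + K1 * (d%:R * Q + 2 * nu * t + 2 * kap * r + M + 3) + 1 <= C * r ^- 2].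
Proof.
move=> dl0 dh0 /andP [c0 c1] K00 K10 M0.
pose Ck := K0 ^+ 2 / delta + 1.
have Ck0 : 0 < Ck by rewrite ltr_wpDl // divr_ge0 ?sqr_ge0 // ltW.
pose X := d%:R / deltahat.
have X0 : 0 <= X by rewrite divr_ge0 // ltW.
pose C1 := 4 * Ck * d%:R + 32 * X + 32 * K1 + 4 * K1 * d%:R.
pose C2 := 34 * X + K1 * (d%:R + 8 + 32 + M + 3) + 1.
have Ck_ge := ltW Ck0; have cd0 : 0 <= d%:R :> R by [].
have C10 : 0 <= C1 by rewrite /C1; nonneg.
have C20 : 0 <= C2 by rewrite /C2; nonneg.
(* [C1] collects the coupling errors and [C2] the cut-off bound. Under [C * r^(chi/8) <= 1] the last
   two terms yield [k <= delta] and [t <= r]. *)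
pose C := C1 + C2 + Ck / delta + 4.
have Cd0 : 0 <= Ck / delta by rewrite divr_ge0 // ltW.
have [CC1 CC2 CCd C4] : [/\ C1 <= C, C2 <= C, Ck / delta <= C & 4 <= C].
  by rewrite /C; move: C10 C20 Cd0; clear; split; lra.
clearbody C; exists C; split; first by move: C4; clear; lra.
move=> r Q r01 Q1 Qr Cr; have /andP [r0 r1] := r01.
have pD a b : r `^ (a + b) = r `^ a * r `^ b 
  by rewrite powRD //; apply/implyP => _; rewrite gt_eqF.
have pge a : 0 <= r `^ a := powR_ge0 _ _.
have ple a b : a <= b -> r `^ b <= r `^ a by exact: ger_powR.
have p2 : r ^+ 2 = r `^ 2 by rewrite powR_mulrn // ltW.
have p1 : r = r `^ 1 by rewrite powRr1 // ltW.
have Q0 : 0 <= Q := le_trans ler01 Q1.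
(* Since [S^2] is of order [r^(15 chi / 8)] once [Q] is absorbed, this exponent of [nu] makes [kap]
   of order [r^(chi/8)]; that of [k] then gives [nu * k = Ck * r^(chi/8)]. *)
pose nu := r `^ (- (2 - 7 * chi / 4)); pose k := Ck * r `^ (2 - 13 * chi / 8).
exists nu, k => S t kap.
have nu0 : 0 < nu by exact: powR_gt0.
have S_le : S <= 2 * Q * r `^ chi.
  rewrite /S powRM ?(ltW r0) // mulrA ler_wpM2r // mulrC ler_wpM2r //.
  by rewrite -[leRHS]powRr1 //; apply: ler_powR; rewrite ?ler1n // ltW.
have S0 : 0 <= S by rewrite mulr_ge0 // powR_ge0.
(* The large factor [Q] is traded for a sixteenth of the Hoelder exponent. *)
have Sr : S <= 2 * r `^ (chi * (15 / 16)).
  have E : r `^ chi = r `^ (chi / 16) * r `^ (chi * (15 / 16)).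
    by rewrite -pD; congr (_ `^ _); field.
  have := ler_wpM2r (pge (chi * (15 / 16))) Qr; move: S_le; rewrite E.
  by move: (r `^ _) (r `^ _) => a1 a2; clear; lra.
have nuV : nu^-1 = r `^ (2 - 7 * chi / 4) by rewrite /nu powRN invrK.
have t_le : t <= 4 * r `^ (2 - 13 * chi / 16).
  rewrite /t nuV.
  have -> : 2 - 13 * chi / 16 = chi * (15 / 16) + (2 - 7 * chi / 4) by field.
  rewrite (pD (chi * (15 / 16))) mulrA ler_wpM2r //; move: Sr; clear; lra.
have t0 : 0 <= t by rewrite /t divr_ge0 ?(ltW nu0) // mulr_ge0.
set rho := r `^ (chi / 8) in Cr *.
have rho0 : 0 <= rho := pge _.
have rho1 : rho <= 1 by rewrite -(powRr0 r) ple // divr_ge0 // ltW.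
have kap_le : kap <= 16 * rho.
  rewrite /kap ler_pdivrMr; last by rewrite mulr_gt0 // exprn_gt0.
  have E : rho * nu * r ^+ 2 = (r `^ (chi * (15 / 16))) ^+ 2.
    by rewrite p2 [RHS]expr2 /rho /nu -!pD; congr (_ `^ _); field.
  have -> : 16 * rho * (nu * r ^+ 2) = 16 * (rho * nu * r ^+ 2) by ring.
  have -> : 16 * (rho * nu * r ^+ 2) = 4 * (2 * r `^ (chi * (15 / 16))) ^+ 2.
    by rewrite E; ring.
  by rewrite ler_pM2l // ler_pXn2r // nnegrE // mulr_ge0.
have kap0 : 0 <= kap.
  apply: divr_ge0; first by rewrite mulr_ge0 // sqr_ge0.
  by apply: mulr_ge0; [exact: ltW|exact: sqr_ge0].
have rho_eq : 4 * rho <= 1.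
  by apply: le_trans Cr; rewrite ler_wpM2r.
have t4 : t <= 4 * rho * r.
  have rr : rho * r = r `^ (chi / 8 + 1) by rewrite pD powRr1 // ltW.
  by apply: le_trans t_le _; rewrite -[leRHS]mulrA rr ler_wpM2l // ple //; move: c0 c1; clear; lra.
have tr : t <= r by apply: le_trans t4 _; rewrite ler_piMl // ltW.
have knu : nu * k = Ck * rho.
  by rewrite /k mulrCA -pD; congr (_ * r `^ _); field.
have kd : k <= delta.
  have : Ck / delta * rho <= 1.
    by apply: le_trans Cr; rewrite ler_wpM2r.
  rewrite mulrAC ler_pdivrMr // mul1r => h; apply: le_trans h.
  by rewrite ler_wpM2l // ple //; move: c0 c1; clear; lra.
split=> //.
- by rewrite kd andbT mulr_gt0 // powR_gt0.
- rewrite exprMn -[(t `^ _) ^+ 2]powR_mulrn ?powR_ge0 // -powRrM.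
  set gm := gamma_of chi * 2%:R.
  have gmE : gm * (4 - 2 * chi) = 4 - 3 * chi.
    rewrite /gm /gamma_of; field; move: c1; clear; lra.
  have gm0 : 0 <= gm.
    have h : 0 <= gm * (4 - 2 * chi) by rewrite gmE; move: c1; clear; lra.
    by rewrite -(pmulr_lge0 _ (_ : 0 < 4 - 2 * chi)) //; move: c1; clear; lra.
  clearbody gm; have gm1 : gm <= 1 by move: gmE gm0 c0 c1; clear; nra.
  have tg : t `^ gm <= 4 * r `^ (2 - 13 * chi / 8).
    apply: (@le_trans _ _ ((4 * r `^ (2 - 13 * chi / 16)) `^ gm)).
      by apply: ge0_ler_powR => //; rewrite nnegrE ?mulr_ge0.
    rewrite powRM // ler_pM ?powR_ge0 //.
      by rewrite -[leRHS]powRr1 //; apply: ler_powR; rewrite ?ler1n.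
    rewrite -powRrM ple //; move: gmE gm0 gm1 c0 c1; clear; nra.
  apply: (@le_trans _ _ (K0 ^+ 2 * (4 * r `^ (2 - 13 * chi / 8)))).
    by rewrite ler_wpM2l // sqr_ge0.
  rewrite /k; move: (r `^ _) (pge (2 - 13 * chi / 8)) => p p0.
  have CkE : delta * Ck = K0 ^+ 2 + delta by rewrite /Ck; field; rewrite gt_eqF.
  have -> : 4 * delta * (Ck * p) = K0 ^+ 2 * (4 * p) + 4 * (delta * p).
    by rewrite -[_ * (4 * p)]mulrC; ring: CkE.
  by rewrite lerDl !mulr_ge0 // ltW.
have Qt : Q * t <= 4 * rho.
  apply: (@le_trans _ _ (Q * (4 * r `^ (2 - 13 * chi / 16)))); first by rewrite ler_wpM2l.
  have -> : 2 - 13 * chi / 16 = chi / 16 + (2 - 14 * chi / 16) by field.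
  rewrite pD mulrCA ler_wpM2l // mulrA -[leRHS]mul1r ler_pM ?mulr_ge0 //.
  by apply: ple; move: c0 c1; clear; lra.
split.
  have e1 : 4 * nu * k * d%:R = 4 * Ck * d%:R * rho.
    by rewrite -[4 * nu * k]mulrA knu; ring.
  have e2 : 2 * kap * X <= 2 * (16 * rho) * X by rewrite ler_wpM2r // ler_wpM2l.
  have e3 : 2 * kap * (K1 * r) <= 2 * (16 * rho) * (K1 * 1).
    have r_ge := ltW r0.
    by apply: ler_pM; [nonneg | nonneg | exact: ler_wpM2l | exact: ler_wpM2l].
  have e4 : K1 * (d%:R * Q * t) <= K1 * (d%:R * (4 * rho)).
    by rewrite -[d%:R * Q * t]mulrA; apply: ler_wpM2l => //; exact: ler_wpM2l.
  apply: (@le_trans _ _ (C1 * rho)); last by rewrite ler_wpM2r.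
  rewrite e1 /C1 -/X; move: e2 e3 e4.
  move: (2 * kap * X) (2 * kap * _) (K1 * (d%:R * Q * t)) => a1 a2 a3; clear; lra.
set W := r ^- 2.
have WE : W = r `^ (- 2) by rewrite powRN -p2.
have W1 : 1 <= W by rewrite WE -[leLHS](powRr0 r); apply: ple; clear; lra.
have nuW : nu <= W by rewrite WE ple // lerN2; move: c0 c1; clear; lra.
have QW : Q <= W.
  rewrite /W -[leRHS]mul1r ler_pdivlMr ?exprn_gt0 //; apply: le_trans Qr.
  by rewrite ler_wpM2l // p2 ple //; move: c1; clear; lra.
have nut : nu * t <= 4.
  rewrite /t mulrCA divff ?gt_eqF // mulr1; apply: (@le_trans _ _ (2 * (2 * 1))); last by clear; lra.
  rewrite ler_wpM2l // (le_trans Sr) // ler_wpM2l // -[leRHS](powRr0 r).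
  by apply: ple; move: c0; clear; lra.
have kap16 : kap <= 16 by apply: le_trans kap_le _; move: rho1; clear; lra.
have kr : kap * r <= 16 by rewrite -[leRHS]mulr1 ler_pM // ltW.
apply: (@le_trans _ _ (C2 * W)); last first.
  by rewrite ler_wpM2r ?(le_trans _ W1).
have f1 : X * (2 * nu + 2 * kap) <= X * (34 * W).
  by rewrite ler_wpM2l //; move: nuW kap16 W1; clear; lra.
have f2 : K1 * (d%:R * Q + 2 * nu * t + 2 * kap * r + M + 3) <=
    K1 * ((d%:R + 8 + 32 + M + 3) * W).
  rewrite ler_wpM2l //.
  have g1 : d%:R * Q <= d%:R * W by rewrite ler_wpM2l.
  have g2 : M <= M * W by rewrite ler_peMr.
  move: nut kr g1 g2; rewrite -[2 * nu * t]mulrA -[2 * kap * r]mulrA.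
  move: (nu * t) (kap * r) (d%:R * Q) W1 => a1 a2 a3; clear; lra.
move: f1 f2; rewrite /C2; move: (X * (_ + _)) (K1 * (_ * Q + _ + _ + _ + _)) W1 => a1 a2; clear; lra.
Qed.

(** All analytic constants are merged into one [C] depending on [G] but not on the coefficients or
    [K]; the conclusions of the theorem are then choices of [r], [eps] and [lam]. *)
Lemma max_min_gap {R : realType} {d : nat} (delta deltahat chi K0 K1 : R)
    (P : jet R d -> R) (G : set 'rV[R]_d) :
  (0 < d)%N -> 0 < chi < 1 -> 0 < deltahat < delta -> 0 <= K0 -> K0 <= K1 ->
  cutoff_function deltahat K1 P -> interior_C1chi_estimate delta chi K0 P ->
  C2_bounded_domain G ->
  exists C, 1 <= C /\ forall (omega : R -> R) (A B : metricType R)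
    (D : @coefficients R d A B) (g : 'rV[R]_d -> R),
    admissible delta chi K0 omega D g ->
  forall (K r eps lam : R) (u v : 'rV[R]_d -> R),
    solves_max D P G g K u -> solves_min D P G g K v ->
    0 < r -> 0 < eps <= 1 -> 2 * r < eps -> lam <= 1 ->
    C * eps ^- 2 * r `^ (chi / 16) <= 1 ->
    C * (r `^ (chi / 8) + eps ^- 2 * omega r) < lam -> C * r ^- 2 < K ->
    forall x, G x -> `|u x - v x| <= lam + C * eps.
Proof.
move=> d0 chi01 /andP [dh0 dh] K00 K01 Pcut /[swap] GC /(_ G GC) [N0 hN0].
have [[z0 Gz0] oG _ bG _] := GC.
have K10 := le_trans K00 K01; have dl0 := lt_trans dh0 dh.
have fG := frontier_nonempty d0 (ex_intro _ z0 Gz0) oG bG.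
have [x0 fx0] := fG.
have [N [N_gt0 hN]] := @two_sided_boundary R d P delta deltahat chi K0 K1 G d0 dh0 dh
  K00 K01 Pcut GC.
have [mu [rb [Dm [c0 [mu0 rb0 c00 Dm0 hbar]]]]] := exterior_barrier GC dh0 K10.
(* One barrier is enough: its annulus contains the whole closure of [G], so any frontier point will
   do. *)
have [y0 [_ ann bar]] := hbar x0 fx0.
have [B0 [B_gt0 hB]] := bounded_enorm bG.
pose M := K0 + N * (2 * B0).
have M0 : 0 <= M by rewrite addr_ge0 // mulr_ge0 ?(ltW N_gt0) // mulr_ge0 // ltW.
have [C1 [C1_gt0 hC1]] := doubling_rates d dl0 dh0 chi01 K00 K10 M0.
pose C0 := 1 + `|N0|.
have C01 : 1 <= C0 by rewrite lerDl.
pose C2 := K0 * (d%:R + M + 1) * C0.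
have C20 : 0 <= C2.
  have C0_ge := le_trans ler01 C01.
  by apply: mulr_ge0 => //; apply: mulr_ge0 => //; rewrite addr_ge0 // addr_ge0.
(* The term [6 * N] comes from two solutions, each within [N * (3 * eps)] of the same boundary
   value. Division by [c0] turns the coupling errors into a lower bound for [lam]. *)
pose C := C0 + C1 + 6 * N + C1 / c0 + C2 / c0.
have q1 : 0 < C1 / c0 by rewrite divr_gt0.
have q2 : 0 <= C2 / c0 by rewrite divr_ge0 // ltW.
have [CC0 CC1 CN Cq1 Cq2] : [/\ C0 <= C, C1 <= C, 6 * N <= C, C1 / c0 <= C & C2 / c0 <= C].
  by rewrite /C; move: C01 C1_gt0 N_gt0 q1 q2; clear; split; lra.
have C_ge1 : 1 <= C := le_trans C01 CC0.
clearbody C; exists C; split=> //.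
move=> omega A B D g Dadm K r eps lam u v solu solv r0 /andP [eps0 eps1] r_eps lam1.
move=> hQ hlam hK.
have K_ge0 : 0 <= K.
  by apply: le_trans (ltW hK); rewrite mulr_ge0 ?invr_ge0 ?sqr_ge0 // (le_trans _ C_ge1).
have tu := solves_max_two_sided dh0 dh K01 Dadm solu.
have tv := solves_min_two_sided dh0 dh K01 Dadm oG solv.
have [_ [_ om_mono om0] _ _ _] := Dadm.
have om_ge0 : 0 <= omega r.
  by rewrite -om0 om_mono // ?in_itv /= ?andbT ?lexx // ltW.
(* The estimate has the factor [eps^(-1 - chi)], which is at most [eps^(-2)] as [chi < 1] and
   [eps <= 1]. *)
pose Q := C0 * eps ^- 2.
have E1 : 1 <= eps ^- 2.
  by rewrite -[leLHS]invr1 lef_pV2 ?posrE ?exprn_gt0 // exprn_ile1 // ltW.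
have Q1 : 1 <= Q by rewrite -[leLHS]mulr1 ler_pM.
have NQ : N0 * eps `^ (- 1 - chi) <= Q.
  apply: (@le_trans _ _ (C0 * eps `^ (- 1 - chi))).
    by rewrite ler_wpM2r ?powR_ge0 // (le_trans (ler_norm _)) // lerDr.
  rewrite ler_wpM2l ?(le_trans _ C01) //.
  have -> : eps ^- 2 = eps `^ (- 2%:R) by rewrite powR_invn // ltW.
  apply: ger_powR; first by rewrite eps0.
  by have /andP [_] := chi01; clear; lra.
have r1 : r <= 1 by move: r0 eps1 r_eps; clear; lra.
have [nu [k [nu0 t_r /andP [k0 kd] kt [errC KC]]]] : exists nu k,
    let S := Q * (2 * r) `^ chi in let t := 2 * S / nu in
    let kap := 4 * S ^+ 2 / (nu * r ^+ 2) in
    [/\ 0 < nu, t <= r, 0 < k <= delta,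
        (K0 * t `^ gamma_of chi) ^+ 2 <= 4 * delta * k &
        4 * nu * k * d%:R + 2 * kap * (d%:R / deltahat) + 2 * kap * (K1 * r)
          + K1 * (d%:R * Q * t) <= C1 * r `^ (chi / 8) /\
        d%:R / deltahat * (2 * nu + 2 * kap)
          + K1 * (d%:R * Q + 2 * nu * t + 2 * kap * r + M + 3) + 1 <= C1 * r ^- 2].
  apply: hC1 => //; first by rewrite r0.
    by apply: le_trans hQ; rewrite ler_wpM2r ?powR_ge0 // ler_wpM2r ?(le_trans _ E1).
  have h1 : C1 * r `^ (chi / 8) <= C * (r `^ (chi / 8) + eps ^- 2 * omega r).
    rewrite ler_pM ?(ltW C1_gt0) ?powR_ge0 //.
    by rewrite lerDl mulr_ge0 // (le_trans _ E1).
  by apply: le_trans h1 (le_trans (ltW hlam) lam1).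
have lam0 : 0 < lam.
  apply: le_lt_trans hlam; rewrite mulr_ge0 ?(le_trans _ C_ge1) //.
  by rewrite addr_ge0 ?powR_ge0 // mulr_ge0 // (le_trans _ E1).
(* The argument needs the Hoelder bound for the second function only, so it can be run in both
   orders. *)
have gapUV U V : two_sided D P g G K U -> two_sided D P g G K V ->
    (inner_set G eps !=set0 ->
      (C1norm chi (inner_set G eps) V <= (N0 * eps `^ (- 1 - chi))%:E)%E) ->
    forall x, G x -> U x - V x <= lam + C * eps.
  move=> tU tV hV x Gx.
  have hU1 := hN omega A B D g K U Dadm K_ge0 tU.
  have hV1 := hN omega A B D g K V Dadm K_ge0 tV.
  have gK := (admissible_C11_bound d0 Dadm).2.
  have bdM W : (forall x x0, G x -> frontier G x0 -> `|W x - g x0| <= N * enorm (x - x0)) ->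
      forall y, G y -> `|W y| <= M.
    move=> hW y Gy; rewrite -[W y](subrK (g x0)) (le_trans (ler_normD _ _)) // addrC lerD //.
      by have [] := gK x0 x0.
    apply: le_trans (hW y x0 Gy fx0) _; rewrite ler_wpM2l ?(ltW N_gt0) //.
    have := hB y (subset_closure Gy); have := hB x0 (proj1 fx0); have := enormB y x0.
    by move: (enorm _) (enorm _) (enorm _) => e1 e2 e3; clear; lra.
  have VQ y y' : inner_set G eps y -> inner_set G eps y' ->
      `|V y - V y'| <= Q * enorm (y - y') /\
      enorm (grad V y - grad V y') <= Q * enorm (y - y') `^ chi.
    move=> iy iy'; have Q0 : 0 <= Q by rewrite (le_trans _ Q1).
    have [->|/eqP ne] := eqVneq y y'.
      by rewrite !subrr normr0 enorm0 mulr0 mulr_ge0 // powR_ge0.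
    have off : offdiag (inner_set G eps) !=set0 by exists (y, y').
    have hVQ : (C1norm chi (inner_set G eps) V <= Q%:E)%E.
      by apply: le_trans (hV _) _; [exists y | rewrite lee_fin].
    have [chi0 _] := andP chi01.
    by have [_ _ h1 h2] := C1norm_bounds chi0 off hVQ; split; [exact: h1|exact: h2].
  have near_bd z : G z -> dist_to (frontier G) z <= 2 * eps -> U z - V z <= 6 * N * eps.
    move=> Gz hz; have hz3 : dist_to (frontier G) z < 3 * eps by move: eps0 hz; clear; lra.
    have [w [fw hw]] := dist_to_lt fG hz3.
    have := hU1 z w Gz fw; have := hV1 z w Gz fw; rewrite !ler_distl.
    have : N * enorm (z - w) <= N * (3 * eps) by rewrite ler_wpM2l ?(ltW N_gt0) // ltW.
    by move: (N * enorm _) => X h /andP [h1 _] /andP [_ h2]; move: h h1 h2; clear; lra.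
  have Bd0 : 0 <= 6 * N * eps by rewrite !mulr_ge0 // ltW.
  apply: (@le_trans _ _ (lam + 6 * N * eps)); last first.
    by rewrite lerD2l ler_wpM2r ?(ltW eps0).
  apply: (@comparison R d A B D P delta deltahat chi K0 K1 omega g d0 dh0 dh chi01 K00 K01
    Pcut Dadm G U V K GC tU tV mu rb Dm c0 y0 mu0 rb0 Dm0 c00 ann bar lam eps Q M
    r nu k (K0 * omega r)) => //.
  - exact: lt_le_trans Q1.
  - rewrite ler_wpM2l // om_mono // in_itv /= andbT; last exact: ltW.
    apply: divr_ge0; last exact: ltW.
    apply: mulr_ge0 => //; apply: mulr_ge0; last exact: powR_ge0.
    exact: le_trans Q1.
  - exact: bdM.
  - exact: bdM.
  - have w_le : K0 * omega r * (d%:R * Q + M + 1) <= C2 * (eps ^- 2 * omega r).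
      have -> : C2 * (eps ^- 2 * omega r) = K0 * omega r * ((d%:R + M + 1) * Q).
        by rewrite /C2 /Q; move: (eps ^- 2) => ?; ring.
      rewrite ler_wpM2l ?mulr_ge0 //.
      have aux q : 1 <= q -> d%:R * q + M + 1 <= (d%:R + M + 1) * q.
        by move=> q_ge1; have := ler_peMr M0 q_ge1; move: q_ge1; clear; lra.
      exact: aux.
    have rho0 : 0 <= r `^ (chi / 8) by exact: powR_ge0.
    have eo0 : 0 <= eps ^- 2 * omega r by rewrite mulr_ge0 // (le_trans _ E1).
    have hc : c0 * C * r `^ (chi / 8) + c0 * C * (eps ^- 2 * omega r) < lam * c0.
      by rewrite -mulrDr -mulrA mulrC ltr_pM2r.
    have cC1 : C1 <= c0 * C by rewrite -ler_pdivrMl // mulrC.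
    have cC2 : C2 <= c0 * C by rewrite -ler_pdivrMl // mulrC.
    have h1 : C1 * r `^ (chi / 8) <= c0 * C * r `^ (chi / 8) by rewrite ler_wpM2r.
    have h2 : C2 * (eps ^- 2 * omega r) <= c0 * C * (eps ^- 2 * omega r).
      by rewrite ler_wpM2r.
    move: errC w_le h1 h2 hc => /=.
    move: (K0 * _ * _) (K1 * _) (2 * _ * _) (2 * _ * _) (4 * _ * _ * _).
    move: (C1 * _) (C2 * _) (c0 * C * _) (c0 * C * _) => ????????? ; clear; lra.
  - apply: le_lt_trans KC _; apply: le_lt_trans hK.
    by rewrite ler_wpM2r ?invr_ge0 ?sqr_ge0.
have eps01 : 0 < eps <= 1 by rewrite eps0.
have nrm := hN0 omega A B D g Dadm K eps u v K_ge0 solu solv eps01.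
move=> x Gx; rewrite ler_norml lerNl opprB; apply/andP; split.
  by apply: (gapUV v u) => // /nrm [].
by apply: (gapUV u v) => // /nrm [].
Qed.

Theorem theorem2p4 (R : realType) (d : nat)
    (delta deltahat chi K0 K1 : R) (P : jet R d -> R)
    (d_gt0 : (0 < d)%N)
    (delta01 : 0 < delta < 1) (chi01 : 0 < chi < 1)
    (deltahatP : 0 < deltahat < delta)
    (K0_ge0 : 0 <= K0) (K0_le_K1 : K0 <= K1)
    (P_cutoff : cutoff_function deltahat K1 P)
    (P_solvable : uniquely_solvable delta chi K0 P)
    (chi_estimate : interior_C1chi_estimate delta chi K0 P) :
  (forall (G : set 'rV[R]_d) (omega : R -> R) (A B : metricType R)
      (D : @coefficients R d A B) (g : 'rV[R]_d -> R)
      (u v : R -> 'rV[R]_d -> R),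
    C2_bounded_domain G -> admissible delta chi K0 omega D g ->
    (forall K, 0 <= K ->
       solves_max D P G g K (u K) /\ solves_min D P G g K (v K)) ->
    forall e : R, 0 < e ->
      \forall K \near +oo, forall x, G x -> `|u K x - v K x| <= e)
  /\
  (forall tau : R, 0 < tau < 1 ->
    exists xi : R, 0 < xi < 1 /\
    forall G : set 'rV[R]_d, C2_bounded_domain G ->
    exists N : R, 0 < N /\
    forall (omega : R -> R) (A B : metricType R)
      (D : @coefficients R d A B) (g : 'rV[R]_d -> R),
      (forall t, 0 <= t -> omega t = t `^ tau) ->
      admissible delta chi K0 omega D g ->
    forall (K : R) (u v : 'rV[R]_d -> R),
      solves_max D P G g K u -> solves_min D P G g K v ->
      N <= K ->
      forall x, G x -> `|u x - v x| <= N * K `^ (- xi)).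
Proof.
have gap G := fun GC => @max_min_gap R d delta deltahat chi K0 K1 P G d_gt0 chi01 deltahatP
  K0_ge0 K0_le_K1 P_cutoff chi_estimate GC.
have /andP [chi0 chi1] := chi01.
split=> [G omega A B D g u v GC Dadm sol e e0|tau /andP [tau0 tau1]].
  have [C [C1 hC]] := gap G GC.
  have C0 : 0 < C := lt_le_trans ltr01 C1.
  (* [e] is split evenly between [C * eps] and [lam]; then [r] is taken small for these two, and
     finally [K] large for [r]. *)
  pose eps := Num.min 1 (e / (2 * C)).
  pose lam := Num.min 1 (e / 2).
  have eps0 : 0 < eps by rewrite lt_min ltr01 /= divr_gt0 // mulr_gt0.
  have eps1 : eps <= 1 by rewrite ge_min lexx.
  have epsC : C * eps <= e / 2.
    have : eps <= e / (2 * C) by rewrite ge_min lexx orbT.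
    by rewrite ler_pdivlMr ?mulr_gt0 //; clear; lra.
  have lam0 : 0 < lam by rewrite lt_min ltr01 /= divr_gt0.
  have lam1 : lam <= 1 by rewrite ge_min lexx.
  have lame : lam <= e / 2 by rewrite ge_min lexx orbT.
  have [_ [om_cont _ om0] _ _ _] := Dadm.
  have om_cvg : omega r @[r --> 0^'+] --> (0 : R).
    by have [_] := (continuous_within_itvcyP 0 omega).1 om_cont; rewrite om0.
  have b1 : 0 < eps ^+ 2 / C by rewrite divr_gt0 // exprn_gt0.
  have b2 : 0 < lam / (2 * C) by rewrite divr_gt0 // mulr_gt0.
  have b3 : 0 < lam * eps ^+ 2 / (2 * C) by rewrite divr_gt0 ?mulr_gt0 // exprn_gt0.
  have b4 : 0 < eps / 2 by rewrite divr_gt0.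
  have c1 : 0 < chi / 16 by rewrite divr_gt0.
  have c2 : 0 < chi / 8 by rewrite divr_gt0.
  have [r [r0 [r_eps [r1 [r2 r3]]]]] : exists r : R, 0 < r /\ r < eps / 2 /\
      r `^ (chi / 16) < eps ^+ 2 / C /\ r `^ (chi / 8) < lam / (2 * C) /\
      omega r < lam * eps ^+ 2 / (2 * C).
    near (0 : R)^'+ => r; exists r; split; first by near: r; exact: nbhs_right_gt.
    split; first by near: r; exact: nbhs_right_lt.
    split; first by near: r; exact: (cvgr_lt _ (powR_cvg0 c1)).
    split; first by near: r; exact: (cvgr_lt _ (powR_cvg0 c2)).
    by near: r; exact: (cvgr_lt _ om_cvg).
  near=> K => x Gx.
  have K0' : 0 <= K by near: K; exact: nbhs_pinfty_ge.
  have KC : C * r ^- 2 < K by near: K; apply: nbhs_pinfty_gt; rewrite num_real.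
  have [solu solv] := sol K K0'.
  have eps2 : 0 < eps ^+ 2 by rewrite exprn_gt0.
  have := hC omega A B D g Dadm K r eps lam (u K) (v K) solu solv r0.
  rewrite eps0 eps1 => /(_ isT) h; apply: le_trans (h _ lam1 _ _ KC x Gx) _.
  - by rewrite -ltr_pdivlMl // mulrC.
  - move: r1; rewrite ltr_pdivlMr // => /ltW r1.
    by rewrite mulrAC ler_pdivrMr // mul1r mulrC.
  - move: r2 r3; rewrite !ltr_pdivlMr ?mulr_gt0 // => r2 r3.
    have : C * (omega r / eps ^+ 2) < lam / 2.
      by rewrite mulrA ltr_pdivrMr //; move: r3; clear; lra.
    by rewrite mulrDr [eps ^- 2 * _]mulrC; move: r2; clear; lra.
  - by move: lame epsC; clear; lra.
(* For eps = r^(2 xi) and r^2 of order 1 / K all errors are O(eps), because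
   6 xi <= chi / 16 and 6 xi <= tau. *)
pose xi := tau * chi / 256.
have xi0 : 0 < xi.
  by apply: divr_gt0; [exact: mulr_gt0 | rewrite ltr0n].
have xi_tau : 256 * xi <= tau.
  by have := ler_piMr (ltW tau0) (ltW chi1); rewrite /xi; clear; lra.
have xi_chi : 256 * xi <= chi.
  by have := ler_piMl (ltW chi0) (ltW tau1); rewrite /xi; clear; lra.
have xi1 : 0 < xi < 1 by rewrite xi0; move: xi_tau tau1 xi0; clear; lra.
clearbody xi; exists xi; split=> //.
move=> G GC; have [C [C1 hC]] := gap G GC.
have C0 : 0 < C := lt_le_trans ltr01 C1.
have p0 : 0 <= (3 * C) `^ xi^-1 := powR_ge0 _ _.
(* The first term is the constant in the final bound [4 * C * eps] with [eps <= 2 * C * K^(- xi)];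
   the second ensures [3 * C * eps <= 1]. *)
pose N := 8 * C ^+ 2 + 2 * C * (3 * C) `^ xi^-1.
have C2 : C <= C ^+ 2 by rewrite expr2 ler_peMr // ltW.
exists N; split.
  by rewrite /N ltr_wpDr ?mulr_ge0 ?mulr_gt0 ?exprn_gt0 // ltW.
move=> omega A B D g om Dadm K u v solu solv NK x Gx.
have n1 : 8 * C ^+ 2 <= K by apply: le_trans NK; rewrite lerDl !mulr_ge0 // ltW.
have n2 : 2 * C * (3 * C) `^ xi^-1 <= K.
  by apply: le_trans NK; rewrite lerDr mulr_ge0 // sqr_ge0.
have Kp : 0 < K by move: C0 C2 n1; clear; lra.
(* With [r^2 = b] the cut-off requirement reads [C * r^(-2) = K / 2 < K]. *)
pose b := 2 * C / K.
have b0 : 0 < b by rewrite !(divr_gt0, mulr_gt0).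
have b1 : b <= 1 by rewrite ler_pdivrMr // mul1r; move: C0 C2 n1; clear; lra.
pose r := b `^ 2^-1; pose eps := r `^ (2 * xi).
have r0 : 0 < r by exact: powR_gt0.
have r1 : r <= 1 by rewrite -(powRr0 b); apply: ger_powR; [rewrite b0 | clear; lra].
have rE : r ^+ 2 = b.
  by rewrite -powR_mulrn ?(ltW r0) // -powRrM mulVf // powRr1 // ltW.
have epsE : eps = b `^ xi by rewrite /eps /r -powRrM mulrA mulVf // mul1r.
have epsR : eps = r `^ (2 * xi) by [].
clearbody eps r.
have pD a1 a2 : r `^ (a1 + a2) = r `^ a1 * r `^ a2.
  by rewrite powRD //; apply/implyP => _; rewrite gt_eqF.
have ple a : 2 * xi <= a -> r `^ a <= eps.
  by move=> h; rewrite epsR; apply: ger_powR => //; rewrite r0.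
have eps0 : 0 < eps by rewrite epsR; exact: powR_gt0.
have epsC : 3 * C * eps <= 1.
  have C3 : 0 < 3 * C by rewrite mulr_gt0.
  rewrite mulrC -ler_pdivlMr // mul1r epsE.
  apply: (@le_trans _ _ (((3 * C) `^ (- xi^-1)) `^ xi)).
    apply: ge0_ler_powR; rewrite ?nnegrE ?powR_ge0 ?(ltW xi0) ?(ltW b0) //.
    rewrite powRN ler_pdivrMr // ler_pdivlMl ?powR_gt0 //.
    by rewrite mulrC.
  by rewrite -powRrM mulNr mulVf ?gt_eqF // powR_inv1 // ltW.
have eps1 : eps <= 1 by apply: le_trans epsC; rewrite ler_peMl ?(ltW eps0) //; move: C1; clear; lra.
have epsV : eps ^- 2 = r `^ (- (4 * xi)).
  rewrite powRN -powR_mulrn ?(ltW eps0) // epsR -powRrM.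
  by congr (_ `^ _)^-1; ring.
(* Both error terms are at most [eps], so [lam] only has to exceed [2 * C * eps]. *)
have := hC omega A B D g Dadm K r eps (3 * C * eps) u v solu solv r0.
rewrite eps0 eps1 => /(_ isT) h; apply: le_trans (h _ epsC _ _ _ x Gx) _.
- have : r <= eps * eps.
    rewrite -[leLHS]powRr1 ?(ltW r0) //.
    have -> : 1 = 2 * xi + (1 - 2 * xi) by ring.
    by rewrite pD -epsR ler_wpM2l ?(ltW eps0) // ple //; move: xi_chi chi1; clear; lra.
  have : 3 * (eps * eps * C) <= eps.
    have -> : 3 * (eps * eps * C) = eps * (3 * C * eps) by ring.
    by rewrite -[leRHS]mulr1 ler_wpM2l // ltW.
  have : 0 < eps * eps by rewrite mulr_gt0.
  have : eps * eps <= eps * eps * C by rewrite ler_peMr // mulr_ge0 // ltW.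
  by move: (eps * eps * C) (eps * eps) => e3 e2; clear -C1; lra.
- rewrite epsV -mulrA -pD; apply: le_trans epsC.
  apply: (@le_trans _ _ (C * eps)); last by rewrite ler_wpM2r ?(ltW eps0) //; move: C0; clear; lra.
  by rewrite ler_wpM2l ?(ltW C0) // ple //; move: xi_chi xi0; clear; lra.
- rewrite (om _ (ltW r0)) epsV -pD.
  have h1 : r `^ (chi / 8) <= eps by apply: ple; move: xi_chi xi0; clear; lra.
  have h2 : r `^ (- (4 * xi) + tau) <= eps by apply: ple; move: xi_tau xi0; clear; lra.
  apply: (@le_lt_trans _ _ (C * (2 * eps))).
    by rewrite ler_wpM2l ?(ltW C0) //; move: h1 h2; clear; lra.
  by have : 0 < C * eps by [rewrite mulr_gt0]; clear; lra.
- have -> : C * r ^- 2 = K / 2.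
    by rewrite rE /b; field; rewrite !gt_eqF.
  by move: Kp; clear; lra.
have -> : 3 * C * eps + C * eps = 4 * C * eps by ring.
have bE : eps <= 2 * C * K `^ (- xi).
  rewrite epsE /b powRM ?invr_ge0 ?mulr_ge0 ?(ltW Kp) ?(ltW C0) //.
  rewrite -powR_inv1 ?(ltW Kp) // -powRrM mulN1r ler_wpM2r ?powR_ge0 //.
  rewrite -[leRHS]powRr1 ?mulr_ge0 ?(ltW C0) //; apply: ler_powR.
    by move: C1; clear; lra.
  by have /andP [_] := xi1; clear; lra.
have K1' : 0 <= K `^ (- xi) := powR_ge0 _ _.
apply: (@le_trans _ _ (4 * C * (2 * C * K `^ (- xi)))).
  by rewrite ler_wpM2l // mulr_ge0 // ltW.
rewrite (_ : 4 * C * _ = 8 * C ^+ 2 * K `^ (- xi)); last by ring.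
by rewrite ler_wpM2r // lerDl !mulr_ge0 // ltW.
Unshelve. all: by end_near.
Qed.
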